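(* Let $F$ be a finite-dimensional complex Hilbert space. A closed subspace $M$ of $H_F^2$ is $S_F^*$-almost invariant if and only if one of the following holds: (1) $M=R(T_\Theta)$, where $\Theta\in H^\infty_{B(E,F)}$ is inner. In this case, $\varsigma(S_F^*,M)=\dim E-\operatorname{rank}(U)$, where $U$ is the unitary part of $\Theta$. (2) $M=R\big(T_\Phi(I_{E_1}-T_\Theta T_\Theta^* )\big)$, where $\Theta\in H^\infty_{B(E,E_1)}$ is inner and pure, $\Phi\in H^2_{B(E_1,F)}$, $\dim E_1<\infty$, and $T_\Phi(I_{E_1}-T_\Theta T_\Theta^* )$ is a partial isometry. In this case, a minimal defect space (of $M$ for $S_F^*$) is $$W:=R(S_F^*T_\Phi P_{E_1})\ominus\big[R(S_F^*T_\Phi P_{E_1})\cap M\big]$$ and $\varsigma(S_F^*,M)=\dim W$.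
   Context: All coefficient spaces $E,E_1,F$ are finite-dimensional complex Hilbert spaces ($E$, $E_1$ are existentially quantified in (1) and (2)). $L_E^2$ is the space of square-integrable $E$-valued functions on the unit circle $\mathbb T$ (normalized Lebesgue measure), $H_E^2$ is the $E$-valued Hardy space, $P:L_E^2\to H_E^2$ is the orthogonal projection. $B(E,F)$ is the space of linear operators from $E$ to $F$; $H^\infty_{B(E,F)}$ and $H^2_{B(E,F)}$ are the spaces of $B(E,F)$-valued analytic functions with entries in $H^\infty$, resp. $H^2$. $S_F$ is the shift $f\mapsto zf$ on $H_F^2$, $S_F^*$ its adjoint. $E_1$ is identified with the constant functions in $H_{E_1}^2$, and $P_{E_1}=I-S_{E_1}S_{E_1}^*$ is the orthogonal projection of $H_{E_1}^2$ onto $E_1$. $R(T)$ denotes the range of $T$. $T_\Phi h=P[\Phi h]$ is the Toeplitz operator $H_{E_1}^2\to H_F^2$ (for analytic $\Phi$, $T_\Phi h=\Phi h$). When $\Phi\in H^2_{B(E_1,F)}$, $T_\Phi$ may be unbounded; it is defined on polynomials and $H^\infty$ functions, operator equations are understood on such functions, and ''$T_\Phi(I_{E_1}-T_\Theta T_\Theta^* )$ is a partial isometry'' means that this operator (well defined on polynomials) extends to a bounded operator $H_{E_1}^2\to H_F^2$ which is a partial isometry. In $I_{E_1}-T_\Theta T_\Theta^*$, $I_{E_1}$ stands for the identity on $H_{E_1}^2$. $\Theta\in H^\infty_{B(E,E_1)}$ is inner if $\Theta(z)^*\Theta(z)=I_E$ for almost all $z\in\mathbb T$; a contractive analytic function $B\in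 H^\infty_{B(E,F)}$ is pure if $\|B(0)v\|<\|v\|$ for all $v\in E\setminus\{0\}$. Any contractive $B\in H^\infty_{B(E,F)}$ decomposes as $B(z)=B_1(z)\oplus U:\ E=E'\oplus E''\to F=F'\oplus F''$ with $B_1$ pure ($B(E',F')$-valued) and $U$ a constant unitary from $E''$ onto $F''$; $U$ is called the unitary part of $B$ (possibly acting on $\{0\}$), with $\operatorname{rank}(U)=\dim E''$. For a bounded operator $T$ on a Hilbert space $H$, a closed subspace $H_1$ is $T$-almost invariant if there is a finite-dimensional subspace $W$ with $TH_1\subset H_1+W$. The minimal possible dimension of $W$ is the defect, denoted $\varsigma(T,H_1)$, and any $W$ attaining it is a minimal defect space. *)

(* Defs.v *)
From HB Require Import structures.
From mathcomp Require Import all_boot all_order all_algebra.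
From mathcomp Require Import complex.
From mathcomp Require Import all_classical all_reals all_analysis.
From mathcomp Require Import sesquilinear.

Set Implicit Arguments.
Unset Strict Implicit.
Unset Printing Implicit Defensive.

Import Order.TTheory GRing.Theory Num.Theory.
Import numFieldNormedType.Exports.

Local Open Scope classical_set_scope.
Local Open Scope complex_scope.
Local Open Scope ring_scope.

(** Finite-dimensional complex Hilbert spaces.  The inner product is linear in
    its first argument; the zero space is allowed. *)

Record fdHilbert (R : realType) := FdHilbert {
  fdH_vect :> vectType R[i];
  fdH_dot : {dot fdH_vect for (@Num.conj R[i])} }.

Definition ip (R : realType) (E : fdHilbert R) (u v : E) : R[i] :=
  fdH_dot E u v.

Definition hnorm (R : realType) (E : fdHilbert R) (u : E) : R :=
  Num.sqrt (complex.Re (ip u u)).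

Definition hadj (R : realType) (E F : fdHilbert R) (A : 'Hom(E, F)) :
    'Hom(F, E) :=
  xget 0 [set B : 'Hom(F, E) | forall u v, ip (A u) v = ip u (B v)].

(** The unit circle.  A function on the circle is represented by a function
    [f : R[i] -> E], of which only the values at points of modulus 1 matter.
    Normalized arc length is the image of Lebesgue measure on [0, 1] under
    t |-> exp (2 i pi t). *)

Definition circ (R : realType) (t : R) : R[i] :=
  cos (2 * pi * t) +i* sin (2 * pi * t).

Definition aeT (R : realType) (P : R[i] -> Prop) : Prop :=
  {ae @lebesgue_measure R, forall t : R, t \in `[0, 1]%R -> P (circ t)}.

Definition eqT (R : realType) (X : Type) (f g : R[i] -> X) : Prop :=
  aeT (fun z => f z = g z).

Definition measT (R : realType) (g : R[i] -> R[i]) : Prop :=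
  measurable_fun (`[0, 1] : set R) (fun t : R => complex.Re (g (circ t))) /\
  measurable_fun (`[0, 1] : set R) (fun t : R => complex.Im (g (circ t))).

Definition intT (R : realType) (g : R[i] -> R[i]) : R[i] :=
  (\int[@lebesgue_measure R]_(t in `[0, 1]) complex.Re (g (circ t)))%R +i*
  (\int[@lebesgue_measure R]_(t in `[0, 1]) complex.Im (g (circ t)))%R.

Definition sq_integrable (R : realType) (r : R[i] -> R) : Prop :=
  (\int[@lebesgue_measure R]_(t in `[0%R, 1%R]) ((r (circ t)) ^+ 2)%:E < +oo)%E.

(** L^2, H^2 and H^oo.  The elements of these spaces are functions, not classes
    of functions: equality in L^2 is [eqT], and subspaces are sets of functions
    saturated for [eqT] inside [H2].  Analyticity is the vanishing of the
    Fourier coefficients of negative index. *)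

Definition scalarH2 (R : realType) (g : R[i] -> R[i]) : Prop :=
  [/\ measT g,
      sq_integrable (fun z => complex.Re `|g z|) &
      forall n : nat, intT (fun z => z ^+ n.+1 * g z) = 0].

Definition scalarHinf (R : realType) (g : R[i] -> R[i]) : Prop :=
  scalarH2 g /\ exists B : R, aeT (fun z => `|g z| <= B%:C).

Definition L2 (R : realType) (E : fdHilbert R) : set (R[i] -> E) :=
  [set f | (forall v : E, measT (fun z => ip (f z) v)) /\
           sq_integrable (fun z => hnorm (f z))].

Definition ip2 (R : realType) (E : fdHilbert R) (f g : R[i] -> E) : R[i] :=
  intT (fun z => ip (f z) (g z)).

Definition norm2 (R : realType) (E : fdHilbert R) (f : R[i] -> E) : R :=
  Num.sqrt (complex.Re (ip2 f f)).

Definition H2 (R : realType) (E : fdHilbert R) : set (R[i] -> E) :=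
  [set f | L2 f /\
    forall (v : E) (n : nat), intT (fun z => z ^+ n.+1 * ip (f z) v) = 0].
Arguments H2 {R} E.

Definition opH2 (R : realType) (E F : fdHilbert R) (Phi : R[i] -> 'Hom(E, F)) :
    Prop :=
  forall (u : E) (v : F), scalarH2 (fun z => ip (Phi z u) v).

Definition opHinf (R : realType) (E F : fdHilbert R)
    (Phi : R[i] -> 'Hom(E, F)) : Prop :=
  forall (u : E) (v : F), scalarHinf (fun z => ip (Phi z u) v).

(** The value at 0 of (the analytic extension to the disc of) a function in H^2
    is its mean over the circle; the vector-valued integral is computed in
    coordinates and does not depend on the basis. *)
Definition at0 (R : realType) (E : fdHilbert R) (f : R[i] -> E) : E :=
  \sum_(i < \dim {:E})
    intT (fun z => coord (vbasis {:E}) i (f z)) *: (vbasis {:E})`_i.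

(** Operators act on functions; each choice made by [xget] below is
    unique up to [eqT]. *)

Definition projH2 (R : realType) (E : fdHilbert R) (f : R[i] -> E) :
    R[i] -> E :=
  xget 0 [set g | H2 E g /\ forall h, H2 E h -> ip2 (f - g) h = 0].

Definition adjH2 (R : realType) (E F : fdHilbert R)
    (T : (R[i] -> E) -> (R[i] -> F)) (g : R[i] -> F) : R[i] -> E :=
  xget 0 [set g' | H2 E g' /\ forall h, H2 E h -> ip2 (T h) g = ip2 h g'].

Definition toeplitz (R : realType) (E F : fdHilbert R)
    (Phi : R[i] -> 'Hom(E, F)) (h : R[i] -> E) : R[i] -> F :=
  projH2 (fun z => Phi z (h z)).

Definition shiftH2 (R : realType) (E : fdHilbert R) (f : R[i] -> E) : R[i] -> E :=
  fun z => z *: f z.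
Arguments shiftH2 {R} E f.

Definition bshift (R : realType) (E : fdHilbert R) : (R[i] -> E) -> R[i] -> E :=
  adjH2 (shiftH2 E).
Arguments bshift {R} E f.

Definition projConst (R : realType) (E : fdHilbert R) (h : R[i] -> E) :
    R[i] -> E :=
  h - shiftH2 E (bshift E h).

Definition rangeH2 (R : realType) (E F : fdHilbert R)
    (T : (R[i] -> E) -> (R[i] -> F)) : set (R[i] -> F) :=
  [set f | H2 F f /\ exists2 h, H2 E h & eqT f (T h)].

Definition bounded_op (R : realType) (E F : fdHilbert R)
    (A : (R[i] -> E) -> (R[i] -> F)) : Prop :=
  [/\ forall h, H2 E h -> H2 F (A h),
      forall (c : R[i]) h g, H2 E h -> H2 E g ->
        eqT (A (c *: h + g)) (c *: A h + A g) &
      exists K : R, forall h, H2 E h -> norm2 (A h) <= K * norm2 h].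

Definition partial_isometry (R : realType) (E F : fdHilbert R)
    (A : (R[i] -> E) -> (R[i] -> F)) : Prop :=
  forall h, H2 E h ->
    (forall g, H2 E g -> eqT (A g) 0 -> ip2 h g = 0) ->
    norm2 (A h) = norm2 h.

Definition poly_fun (R : realType) (E : fdHilbert R) : set (R[i] -> E) :=
  [set p | exists n (a : 'I_n -> E), p = fun z => \sum_(i < n) z ^+ i *: a i].

Definition bounded_extension (R : realType) (E F : fdHilbert R)
    (A T : (R[i] -> E) -> (R[i] -> F)) : Prop :=
  bounded_op A /\ forall p, poly_fun p -> eqT (A p) (T p).

Definition inner_fun (R : realType) (E F : fdHilbert R)
    (Theta : R[i] -> 'Hom(E, F)) : Prop :=
  opHinf Theta /\
  aeT (fun z => (hadj (Theta z) \o Theta z)%VF = \1%VF).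

Definition pure_on (R : realType) (E F : fdHilbert R) (V : {vspace E})
    (B : R[i] -> 'Hom(E, F)) : Prop :=
  forall v, v \in V -> v != 0 -> hnorm (at0 (fun z => B z v)) < hnorm v.

Definition pure_fun (R : realType) (E F : fdHilbert R)
    (B : R[i] -> 'Hom(E, F)) : Prop :=
  pure_on fullv B.

Definition orth_decomp (R : realType) (E : fdHilbert R) (V W : {vspace E}) :
    Prop :=
  (V + W)%VS = fullv /\ forall u v, u \in V -> v \in W -> ip u v = 0.

(** B = B_1 (+) U along E = E' (+) E'' -> F = F' (+) F''; only the restriction
    of [U] to [E''] matters. *)
Definition pure_unitary_decomp (R : realType) (E F : fdHilbert R)
    (B : R[i] -> 'Hom(E, F)) (E' E'' : {vspace E}) (F' F'' : {vspace F})
    (U : 'Hom(E, F)) : Prop :=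
  [/\ orth_decomp E' E'', orth_decomp F' F'',
      aeT (fun z => (B z @: E' <= F')%VS) /\ pure_on E' B,
      aeT (fun z => forall v, v \in E'' -> B z v = U v) &
      (U @: E'')%VS = F'' /\
      forall u v, u \in E'' -> v \in E'' -> ip (U u) (U v) = ip u v].

Definition unitary_rank (R : realType) (E F : fdHilbert R)
    (B : R[i] -> 'Hom(E, F)) : nat :=
  xget 0%N [set r | exists E' E'' F' F'' U,
    pure_unitary_decomp B E' E'' F' F'' U /\ r = \dim E''].

Definition closed_subspace (R : realType) (E : fdHilbert R)
    (M : set (R[i] -> E)) : Prop :=
  [/\ M `<=` H2 E,
      M 0,
      forall (c : R[i]) f g, M f -> M g -> M (c *: f + g) &
      forall f, H2 E f ->
        (forall e : R, 0 < e -> exists2 g, M g & norm2 (f - g) < e) -> M f].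

Definition has_dim (R : realType) (E : fdHilbert R) (W : set (R[i] -> E))
    (k : nat) : Prop :=
  exists w : 'I_k -> (R[i] -> E),
    [/\ forall i, H2 E (w i),
        forall c : 'I_k -> R[i], eqT (\sum_i c i *: w i) 0 -> forall i, c i = 0 &
        W = [set f | H2 E f /\
               exists c : 'I_k -> R[i], eqT f (\sum_i c i *: w i)]].

Definition dimH2 (R : realType) (E : fdHilbert R) (W : set (R[i] -> E)) : nat :=
  xget 0%N [set k | has_dim W k].

Definition defect_space (R : realType) (E : fdHilbert R)
    (T : (R[i] -> E) -> (R[i] -> E)) (M W : set (R[i] -> E)) : Prop :=
  (exists k, has_dim W k) /\
  forall f, M f -> exists g w, [/\ M g, W w & eqT (T f) (g + w)].

Definition almost_invariant (R : realType) (E : fdHilbert R)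
    (T : (R[i] -> E) -> (R[i] -> E)) (M : set (R[i] -> E)) : Prop :=
  exists W, defect_space T M W.

(** The default value 0 is only used when [M] is not almost invariant. *)
Definition defect (R : realType) (E : fdHilbert R)
    (T : (R[i] -> E) -> (R[i] -> E)) (M : set (R[i] -> E)) : nat :=
  xget 0%N [set k | (exists2 W, defect_space T M W & dimH2 W = k) /\
                    forall W, defect_space T M W -> (k <= dimH2 W)%N].

Definition minimal_defect_space (R : realType) (E : fdHilbert R)
    (T : (R[i] -> E) -> (R[i] -> E)) (M W : set (R[i] -> E)) : Prop :=
  defect_space T M W /\ dimH2 W = defect T M.

Definition ominus (R : realType) (E : fdHilbert R) (X Y : set (R[i] -> E)) :
    set (R[i] -> E) :=
  [set f | X f /\ forall g, Y g -> ip2 f g = 0].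

Definition inner_range_rep (R : realType) (E F : fdHilbert R)
    (M : set (R[i] -> F)) (Theta : R[i] -> 'Hom(E, F)) : Prop :=
  inner_fun Theta /\ M = rangeH2 (toeplitz Theta).

Definition compressed_op (R : realType) (E E1 F : fdHilbert R)
    (Theta : R[i] -> 'Hom(E, E1)) (Phi : R[i] -> 'Hom(E1, F))
    (h : R[i] -> E1) : R[i] -> F :=
  toeplitz Phi (h - toeplitz Theta (adjH2 (toeplitz Theta) h)).

(** [compressed_op Theta Phi] makes sense on polynomials; its range is that of
    its bounded extension [A], which is unique up to [eqT]. *)
Definition partial_isometry_rep (R : realType) (E E1 F : fdHilbert R)
    (M : set (R[i] -> F)) (Theta : R[i] -> 'Hom(E, E1))
    (Phi : R[i] -> 'Hom(E1, F)) : Prop :=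
  [/\ inner_fun Theta, pure_fun Theta, opH2 Phi &
      exists A, [/\ bounded_extension A (compressed_op Theta Phi),
                    partial_isometry A & M = rangeH2 A]].

(* Main.v *)
(** Almost invariant subspaces are put in the form (2) as follows.  Let G be the
    orthogonal projection on M^perp of a defect space.  The contraction
    T = (I - P_G) S^* maps M into M and, with J = I - S T, satisfies
    |J f|^2 = |f|^2 - |T f|^2 on M; the space J M has finite dimension, and
    T^n tends strongly to 0.  If (phi_a) is an orthonormal basis of J M, then
    V f = sum_n z^n (<J T^n f, phi_a>)_a is an isometry on M with V T = S^* V,
    and f = Phi (V f) for the matrix Phi with columns phi_a.  By the
    Beurling-Lax theorem V M = (Theta H^2)^perp with Theta inner, and V^* is the
    partial isometry T_Phi (I - T_Theta T_Theta^* ).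

    The stability T^n -> 0 is the heart of the argument: the limit form
    B(x, y) = lim <T^n x, T^n y> vanishes because Schur products of the Gram
    matrices of the vectors S^a g_i, for B and for the scalar product, are
    positive.

    Conversely, in (2) M consists of the Phi k with k in (Theta H^2)^perp, and
    S^* (Phi k) = S^* (Phi k(0)) + Phi S^* k, where k(0) is arbitrary because
    Theta is pure; in (1), S^* (Theta h) = S^* (Theta h(0)) + Theta S^* h.  In both
    cases this exhibits S^* M + M modulo M, whose dimension is the defect. *)

(* T is a finite-rank perturbation of L = S^*, and the perturbation might create vectors on which
   T^n x does not tend to 0; then V would not be isometric, and f = Phi (V f) would miss a remainder
   z^n T^n f. The form B measures this remainder. S is isometric for the scalar product and T for B,
   so the Schur product of the Gram matrices of the S^a g_i and of the T^(N-a) g_i is block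
   Toeplitz. Its square blocks of size n sum to sum_(m < n) (2 Re eps_m - b), with b = sum_i B(g_i,
   g_i) and eps_m -> 0 because L^m g_i -> 0. Positivity for every n forces b = 0. Then T and L agree
   for B, and B(x, x) = B(L^n x, T^n x) -> 0. The second obstacle is that Phi has only H^2 entries:
   multiplication by Phi maps L^2 to L^1 only. It is a closed operator, however, which lets
   identities known for polynomials or partial sums pass to the limit. Working with semi-definite
   forms throughout takes care of equality almost everywhere and also lets B be treated as a scalar
   product on the same functions. *)
Require Import Defs.
From HB Require Import structures.
From mathcomp Require Import all_boot all_order all_algebra.
From mathcomp Require Import complex ring lra.
From mathcomp Require Import all_classical all_reals all_analysis.
From mathcomp Require Import sesquilinear measurable_realfun.

Set Implicit Arguments.
Unset Strict Implicit.
Unset Printing Implicit Defensive.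

Import Order.TTheory GRing.Theory Num.Theory.
Import numFieldNormedType.Exports.

Local Open Scope classical_set_scope.
Local Open Scope complex_scope.
Local Open Scope ring_scope.

(** * Complex numbers and pre-Hilbert spaces *)

Notation cRe := complex.Re.
Notation cIm := complex.Im.
Definition cabs (R : realType) (z : R[i]) : R := cRe `|z|.

Lemma lincombB (K : pzRingType) (V : lmodType K) (c : K) (u v p q : V) :
  c *: u + v - (c *: p + q) = c *: (u - p) + (v - q).
Proof. by rewrite scalerBr opprD addrACA. Qed.

Section ComplexFacts.
Variable R : realType.
Implicit Types z w : R[i].

Lemma normcC z : `|z| = (cabs z)%:C.
Proof. by rewrite /cabs RRe_real // normr_real. Qed.
Lemma cabs_ge0 z : 0 <= cabs z.
Proof. by rewrite -ler0c -normcC. Qed.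
Lemma cabsM z w : cabs (z * w) = cabs z * cabs w.
Proof. by apply: complexI; rewrite -normcC normrM !normcC rmorphM. Qed.
Lemma cabsD z w : cabs (z + w) <= cabs z + cabs w.
Proof. by rewrite -lecR rmorphD /= -!normcC ler_normD. Qed.
Lemma cabsN z : cabs (- z) = cabs z.
Proof. by rewrite /cabs normrN. Qed.
Lemma cabsJ z : cabs z^* = cabs z.
Proof. by rewrite /cabs norm_conjC. Qed.
Lemma cabs0 : cabs (0 : R[i]) = 0. Proof. by rewrite /cabs normr0. Qed.
Lemma cabs0_eq0 z : cabs z = 0 -> z = 0.
Proof. by move=> h; apply/eqP; rewrite -normr_eq0 normcC h. Qed.
Lemma cabs2 z : (cabs z) ^+ 2 = cRe z ^+ 2 + cIm z ^+ 2.
Proof. by apply: complexI; rewrite rmorphXn /= -normcC -add_Re2_Im2. Qed.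
Lemma mul_conjcC z : z * z^* = ((cabs z) ^+ 2)%:C.
Proof. by rewrite -normCK normcC rmorphXn. Qed.
Lemma cRe_conj z : cRe z^* = cRe z. Proof. by case: z. Qed.
Lemma cIm_conj z : cIm z^* = - cIm z. Proof. by case: z. Qed.
Lemma cReD z w : cRe (z + w) = cRe z + cRe w. Proof. by case: z; case: w. Qed.
Lemma cImD z w : cIm (z + w) = cIm z + cIm w. Proof. by case: z; case: w. Qed.
Lemma cReN z : cRe (- z) = - cRe z. Proof. by case: z. Qed.
Lemma cImN z : cIm (- z) = - cIm z. Proof. by case: z. Qed.
Lemma cReM z w : cRe (z * w) = cRe z * cRe w - cIm z * cIm w.
Proof. by case: z; case: w. Qed.
Lemma cImM z w : cIm (z * w) = cRe z * cIm w + cIm z * cRe w.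
Proof. by case: z; case: w. Qed.
Lemma cRe_sum I (r : seq I) (P : pred I) (F : I -> R[i]) :
  cRe (\sum_(i <- r | P i) F i) = \sum_(i <- r | P i) cRe (F i).
Proof. by elim/big_rec2: _ => // i a b _ <-; rewrite cReD. Qed.
Lemma complex_eq z w : cRe z = cRe w -> cIm z = cIm w -> z = w.
Proof. by case: z; case: w => a b c d /= -> ->. Qed.
Lemma cRe_le_cabs z : `|cRe z| <= cabs z.
Proof. by rewrite -lecR -normcC normc_ge_Re. Qed.
Lemma cIm_le_cabs z : `|cIm z| <= cabs z.
Proof.
rewrite -(@ler_pXn2r _ 2) ?nnegrE ?cabs_ge0 // cabs2 real_normK ?num_real //.
by rewrite lerDr sqr_ge0.
Qed.
Lemma cabs_le z : cabs z <= `|cRe z| + `|cIm z|.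
Proof.
rewrite -(@ler_pXn2r _ 2) ?nnegrE ?cabs_ge0 ?addr_ge0 // cabs2.
rewrite sqrrD !real_normK ?num_real //.
have : 0 <= `|cRe z| * `|cIm z| by rewrite mulr_ge0.
lra.
Qed.
Lemma cge0 z : 0 <= z -> z = (cRe z)%:C /\ 0 <= cRe z.
Proof.
move=> h; split; first by rewrite RRe_real // ger0_real.
by move: h; rewrite lecE => /andP[].
Qed.
Lemma cabsR (x : R) : cabs x%:C = `|x|.
Proof. by rewrite /cabs normc_def /= expr0n /= addr0 sqrtr_sqr. Qed.
Lemma cabs_sum I (r : seq I) (P : pred I) (F : I -> R[i]) :
  cabs (\sum_(i <- r | P i) F i) <= \sum_(i <- r | P i) cabs (F i).
Proof.
elim/big_rec2: _ => [|i a b _ h]; first by rewrite cabs0.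
by apply: le_trans (cabsD _ _) _; rewrite lerD2l.
Qed.
Lemma conjcRC (x : R) : (x%:C)^* = x%:C.
Proof. by apply: complex_eq; rewrite ?cRe_conj ?cIm_conj //= oppr0. Qed.
Lemma sumRC I (r : seq I) (P : pred I) (F : I -> R) :
  (\sum_(i <- r | P i) F i)%:C = \sum_(i <- r | P i) (F i)%:C.
Proof. exact: rmorph_sum. Qed.
End ComplexFacts.

(* Elements of H^2 are functions, equal only almost everywhere.  Hence the form is
   only semi-definite, [ph_mem] is the domain on which it makes sense, and [pheq]
   below replaces equality. *)
Record preHilbert (R : realType) := PreHilbert {
  ph_sort : lmodType R[i];
  ph_mem : set ph_sort;
  ph_dot : ph_sort -> ph_sort -> R[i];
  ph_mem0 : ph_mem 0;
  ph_mem_lin : forall c x y, ph_mem x -> ph_mem y -> ph_mem (c *: x + y);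
  ph_dot_lin : forall c x y z, ph_mem x -> ph_mem y -> ph_mem z ->
    ph_dot (c *: x + y) z = c * ph_dot x z + ph_dot y z;
  ph_dotC : forall x y, ph_mem x -> ph_mem y -> ph_dot y x = (ph_dot x y)^*;
  ph_dot_ge0 : forall x, ph_mem x -> 0 <= ph_dot x x }.

Section PreHilbert.
Variables (R : realType) (H : preHilbert R).
Notation C := R[i].
Notation V := (ph_sort H).
Notation mem := (@ph_mem R H).
Notation dot := (@ph_dot R H).
Implicit Types (x y z : V) (c : C).

Definition nrm2 x : R := cRe (dot x x).
Definition nrm x : R := Num.sqrt (nrm2 x).
Definition pheq x y := nrm2 (x - y) = 0.

Lemma phm0 : mem 0. Proof. exact: ph_mem0. Qed.
Lemma phmZ c x : mem x -> mem (c *: x).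
Proof. by move=> h; rewrite -[_ *: _]addr0; apply: ph_mem_lin => //; exact: phm0. Qed.
Lemma phmD x y : mem x -> mem y -> mem (x + y).
Proof. by move=> hx hy; rewrite -[x]scale1r; exact: ph_mem_lin. Qed.
Lemma phmN x : mem x -> mem (- x).
Proof. by move=> h; rewrite -scaleN1r; exact: phmZ. Qed.
Lemma phmB x y : mem x -> mem y -> mem (x - y).
Proof. by move=> hx hy; apply: phmD => //; exact: phmN. Qed.
Lemma phm_sum (I : Type) (r : seq I) (P : pred I) (F : I -> V) :
  (forall i, mem (F i)) -> mem (\sum_(i <- r | P i) F i).
Proof. by move=> h; elim/big_ind: _ => //; [exact: phm0|exact: phmD]. Qed.
Lemma phm_lc (I : Type) (r : seq I) (P : pred I) (F : I -> V) (a : I -> C) :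
  (forall i, mem (F i)) -> mem (\sum_(i <- r | P i) a i *: F i).
Proof. by move=> h; apply: phm_sum => i; exact: phmZ. Qed.
#[local] Hint Resolve phm0 phmZ phmD phmN phmB phm_sum phm_lc : ph.
Local Ltac ph := solve [auto 8 with ph].

Lemma dotDl x y z : mem x -> mem y -> mem z -> dot (x + y) z = dot x z + dot y z.
Proof. by move=> *; rewrite -[x]scale1r ph_dot_lin // mul1r scale1r. Qed.
Lemma dot0l z : mem z -> dot 0 z = 0.
Proof.
move=> hz; have := dotDl phm0 phm0 hz; rewrite addr0 => h.
by apply: (addrI (dot 0 z)); rewrite -h addr0.
Qed.
Lemma dotZl c x z : mem x -> mem z -> dot (c *: x) z = c * dot x z.
Proof.
move=> hx hz; rewrite -[_ *: _]addr0 ph_dot_lin //; last exact: phm0.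
by rewrite dot0l // addr0.
Qed.
Lemma dotNl x z : mem x -> mem z -> dot (- x) z = - dot x z.
Proof. by move=> *; rewrite -scaleN1r dotZl // mulN1r. Qed.
Lemma dotBl x y z : mem x -> mem y -> mem z -> dot (x - y) z = dot x z - dot y z.
Proof. by move=> *; rewrite dotDl ?dotNl //; ph. Qed.
Lemma dotC x y : mem x -> mem y -> dot y x = (dot x y)^*.
Proof. exact: ph_dotC. Qed.
Lemma dotDr x y z : mem x -> mem y -> mem z -> dot z (x + y) = dot z x + dot z y.
Proof.
by move=> *; rewrite dotC ?dotDl //; [rewrite rmorphD /= -!dotC|ph].
Qed.
Lemma dotZr c x z : mem x -> mem z -> dot z (c *: x) = c^* * dot z x.
Proof. by move=> *; rewrite dotC ?dotZl //; [rewrite rmorphM /= -dotC|ph]. Qed.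
Lemma dotNr x z : mem x -> mem z -> dot z (- x) = - dot z x.
Proof. by move=> *; rewrite dotC ?dotNl //; [rewrite rmorphN /= -dotC|ph]. Qed.
Lemma dotBr x y z : mem x -> mem y -> mem z -> dot z (x - y) = dot z x - dot z y.
Proof. by move=> *; rewrite dotDr ?dotNr //; ph. Qed.
Lemma dot_suml (I : Type) (r : seq I) (P : pred I) (F : I -> V) z :
  (forall i, mem (F i)) -> mem z ->
  dot (\sum_(i <- r | P i) F i) z = \sum_(i <- r | P i) dot (F i) z.
Proof.
move=> hF hz.
suff: mem (\sum_(i <- r | P i) F i) /\
  dot (\sum_(i <- r | P i) F i) z = \sum_(i <- r | P i) dot (F i) z by case.
elim/big_rec2: _ => [|i y x _ [h1 h2]].
  by split; [ph|rewrite dot0l].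
by split; [ph|rewrite dotDl // h2].
Qed.
Lemma dot_sumr (I : Type) (r : seq I) (P : pred I) (F : I -> V) z :
  (forall i, mem (F i)) -> mem z ->
  dot z (\sum_(i <- r | P i) F i) = \sum_(i <- r | P i) dot z (F i).
Proof.
move=> hF hz; rewrite dotC ?dot_suml //; last by ph.
by rewrite rmorph_sum /=; apply: eq_bigr => i _; rewrite -dotC.
Qed.
Lemma dot_lcl (I : Type) (r : seq I) (P : pred I) (F : I -> V) (a : I -> C) z :
  (forall i, mem (F i)) -> mem z ->
  dot (\sum_(i <- r | P i) a i *: F i) z = \sum_(i <- r | P i) a i * dot (F i) z.
Proof.
by move=> hF hz; rewrite dot_suml //; [apply: eq_bigr => i _; rewrite dotZl|ph].
Qed.
Lemma dot_lcr (I : Type) (r : seq I) (P : pred I) (F : I -> V) (a : I -> C) z :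
  (forall i, mem (F i)) -> mem z ->
  dot z (\sum_(i <- r | P i) a i *: F i) = \sum_(i <- r | P i) (a i)^* * dot z (F i).
Proof.
by move=> hF hz; rewrite dot_sumr //; [apply: eq_bigr => i _; rewrite dotZr|ph].
Qed.

Lemma dotxx x : mem x -> dot x x = (nrm2 x)%:C.
Proof. by move=> h; have [] := cge0 (ph_dot_ge0 h). Qed.
Lemma nrm2_ge0 x : mem x -> 0 <= nrm2 x.
Proof. by move=> h; have [] := cge0 (ph_dot_ge0 h). Qed.
Lemma nrm_ge0 x : 0 <= nrm x. Proof. exact: sqrtr_ge0. Qed.
Lemma nrmK x : mem x -> nrm x ^+ 2 = nrm2 x.
Proof. by move=> h; rewrite sqr_sqrtr // nrm2_ge0. Qed.
Lemma nrm20 : nrm2 0 = 0. Proof. by rewrite /nrm2 dot0l //; ph. Qed.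
Lemma nrm2D x y : mem x -> mem y ->
  nrm2 (x + y) = nrm2 x + nrm2 y + 2 * cRe (dot x y).
Proof.
move=> hx hy; rewrite /nrm2 dotDl ?dotDr //; last by ph.
by rewrite (dotC hx hy) !cReD cRe_conj; ring.
Qed.
Lemma nrm2Z c x : mem x -> nrm2 (c *: x) = cabs c ^+ 2 * nrm2 x.
Proof.
move=> hx; apply: complexI; rewrite -dotxx; last by ph.
rewrite dotZl ?dotZr //; last by ph.
by rewrite mulrA mul_conjcC dotxx // [RHS]rmorphM.
Qed.
Lemma nrm2N x : mem x -> nrm2 (- x) = nrm2 x.
Proof.
by move=> h; rewrite -scaleN1r nrm2Z // cabsN -[1]/((1 : R)%:C) cabsR normr1 expr1n mul1r.
Qed.
Lemma nrm2B x y : mem x -> mem y ->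
  nrm2 (x - y) = nrm2 x + nrm2 y - 2 * cRe (dot x y).
Proof. by move=> *; rewrite nrm2D ?nrm2N ?dotNr ?cReN //; [ring|ph]. Qed.
Lemma nrm2Bsym x y : mem x -> mem y -> nrm2 (x - y) = nrm2 (y - x).
Proof. by move=> *; rewrite -nrm2N ?opprB //; ph. Qed.

(** The square norm of x - t <x, y> y is a polynomial in the real t of degree at most 2, nonnegative
    everywhere. *)
Lemma CS2 x y : mem x -> mem y -> cabs (dot x y) ^+ 2 <= nrm2 x * nrm2 y.
Proof.
move=> hx hy; set d := dot x y; set a := cabs d ^+ 2.
have a0 : 0 <= a by exact: sqr_ge0.
have key (t : R) : 0 <= nrm2 x - 2 * t * a + t ^+ 2 * a * nrm2 y.
  have : 0 <= nrm2 (x - (t%:C * d) *: y) by apply: nrm2_ge0; ph.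
  rewrite nrm2B ?nrm2Z //; last by ph.
  rewrite dotZr // -/d rmorphM /= conjcRC -mulrA.
  rewrite [_^* * d]mulrC mul_conjcC -rmorphM /= cabsM cabsR exprMn.
  by rewrite real_normK ?num_real // -/a => h; lra.
have ny := nrm2_ge0 hy; have nx := nrm2_ge0 hx.
case: (eqVneq (nrm2 y) 0) => [y0|yn0].
  (* A null y need not be 0. The polynomial is then affine in t, and the value of t below would make
     it equal to -1. *)
  rewrite y0 mulr0; case: (eqVneq a 0) => [->//|an0].
  have /(_ ((nrm2 x + 1) / (2 * a))) := key; rewrite y0 mulr0 addr0.
  have -> : 2 * ((nrm2 x + 1) / (2 * a)) * a = nrm2 x + 1 by field.
  by lra.
have y_gt0 : 0 < nrm2 y by rewrite lt0r yn0.
have /(_ (nrm2 y)^-1) := key.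
have -> : nrm2 x - 2 * (nrm2 y)^-1 * a + (nrm2 y)^-1 ^+ 2 * a * nrm2 y =
  (nrm2 x * nrm2 y - a) / nrm2 y by field.
by rewrite pmulr_lge0 ?invr_gt0 // subr_ge0.
Qed.
Lemma CS x y : mem x -> mem y -> cabs (dot x y) <= nrm x * nrm y.
Proof.
move=> hx hy; rewrite -(@ler_pXn2r _ 2) ?nnegrE ?cabs_ge0 //; last first.
  by rewrite mulr_ge0 ?nrm_ge0.
by rewrite exprMn !nrmK // CS2.
Qed.
Lemma dot_null x y : mem x -> mem y -> nrm2 x = 0 -> dot x y = 0.
Proof.
move=> hx hy h; apply: cabs0_eq0; apply/eqP.
by rewrite -sqrf_eq0 eq_le sqr_ge0 andbT -(mul0r (nrm2 y)) -h CS2.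
Qed.
Lemma dot_nullr x y : mem x -> mem y -> nrm2 x = 0 -> dot y x = 0.
Proof. by move=> hx hy h; rewrite dotC // dot_null // rmorph0. Qed.
Lemma pheq_dotl x y z : mem x -> mem y -> mem z -> pheq x y -> dot x z = dot y z.
Proof. by move=> hx hy hz h; apply/eqP; rewrite -subr_eq0 -dotBl // dot_null //; ph. Qed.
Lemma pheq_dotr x y z : mem x -> mem y -> mem z -> pheq x y -> dot z x = dot z y.
Proof. by move=> hx hy hz h; rewrite dotC // (@pheq_dotl x y) // -dotC. Qed.
Lemma pheq_nrm2 x y : mem x -> mem y -> pheq x y -> nrm2 x = nrm2 y.
Proof. by move=> hx hy h; rewrite /nrm2 (pheq_dotl hx hy) // (pheq_dotr hx hy). Qed.
Lemma nrmD x y : mem x -> mem y -> nrm (x + y) <= nrm x + nrm y.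
Proof.
move=> hx hy; rewrite -(@ler_pXn2r _ 2) ?nnegrE ?addr_ge0 ?nrm_ge0 //.
rewrite sqrrD !nrmK //; last by ph.
rewrite nrm2D //.
have := le_trans (ler_norm _) (cRe_le_cabs (dot x y)); have := CS hx hy.
by lra.
Qed.
Lemma nrmN x : mem x -> nrm (- x) = nrm x.
Proof. by move=> h; rewrite /nrm nrm2N. Qed.
Lemma nrmBsym x y : mem x -> mem y -> nrm (x - y) = nrm (y - x).
Proof. by move=> *; rewrite /nrm nrm2Bsym. Qed.
Lemma nrmB_tri y x z : mem x -> mem y -> mem z -> nrm (x - z) <= nrm (x - y) + nrm (y - z).
Proof.
move=> *; have -> : x - z = (x - y) + (y - z) by rewrite addrA subrK.
by apply: nrmD; ph.
Qed.
Lemma pheq_refl x : pheq x x. Proof. by rewrite /pheq subrr nrm20. Qed.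
Lemma pheq_sym x y : mem x -> mem y -> pheq x y -> pheq y x.
Proof. by move=> hx hy; rewrite /pheq nrm2Bsym. Qed.
Lemma nrm2_eq0 x : mem x -> (nrm x = 0) <-> nrm2 x = 0.
Proof.
move=> h; split=> e; first by rewrite -nrmK // e expr0n.
by rewrite /nrm e sqrtr0.
Qed.
Lemma pheq_trans y x z : mem x -> mem y -> mem z -> pheq x y -> pheq y z -> pheq x z.
Proof.
move=> hx hy hz /nrm2_eq0 h1 /nrm2_eq0 h2; apply/nrm2_eq0; first by ph.
apply/eqP; rewrite eq_le nrm_ge0 andbT.
by apply: le_trans (nrmB_tri hx hy hz) _; rewrite h1 ?h2 ?addr0 //; ph.
Qed.
Lemma pheq_lin c x y x' y' : mem x -> mem y -> mem x' -> mem y' ->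
  pheq x x' -> pheq y y' -> pheq (c *: x + y) (c *: x' + y').
Proof.
move=> hx hy hx' hy' h1 h2; rewrite /pheq opprD addrACA -scalerBr.
rewrite nrm2D ?nrm2Z; [|by ph..].
by rewrite h1 h2 mulr0 addr0 add0r (dot_nullr _ _ h2) ?mulr0 //; ph.
Qed.
Lemma pheq0 x : pheq x 0 <-> nrm2 x = 0.
Proof. by rewrite /pheq subr0. Qed.

Definition onf (k : nat) (w : 'I_k -> V) :=
  (forall i, mem (w i)) /\ forall i j, dot (w i) (w j) = (i == j)%:R.

Lemma onf_dot_lc k (w : 'I_k -> V) (a : 'I_k -> C) j : onf w ->
  dot (\sum_i a i *: w i) (w j) = a j.
Proof.
case=> hw h; rewrite dot_lcl // (bigD1 j) //= h eqxx mulr1 big1 ?addr0 // => i ij.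
by rewrite h (negbTE ij) mulr0.
Qed.
Lemma onf_dot_lcr k (w : 'I_k -> V) (a : 'I_k -> C) j : onf w ->
  dot (w j) (\sum_i a i *: w i) = (a j)^*.
Proof.
by move=> hw; rewrite dotC ?onf_dot_lc //; [have := hw.1; ph|have := hw.1; ph].
Qed.
Lemma onf_dot_lc2 k (w : 'I_k -> V) (a b : 'I_k -> C) : onf w ->
  dot (\sum_i a i *: w i) (\sum_i b i *: w i) = \sum_i a i * (b i)^*.
Proof.
move=> hw; have m := hw.1; rewrite dot_lcl //; last by ph.
by apply: eq_bigr => i _; rewrite onf_dot_lcr.
Qed.
Lemma onf_nrm2 k (w : 'I_k -> V) (a : 'I_k -> C) : onf w ->
  nrm2 (\sum_i a i *: w i) = \sum_i cabs (a i) ^+ 2.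
Proof.
move=> hw; rewrite /nrm2 onf_dot_lc2 // cRe_sum.
by apply: eq_bigr => i _; rewrite mul_conjcC.
Qed.
Definition onproj k (w : 'I_k -> V) x := \sum_i dot x (w i) *: w i.
Lemma onprojm k (w : 'I_k -> V) x : onf w -> mem (onproj w x).
Proof. by case=> h _; rewrite /onproj; ph. Qed.
Lemma onproj_orth k (w : 'I_k -> V) x j : onf w -> mem x ->
  dot (x - onproj w x) (w j) = 0.
Proof.
move=> hw hx; rewrite dotBl ?onf_dot_lc ?subrr //; [exact: onprojm|by have [] := hw].
Qed.
Lemma onproj_orth_lc k (w : 'I_k -> V) x a : onf w -> mem x ->
  dot (x - onproj w x) (\sum_i a i *: w i) = 0.
Proof.
move=> hw hx; have [m _] := hw; have := onprojm x hw => hp.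
rewrite dot_lcr //; last by ph.
by rewrite big1 // => i _; rewrite onproj_orth // mulr0.
Qed.
Lemma onproj_pyth k (w : 'I_k -> V) x : onf w -> mem x ->
  nrm2 (x - onproj w x) = nrm2 x - \sum_i cabs (dot x (w i)) ^+ 2.
Proof.
move=> hw hx; have hp := onprojm x hw.
have := onproj_orth_lc (fun i => dot x (w i)) hw hx; rewrite -/(onproj w x).
rewrite dotBl // => /subr0_eq h; rewrite nrm2B // h.
rewrite -/(nrm2 _) /onproj onf_nrm2 //; ring.
Qed.

Lemma pheq_lc (I : Type) (r : seq I) (P : pred I) (F G : I -> V) (a : I -> C) :
  (forall i, mem (F i)) -> (forall i, mem (G i)) ->
  (forall i, pheq (F i) (G i)) ->
  pheq (\sum_(i <- r | P i) a i *: F i) (\sum_(i <- r | P i) a i *: G i).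
Proof.
move=> hF hG h; elim: r => [|i r IH]; first by rewrite !big_nil; exact: pheq_refl.
by rewrite !big_cons; case: (P i) => //; apply: pheq_lin => //; ph.
Qed.

(** A has more rows than columns, so c A = 0 for some nonzero row c. Vectors are known only up to
    null vectors, hence a conclusion on [nrm2]. *)
Lemma lin_dep (k n : nat) (w : 'I_k -> V) (v : 'I_n -> V) (A : 'M[C]_(k, n)) :
  (forall i, mem (w i)) -> (forall j, mem (v j)) ->
  (forall i, pheq (w i) (\sum_j A i j *: v j)) -> (n < k)%N ->
  exists2 c : 'rV[C]_k, c != 0 & nrm2 (\sum_i c 0 i *: w i) = 0.
Proof.
move=> hw hv hA nk.
have : kermx A != 0.
  by rewrite -mxrank_eq0 mxrank_ker subn_eq0 -ltnNge (leq_ltn_trans (rank_leq_col _)).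
move=> /rowV0Pn[c /sub_kermxP cA c0]; exists c => //.
have h := pheq_lc (index_enum 'I_k) xpredT (fun i => c 0 i) hw
  (fun i => phm_lc (index_enum 'I_n) xpredT (A i) hv) hA.
rewrite (pheq_nrm2 _ _ h); [|by ph|by apply: phm_lc => i; ph].
have -> : \sum_i c 0 i *: (\sum_j A i j *: v j) = 0; last exact: nrm20.
transitivity (\sum_j (c *m A) 0 j *: v j); last first.
  by rewrite cA big1 // => j _; rewrite mxE scale0r.
under eq_bigr do rewrite scaler_sumr.
rewrite exchange_big; apply: eq_bigr => j _ /=.
by rewrite mxE scaler_suml; apply: eq_bigr => i _; rewrite scalerA.
Qed.

Lemma onf_bound (k n : nat) (w : 'I_k -> V) (v : 'I_n -> V) (A : 'M[C]_(k, n)) :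
  onf w -> (forall j, mem (v j)) ->
  (forall i, pheq (w i) (\sum_j A i j *: v j)) -> (k <= n)%N.
Proof.
move=> hw hv hA; rewrite leqNgt; apply/negP => nk.
have [c c0] := lin_dep hw.1 hv hA nk.
rewrite onf_nrm2 // => /eqP; rewrite psumr_eq0; last by move=> i _; exact: sqr_ge0.
move=> /allP h; move/eqP: c0; apply; apply/rowP => i; rewrite mxE.
by apply: cabs0_eq0; apply/eqP; rewrite -sqrf_eq0; exact: (h i (mem_index_enum i)).
Qed.

Lemma onf_extend (k : nat) (w : 'I_k -> V) r : onf w -> mem r -> nrm2 r != 0 ->
  (forall i, dot r (w i) = 0) ->
  onf (fun i : 'I_k.+1 => oapp w ((nrm r)^-1%:C *: r) (unlift ord_max i)).
Proof.
move=> hw hr r0 h; have m := hw.1; split.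
  by move=> i; case: (unlift _ _) => [j|] /=; ph.
have nr0 : nrm r != 0 by apply: contra r0 => /eqP /nrm2_eq0 ->.
move=> i j; case: unliftP => [i' ->|->]; case: unliftP => [j' ->|->] /=.
- by rewrite hw.2 (inj_eq (@lift_inj _ _)).
- by rewrite dotZr // dotC // h rmorph0 mulr0 eq_sym (negbTE (neq_lift _ _)).
- by rewrite dotZl // h mulr0 (negbTE (neq_lift _ _)).
- rewrite eqxx dotZl ?dotZr //; last by ph.
  rewrite conjcRC dotxx // -!rmorphM /=.
  by rewrite -nrmK // mulrA -expr2 -exprMn mulVf // expr1n.
Qed.

Definition subsp (W : set V) :=
  [/\ forall x, W x -> mem x, W 0 & forall c x y, W x -> W y -> W (c *: x + y)].

Section Subsp.
Variable (W : set V).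
Hypothesis hW : subsp W.
Lemma subspm x : W x -> mem x. Proof. by case: hW => h _ _; exact: h. Qed.
Lemma subsp0 : W 0. Proof. by case: hW. Qed.
Lemma subspL c x y : W x -> W y -> W (c *: x + y).
Proof. by case: hW => _ _; apply. Qed.
Lemma subspD x y : W x -> W y -> W (x + y).
Proof. by move=> *; rewrite -[x]scale1r; exact: subspL. Qed.
Lemma subspZ c x : W x -> W (c *: x).
Proof. by move=> *; rewrite -[_ *: _]addr0; apply: subspL => //; exact: subsp0. Qed.
Lemma subspB x y : W x -> W y -> W (x - y).
Proof. by move=> *; apply: subspD => //; rewrite -scaleN1r; exact: subspZ. Qed.
Lemma subsp_lc (I : Type) (r : seq I) (P : pred I) (F : I -> V) (a : I -> C) :
  (forall i, W (F i)) -> W (\sum_(i <- r | P i) a i *: F i).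
Proof.
move=> h; elim/big_ind: _ => [|x y|i _]; [exact: subsp0|exact: subspD|exact: subspZ].
Qed.
End Subsp.

(** An orthonormal family in W of maximal length is a basis: the residual of a vector of W, if not
    null, could be normalised and appended. *)
Lemma max_onb (W : set V) (n : nat) : subsp W ->
  (forall k (w : 'I_k -> V), onf w -> (forall i, W (w i)) -> (k <= n)%N) ->
  exists k (w : 'I_k -> V), [/\ onf w, forall i, W (w i) &
    forall x, W x -> pheq x (onproj w x)].
Proof.
move=> hW hn.
pose P k := `[< exists w : 'I_k -> V, onf w /\ forall i, W (w i) >].
have exP : exists k, P k.
  exists 0%N; apply/asboolP; exists (fun _ => 0); split; last by case.
  by split; case.
have bP k : P k -> (k <= n)%N by move=> /asboolP[w [h1 h2]]; exact: hn h1 h2.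
case: (ex_maxnP exP bP) => k /asboolP[w [hw Ww]] kmax.
exists k, w; split => // x Wx; apply: contrapT => hx.
pose r := x - onproj w x.
have xm := subspm hW Wx.
have Wr : W r by apply: subspB => //; apply: subsp_lc.
have r0 : nrm2 r != 0 by apply/eqP.
have := onf_extend hw (subspm hW Wr) r0 (fun i => onproj_orth i hw xm).
set w' := (fun i => _) => hw'.
have /kmax : P k.+1.
  apply/asboolP; exists w'; split => // i; rewrite /w'.
  by case: (unlift _ _) => [j|] //=; apply: subspZ.
by rewrite ltnn.
Qed.

Lemma span_onb (J : finType) (v : J -> V) (W : set V) : subsp W ->
  (forall j, W (v j)) ->
  (forall x, W x -> exists a : J -> C, pheq x (\sum_j a j *: v j)) ->
  exists k (w : 'I_k -> V), [/\ onf w, forall i, W (w i) &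
    forall x, W x -> pheq x (onproj w x)].
Proof.
move=> hW hv hs; apply: (@max_onb _ #|J|) => // k w hw Ww.
have [a ha] := choice (fun i => hs _ (Ww i)).
pose e (i : 'I_#|J|) : J := enum_val i.
apply: (@onf_bound _ _ w (v \o e) (\matrix_(i, j) a i (e j))) => //.
  by move=> j; exact: (subspm hW (hv _)).
move=> i.
suff -> : \sum_j (\matrix_(i, j) a i (e j)) i j *: (v \o e) j = \sum_j a i j *: v j by [].
rewrite [RHS](reindex e) /=; last first.
  by exists enum_rank => j _; rewrite /e ?enum_valK ?enum_rankK.
by apply: eq_bigr => j _; rewrite mxE.
Qed.

Lemma fin_onb (J : finType) (v : J -> V) : (forall j, mem (v j)) ->
  exists k (w : 'I_k -> V), onf w /\ forall j, pheq (v j) (onproj w (v j)).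
Proof.
move=> hv; pose W := [set x | exists a : J -> C, x = \sum_j a j *: v j].
have hW : subsp W.
  split; first by move=> x [a ->]; ph.
    by exists (fun=> 0); rewrite big1 // => j _; rewrite scale0r.
  move=> c x y [a ->] [b ->]; exists (fun j => c * a j + b j).
  rewrite scaler_sumr -big_split; apply: eq_bigr => j _ /=.
  by rewrite scalerDl scalerA.
have Wv j : W (v j).
  exists (fun i => (i == j)%:R); rewrite (bigD1 j) //= eqxx scale1r big1 ?addr0 //.
  by move=> i /negbTE ->; rewrite scale0r.
have [] := @span_onb J v W hW Wv.
  by move=> x [a ->]; exists a; exact: pheq_refl.
by move=> k [w [h1 h2 h3]]; exists k, w; split => // j; exact: h3.
Qed.

Definition closedW (W : set V) :=
  forall x, mem x -> (forall e : R, 0 < e -> exists2 y, W y & nrm (x - y) < e) -> W x.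

Definition cvg_to (u : nat -> V) x :=
  forall e : R, 0 < e -> exists N, forall n, (N <= n)%N -> nrm (u n - x) < e.

Definition cauchyseq (u : nat -> V) :=
  forall e : R, 0 < e -> exists N, forall m n, (N <= m)%N -> (N <= n)%N ->
    nrm (u m - u n) < e.

Definition completeH := forall u, (forall n, mem (u n)) -> cauchyseq u ->
  exists2 x, mem x & cvg_to u x.

Lemma cvg_to_pheq u x y : (forall n, mem (u n)) -> mem x -> mem y ->
  cvg_to u x -> cvg_to u y -> pheq x y.
Proof.
move=> mu mx my hx hy; apply/nrm2_eq0; first by ph.
apply/eqP; rewrite eq_le nrm_ge0 andbT leNgt; apply/negP => h.
have e0 : 0 < nrm (x - y) / 2 by rewrite divr_gt0.
have [N1 h1] := hx _ e0; have [N2 h2] := hy _ e0.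
have := h1 (maxn N1 N2) (leq_maxl _ _); have := h2 (maxn N1 N2) (leq_maxr _ _).
rewrite (nrmBsym _ mx) // => a1 a2.
have := nrmB_tri mx (mu (maxn N1 N2)) my; lra.
Qed.

Lemma closedW_pheq W x y : closedW W -> mem x -> W y -> pheq x y -> W x.
Proof.
move=> cW mx Wy h; apply: cW => // e e0; exists y => //.
by rewrite /nrm h sqrtr0.
Qed.

Lemma min_orth r z : mem r -> mem z ->
  (forall c, nrm2 r <= nrm2 (r - c *: z)) -> dot r z = 0.
Proof.
move=> hr hz h; set d := dot r z; set a := cabs d ^+ 2.
have a0 : 0 <= a by exact: sqr_ge0.
(* The optimal step would be 1 / nrm2 z. Adding 1 to the denominator covers null z as well and still
   decreases the distance. *)
have nz := nrm2_ge0 hz; set t : R := (nrm2 z + 1)^-1.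
have t0 : 0 < t by rewrite invr_gt0 ltr_wpDl.
have tz : t * nrm2 z = 1 - t by rewrite /t; field; rewrite gt_eqF // ltr_wpDl.
have := h (t%:C * d); rewrite nrm2B ?nrm2Z //; last by ph.
rewrite dotZr // -/d rmorphM /= conjcRC -mulrA.
rewrite [_^* * d]mulrC mul_conjcC -rmorphM /= cabsM cabsR exprMn.
rewrite real_normK ?num_real // -/a => k.
have : t * a * (1 + t) <= 0.
  have : t ^+ 2 * a * nrm2 z = t * a * (1 - t) by rewrite -tz; ring.
  by lra.
rewrite pmulr_lle0; last by lra.
rewrite pmulr_rle0 // => a1.
apply: cabs0_eq0; apply/eqP; rewrite -sqrf_eq0 eq_le a1.
exact: sqr_ge0.
Qed.

(** A minimising sequence for the distance from x to W is Cauchy by the parallelogram law, since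
    midpoints stay in W. Its limit is a nearest point, and [min_orth] gives the orthogonality. *)
Lemma proj_exists W x : completeH -> subsp W -> closedW W -> mem x ->
  exists2 m, W m & forall y, W y -> dot (x - m) y = 0.
Proof.
move=> hc hW cW mx.
pose D : set R := [set nrm2 (x - y) | y in W].
have hD : has_inf D.
  split; first by exists (nrm2 (x - 0)), 0 => //; exact: (subsp0 hW).
  by exists 0 => _ [y Wy <-]; apply: nrm2_ge0; apply: phmB => //; exact: (subspm hW Wy).
pose d := inf D.
have dle y : W y -> d <= nrm2 (x - y).
  by move=> Wy; apply: ge_inf; [case: hD | exists y].
have /choice[y hy] (n : nat) : exists y, W y /\ nrm2 (x - y) < d + n.+1%:R^-1.
  have [|_ [y Wy <-] hy] := @inf_adherent _ D n.+1%:R^-1 _ hD; first by rewrite invr_gt0.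
  by exists y.
have my n : mem (y n) by apply: (subspm hW); case: (hy n).
have par m n : nrm2 (y m - y n) <= 2 * m.+1%:R^-1 + 2 * n.+1%:R^-1.
  have e1 : y m - y n = (x - y n) - (x - y m) by rewrite opprB [RHS]addrC addrA subrK.
  have h1 : W (2^-1 *: (y m + y n)).
    by apply: (subspZ hW); apply: (subspD hW); [case: (hy m)|case: (hy n)].
  have e2 : (x - y n) + (x - y m) = (2%:R : R)%:C *: (x - 2^-1 *: (y m + y n)).
    rewrite scalerBr scalerA rmorph_nat mulfV ?pnatr_eq0 // scale1r.
    by rewrite scaler_nat mulr2n opprD addrACA [- y n - y m]addrC.
  have := dle _ h1.
  have : nrm2 ((x - y n) + (x - y m)) = 4 * nrm2 (x - 2^-1 *: (y m + y n)).
    rewrite e2 nrm2Z ?cabsR; last by ph.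
    by rewrite ger0_norm // -natrX.
  have ma : mem (x - y n) by ph.
  have mb : mem (x - y m) by ph.
  have [_] := hy m; have [_] := hy n.
  rewrite e1 (nrm2D ma mb) (nrm2B ma mb).
  by move: (n.+1%:R^-1) (m.+1%:R^-1) => a b; lra.
have cy : cauchyseq y.
  move=> e e0; pose N := Num.truncn (4 / e ^+ 2).
  exists N => m n Nm Nn.
  rewrite -(@ltr_pXn2r _ 2) ?nnegrE ?nrm_ge0 ?(ltW e0) // nrmK; last by ph.
  apply: le_lt_trans (par m n) _.
  have hN : 4 / e ^+ 2 < N.+1%:R by rewrite truncnS_gt.
  have bnd k : (N <= k)%N -> 4 * k.+1%:R^-1 < e ^+ 2.
    move=> Nk; rewrite ltr_pdivrMr ?ltr0Sn // mulrC -ltr_pdivrMr ?exprn_gt0 //.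
    by apply: lt_le_trans hN _; rewrite ler_nat.
  have := bnd _ Nm; have := bnd _ Nn.
  by move: (n.+1%:R^-1) (m.+1%:R^-1) => a b; lra.
have [m mm ym] := hc _ my cy.
have Wm : W m.
  apply: cW => // e e0; have [N hN] := ym _ e0; exists (y N); first by case: (hy N).
  by rewrite nrmBsym // hN.
exists m => // z Wz; have mz := subspm hW Wz.
apply: min_orth => //; [by ph|move=> c].
set z' := c *: z; have Wmz : W (m + z') by apply: (subspD hW) => //; exact: subspZ.
have -> : x - m - z' = x - (m + z') by rewrite opprD addrA.
have := subspm hW Wmz; move: (m + z') Wmz => u Wu mu.
rewrite -!nrmK; [|by ph..].
rewrite ler_pXn2r ?nnegrE ?nrm_ge0 // leNgt; apply/negP => hlt.
(* Half the gap: for large n, y n is within e of m and within nrm (x - u) + e of x, which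
   contradicts the triangle inequality. *)
pose e := (nrm (x - m) - nrm (x - u)) / 2.
have e0 : 0 < e by rewrite /e; lra.
have [N hN] := ym _ e0; pose n := maxn N (Num.truncn (1 / e ^+ 2)).
have := hN n (leq_maxl _ _).
have hn : n.+1%:R^-1 < e ^+ 2.
  rewrite -[X in X < _]mul1r ltr_pdivrMr ?ltr0Sn // mulrC -ltr_pdivrMr ?exprn_gt0 //.
  apply: lt_le_trans (truncnS_gt _) _; rewrite ler_nat ltnS; exact: leq_maxr.
have [_ hy2] := hy n.
have : nrm (x - y n) < nrm (x - u) + e.
  rewrite -(@ltr_pXn2r _ 2) ?nnegrE ?nrm_ge0 ?addr_ge0 ?nrm_ge0 ?(ltW e0) //.
  rewrite nrmK; last by ph.
  have := dle _ Wu; rewrite -nrmK; last by ph.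
  have : 0 <= nrm (x - u) * e by rewrite mulr_ge0 ?nrm_ge0 // ltW.
  by rewrite sqrrD; move: hn hy2; move: (n.+1%:R^-1) => b; lra.
have := nrmB_tri mx (my n) mm; rewrite /e; lra.
Qed.
End PreHilbert.
#[export] Hint Resolve phm0 phmZ phmD phmN phmB phm_sum phm_lc : ph.
Ltac ph := solve [auto 8 with ph].

(** * Stability of deflated contractions *)

Section Schur.
Variables (R : realType) (H1 H2 : preHilbert R) (J : finType).
Variables (u : J -> ph_sort H1) (w : J -> ph_sort H2).
Hypotheses (mu : forall j, ph_mem (u j)) (mw : forall j, ph_mem (w j)).

(* Expanding the first Gram matrix in an orthonormal basis exhibits the sum as
   a sum of squared norms. *)
Lemma schur_ge0 :
  0 <= \sum_j \sum_k ph_dot (u k) (u j) * ph_dot (w j) (w k).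
Proof.
have [m [g [ho hu]]] := fin_onb mu; have mo := ho.1.
pose c j a := ph_dot (u j) (g a).
have e j k : ph_dot (u k) (u j) = \sum_a c k a * (c j a)^*.
  rewrite (pheq_dotl _ _ _ (hu k)) //; last exact: onprojm.
  rewrite (pheq_dotr _ _ _ (hu j)) //; [|exact: onprojm..].
  by rewrite /onproj onf_dot_lc2.
have -> : \sum_j \sum_k ph_dot (u k) (u j) * ph_dot (w j) (w k) =
   \sum_a ph_dot (\sum_j (c j a)^* *: w j) (\sum_j (c j a)^* *: w j).
  under eq_bigr => j _ do under eq_bigr => k _ do rewrite e mulr_suml.
  under eq_bigr => j _ do rewrite exchange_big.
  rewrite exchange_big; apply: eq_bigr => a _ /=.
  rewrite dot_lcl //; last by ph.
  apply: eq_bigr => j _; rewrite dot_lcr // mulr_sumr; apply: eq_bigr => k _.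
  by rewrite conjCK; ring.
by apply: sumr_ge0 => a _; apply: ph_dot_ge0; ph.
Qed.
End Schur.

(** * The asymptotic form lim <T^n x, T^n y> of a contraction *)

Section LimitForm.
Variables (R : realType) (H : preHilbert R) (T : ph_sort H -> ph_sort H).
Notation V := (ph_sort H).
Notation mem := (@ph_mem R H).
Notation dot := (@ph_dot R H).
Implicit Types (x y z : V).
Hypothesis Tm : forall x, mem x -> mem (T x).
Hypothesis Tlin : forall c x y, mem x -> mem y -> T (c *: x + y) = c *: T x + T y.
Hypothesis Tc : forall x, mem x -> nrm2 (T x) <= nrm2 x.

Lemma iterm n x : mem x -> mem (iter n T x).
Proof. by move=> h; elim: n => //= n; exact: Tm. Qed.
Lemma iter_lin n c x y : mem x -> mem y ->
  iter n T (c *: x + y) = c *: iter n T x + iter n T y.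
Proof. by move=> hx hy; elim: n => //= n ->; rewrite Tlin //; exact: iterm. Qed.

Lemma iter_nrm2_cvg x : mem x -> cvgn (fun n => nrm2 (iter n T x)).
Proof.
move=> hx; apply: nonincreasing_is_cvgn; last first.
  by exists 0 => _ [n _ <-]; apply: nrm2_ge0; exact: iterm.
apply: (homo_leq (fun a => lexx a) (fun b a c h1 h2 => le_trans h2 h1)) => n.
by apply: Tc; exact: iterm.
Qed.

(** Polarization reduces the real part to three sequences of square norms, each monotone because T
    is a contraction. *)
Lemma iter_Re_cvg x y : mem x -> mem y ->
  cvgn (fun n => cRe (dot (iter n T x) (iter n T y))).
Proof.
move=> hx hy.
have -> : (fun n => cRe (dot (iter n T x) (iter n T y))) =
  (fun n => 2^-1 * (nrm2 (iter n T (x + y)) - nrm2 (iter n T x) - nrm2 (iter n T y))).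
  apply/funext => n; have := iter_lin n 1 hx hy; rewrite !scale1r => ->.
  by rewrite nrm2D; [field|exact: iterm..].
apply: is_cvgMl_tmp; apply: is_cvgB; [apply: is_cvgB|]; apply: iter_nrm2_cvg; ph.
Qed.

Lemma iter_Im_cvg x y : mem x -> mem y ->
  cvgn (fun n => cIm (dot (iter n T x) (iter n T y))).
Proof.
move=> hx hy.
have -> : (fun n => cIm (dot (iter n T x) (iter n T y))) =
  (fun n => cRe (dot (iter n T x) (iter n T ('i *: y)))).
  apply/funext => n; have := iter_lin n 'i hy (phm0 H); rewrite addr0 => ->.
  have -> : iter n T 0 = 0.
    have := iter_lin n 1 (phm0 H) (phm0 H); rewrite !scale1r addr0 => h.
    by apply: (addrI (iter n T 0)); rewrite -h addr0.
  rewrite addr0 dotZr; [|exact: iterm..].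
  by case: (dot _ _) => a b; rewrite /= ; ring.
apply: iter_Re_cvg => //; ph.
Qed.

Definition limform x y : R[i] :=
  limn (fun n => cRe (dot (iter n T x) (iter n T y))) +i*
  limn (fun n => cIm (dot (iter n T x) (iter n T y))).

Lemma limform_lin c x y z : mem x -> mem y -> mem z ->
  limform (c *: x + y) z = c * limform x z + limform y z.
Proof.
move=> hx hy hz.
have r1 := iter_Re_cvg hx hz; have r2 := iter_Re_cvg hy hz.
have i1 := iter_Im_cvg hx hz; have i2 := iter_Im_cvg hy hz.
apply: complex_eq; rewrite ?cReD ?cImD ?cReM ?cImM /limform /=.
  apply/cvg_lim => //.
  under eq_fun do (rewrite iter_lin // ph_dot_lin; [|exact: iterm..]; rewrite cReD cReM).
  by apply: cvgD => //; apply: cvgB => //; apply: cvgMl_tmp.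
apply/cvg_lim => //.
under eq_fun do (rewrite iter_lin // ph_dot_lin; [|exact: iterm..]; rewrite cImD cImM).
by apply: cvgD => //; apply: cvgD => //; apply: cvgMl_tmp.
Qed.

Lemma limformC x y : mem x -> mem y -> limform y x = (limform x y)^*.
Proof.
move=> hx hy; have i1 := iter_Im_cvg hx hy.
apply: complex_eq; rewrite ?cRe_conj ?cIm_conj /limform /=.
  by congr (limn _); apply/funext => n; rewrite dotC ?cRe_conj //; exact: iterm.
apply/cvg_lim => //.
under eq_fun do (rewrite dotC; [|exact: iterm..]; rewrite cIm_conj).
exact: cvgN.
Qed.

Lemma limform_real x : mem x -> limform x x = (limn (fun n => nrm2 (iter n T x)))%:C.
Proof.
move=> hx; apply: complex_eq => //=; apply/cvg_lim => //.
under eq_fun do (rewrite dotxx; [|exact: iterm]; rewrite /=).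
exact: cvg_cst.
Qed.

Lemma limform_ge0 x : mem x -> 0 <= limform x x.
Proof.
move=> hx; rewrite limform_real // ler0c; apply: limr_ge; first exact: iter_nrm2_cvg.
by near=> n; apply: nrm2_ge0; exact: iterm.
Unshelve. all: end_near. Qed.

(** Packaging the limit form as a pre-Hilbert structure on the same vectors makes Cauchy-Schwarz and
    [schur_ge0] available for it. It is only semi-definite, and for deflated shifts it will turn out
    to vanish. *)
Definition limHilbert : preHilbert R :=
  PreHilbert (phm0 H) (@ph_mem_lin R H) limform_lin limformC limform_ge0.

Lemma nrm2_lim x : @nrm2 R limHilbert x = limn (fun n => nrm2 (iter n T x)).
Proof. by []. Qed.

Lemma limform_le x : mem x -> @nrm2 R limHilbert x <= nrm2 x.
Proof.
move=> hx; rewrite nrm2_lim; apply: limr_le; first exact: iter_nrm2_cvg.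
near=> n; elim: (n) => // m IH; apply: le_trans IH => /=; apply: Tc; exact: iterm.
Unshelve. all: end_near. Qed.

(** The sequence for T x and T y is the sequence for x and y shifted by one. *)
Lemma limformT x y : mem x -> mem y -> limform (T x) (T y) = limform x y.
Proof.
move=> hx hy; have r := iter_Re_cvg hx hy; have i := iter_Im_cvg hx hy.
apply: complex_eq; rewrite /limform /=; apply/cvg_lim => //.
  under eq_fun do rewrite -!iterSr.
  by rewrite -(cvg_shiftS (fun n => cRe (dot (iter n T x) (iter n T y)))) in r *.
under eq_fun do rewrite -!iterSr.
by rewrite -(cvg_shiftS (fun n => cIm (dot (iter n T x) (iter n T y)))) in i *.
Qed.

Lemma limform0_cvg x : mem x -> @nrm2 R limHilbert x = 0 ->
  forall e : R, 0 < e -> exists N, forall n, (N <= n)%N -> nrm2 (iter n T x) < e.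
Proof.
move=> hx; rewrite nrm2_lim => l0 e e0.
have := iter_nrm2_cvg hx => h.
move/cvgrPdist_lt : h => /(_ e e0); rewrite l0 => -[N _ hN]; exists N => n nN.
by have := hN n nN; rewrite /= sub0r normrN ger0_norm // nrm2_ge0 //; exact: iterm.
Qed.
End LimitForm.

(** * Vanishing of the limit form for a deflated backward shift *)

Section Stability.
Variables (R : realType) (H : preHilbert R) (L S : ph_sort H -> ph_sort H).
Variables (d : nat) (g : 'I_d -> ph_sort H).
Notation V := (ph_sort H).
Notation mem := (@ph_mem R H).
Notation dot := (@ph_dot R H).
Implicit Types (x y z : V).
Hypothesis Lm : forall x, mem x -> mem (L x).
Hypothesis Llin : forall c x y, mem x -> mem y -> L (c *: x + y) = c *: L x + L y.
Hypothesis Lc : forall x, mem x -> nrm2 (L x) <= nrm2 x.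
Hypothesis L0 : forall x, mem x -> forall e : R, 0 < e ->
  exists N, forall n, (N <= n)%N -> nrm (iter n L x) < e.
Hypothesis Sm : forall x, mem x -> mem (S x).
Hypothesis LS : forall x y, mem x -> mem y -> dot (L x) y = dot x (S y).
Hypothesis SS : forall x y, mem x -> mem y -> dot (S x) (S y) = dot x y.
Hypothesis hg : onf g.

Definition defl x := L x - onproj g (L x).
Notation T := defl.

Let gm : forall i, mem (g i). Proof. exact: hg.1. Qed.

Lemma deflm x : mem x -> mem (T x).
Proof. by move=> h; apply: phmB; [exact: Lm|exact: onprojm]. Qed.
Lemma onproj_lin k (w : 'I_k -> V) c x y : (forall i, mem (w i)) -> mem x -> mem y ->
  onproj w (c *: x + y) = c *: onproj w x + onproj w y.
Proof.
move=> hw hx hy; rewrite /onproj scaler_sumr -big_split; apply: eq_bigr => i _ /=.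
by rewrite ph_dot_lin // scalerDl scalerA.
Qed.
Lemma defl_lin c x y : mem x -> mem y -> T (c *: x + y) = c *: T x + T y.
Proof.
move=> hx hy; rewrite /defl Llin // onproj_lin //; [|exact: Lm..].
by rewrite scalerBr opprD addrACA.
Qed.
Lemma defl_contr x : mem x -> nrm2 (T x) <= nrm2 x.
Proof.
move=> hx; rewrite /defl onproj_pyth //; last exact: Lm.
apply: le_trans (Lc hx); rewrite gerBl; apply: sumr_ge0 => i _; exact: sqr_ge0.
Qed.

Let B := limform T.
Let HB : preHilbert R := limHilbert deflm defl_lin defl_contr.

Let BT x y : mem x -> mem y -> B (T x) (T y) = B x y.
Proof. by move=> hx hy; apply: limformT => //; [exact: deflm|exact: defl_lin|exact: defl_contr]. Qed.
Let BTn n x y : mem x -> mem y -> B (iter n T x) (iter n T y) = B x y.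
Proof. by move=> hx hy; elim: n => //= n IH; rewrite BT //; exact: iterm deflm _ _ _. Qed.
Let Tn n x : mem x -> mem (iter n T x). Proof. exact: (iterm deflm). Qed.
Let Ln n x : mem x -> mem (iter n L x). Proof. exact: (iterm Lm). Qed.
Let Sn n x : mem x -> mem (iter n S x). Proof. exact: (iterm Sm). Qed.

(** B is T-invariant. Expanding T x but not T y by the definition of [defl] brings in L x, whose
    iterates are known to decay. *)
Let Bstep x y : mem x -> mem y ->
  B x y = B (L x) (T y) - \sum_i dot (L x) (g i) * B (g i) (T y).
Proof.
move=> hx hy; rewrite -BT // {1}/defl.
have := @dotBl R HB (L x) (onproj g (L x)) (T y) (Lm hx) (onprojm _ hg) (deflm hy).
rewrite /= -/B => ->; congr (_ - _).
exact: (@dot_lcl R HB _ _ _ g _ (T y) gm (deflm hy)).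
Qed.

Let Biter n x y : mem x -> mem y ->
  B x y = B (iter n L x) (iter n T y) -
    \sum_(j < n) \sum_i dot (iter j.+1 L x) (g i) * B (g i) (iter j.+1 T y).
Proof.
elim: n x y => [|n IH] x y hx hy; first by rewrite big_ord0 subr0.
rewrite Bstep // (IH (L x) (T y)); [|exact: Lm|exact: deflm].
rewrite -!iterSr big_ord_recl /= opprD [- (\sum_i _) - _]addrC addrA.
congr (_ - _ - _); apply: eq_bigr => j _; apply: eq_bigr => i _.
by rewrite -!iterSr.
Qed.

(* [psum] expands b along T; [key] is the positivity of a Schur product, whose sums
   over square blocks telescope.  As eps tends to 0, this forces b = 0. *)
Let p j := \sum_i \sum_l dot (iter j L (g l)) (g i) * B (g i) (iter j T (g l)).
Let b := \sum_l B (g l) (g l).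
Let eps n := \sum_l B (iter n L (g l)) (iter n T (g l)).

Let p0 : p 0 = b.
Proof.
apply: eq_bigr => i _; rewrite (bigD1 i) //= hg.2 eqxx mul1r big1 ?addr0 // => j ji.
by rewrite hg.2 (negbTE ji) mul0r.
Qed.

Let psum n : \sum_(j < n) p j.+1 = eps n - b.
Proof.
rewrite /b; under [in RHS]eq_bigr do rewrite (Biter n) //.
rewrite sumrB opprB addrC subrK [RHS]exchange_big /=; apply: eq_bigr => j _.
by rewrite exchange_big.
Qed.

(** Block entry of the Schur product of the Gram matrices of the S^a g_i for [dot] and of the
    T^(N-a) g_i for B. Each operator is isometric for its form, and the reversed exponents of T make
    both factors depend on a - c in the way that [p] requires. *)
Let kap N a c := \sum_i \sum_l dot (iter c S (g l)) (iter a S (g i)) *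
   B (iter (N - a) T (g i)) (iter (N - c) T (g l)).

Let SSn n x y : mem x -> mem y -> dot (iter n S x) (iter n S y) = dot x y.
Proof. by move=> hx hy; elim: n => //= n IH; rewrite SS //; exact: Sn. Qed.
Let LSn n x y : mem x -> mem y -> dot (iter n L x) y = dot x (iter n S y).
Proof.
move=> hx hy; elim: n y hy => //= n IH y hy; rewrite LS //; last exact: Ln.
by rewrite IH ?iterSr -?iterSr //; exact: Sm.
Qed.

Let kapE N a c : (c <= a <= N)%N -> kap N a c = p (a - c).
Proof.
move=> /andP[ca aN]; apply: eq_bigr => i _; apply: eq_bigr => l _; congr (_ * _).
  by rewrite -{1}(subnKC ca) iterD SSn //; [rewrite LSn|exact: Sn].
have -> : (N - c = (N - a) + (a - c))%N by rewrite addnBA // subnK.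
by rewrite iterD BTn //; exact: Tn.
Qed.

Let kapC N a c : kap N c a = (kap N a c)^*.
Proof.
rewrite /kap exchange_big rmorph_sum; apply: eq_bigr => i _ /=.
rewrite rmorph_sum; apply: eq_bigr => l _; rewrite rmorphM /=.
rewrite -dotC; [|exact: Sn..]; congr (_ * _).
by apply: (@dotC R HB); exact: Tn.
Qed.

(** Enlarging the square block from n to n + 1 adds the corner b, the row p_n + ... + p_1 = eps_n -
    b and the conjugate column, with total real part 2 Re eps_n - Re b. *)
Let kap_sum N n : (n <= N.+1)%N ->
  cRe (\sum_(a < n) \sum_(c < n) kap N a c) = \sum_(m < n) (2 * cRe (eps m) - cRe b).
Proof.
elim: n => [|n IH] nN; first by rewrite !big_ord0.
rewrite big_ord_recr [in RHS]big_ord_recr /= -IH; last exact: ltnW.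
have -> : \sum_(a < n) \sum_(c < n.+1) kap N a c =
   \sum_(a < n) \sum_(c < n) kap N a c + \sum_(a < n) kap N a n.
  by rewrite -big_split; apply: eq_bigr => a _; rewrite big_ord_recr.
rewrite big_ord_recr /= kapE ?leqnn ?subnn ?p0 //.
have e : \sum_(c < n) kap N n c = eps n - b.
  rewrite -psum (reindex_inj rev_ord_inj) /=; apply: eq_bigr => c _.
  rewrite kapE; first by rewrite subKn.
  by rewrite leq_subr.
rewrite e; have -> : \sum_(a < n) kap N a n = (eps n - b)^*.
  by rewrite -e rmorph_sum; apply: eq_bigr => a _; rewrite kapC.
by rewrite !cReD cRe_conj !cReD cReN; ring.
Qed.

Let key n : 0 <= \sum_(m < n) (2 * cRe (eps m) - cRe b).
Proof.
rewrite -(@kap_sum n n) ?leqnSn //.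
pose u (j : 'I_n * 'I_d) := iter j.1 S (g j.2).
pose w (j : 'I_n * 'I_d) : ph_sort HB := iter (n - j.1) T (g j.2).
have := @schur_ge0 R H HB _ u w (fun j => Sn _ (gm _)) (fun j => Tn _ (gm _)).
move=> /cge0[_]; congr (0 <= cRe _).
have dbl (F : 'I_n -> 'I_d -> R[i]) : \sum_j F j.1 j.2 = \sum_a \sum_i F a i.
  by rewrite pair_bigA.
rewrite (dbl (fun a i => \sum_k dot (u k) (iter a S (g i)) *
  B (iter (n - a) T (g i)) (w k))).
apply: eq_bigr => a _; rewrite [RHS]exchange_big; apply: eq_bigr => i _.
exact: (dbl (fun c l => dot (iter c S (g l)) (iter a S (g i)) *
  B (iter (n - a) T (g i)) (iter (n - c) T (g l)))).
Qed.

Let Bnrm1 x : mem x -> @nrm R HB x <= nrm x.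
Proof.
by move=> hx; rewrite /nrm ler_sqrt; [exact: limform_le|exact: nrm2_ge0].
Qed.

Let nrm2g i : nrm2 (g i) = 1.
Proof. by rewrite /nrm2 hg.2 eqxx. Qed.

Let TnC n x : mem x -> nrm2 (iter n T x) <= nrm2 x.
Proof.
move=> hx; elim: n => //= n IH; apply: le_trans IH; apply: defl_contr; exact: Tn.
Qed.

Let eps_le n : cRe (eps n) <= \sum_l nrm (iter n L (g l)).
Proof.
rewrite cRe_sum; apply: ler_sum => l _.
apply: le_trans (ler_norm _) _; apply: le_trans (cRe_le_cabs _) _.
apply: le_trans (@CS R HB _ _ _ _) _; [exact: Ln|exact: Tn|].
rewrite -[leRHS]mulr1; apply: ler_pM; rewrite ?nrm_ge0 //; first exact: Bnrm1 (Ln _ _).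
apply: le_trans (Bnrm1 (Tn _ _)) _ => //.
by rewrite -(sqrtr1 R) /nrm ler_sqrt // (le_trans (TnC _ _)) ?nrm2g.
Qed.

Let b_ge0 : 0 <= cRe b.
Proof.
by rewrite cRe_sum; apply: sumr_ge0 => l _; have /cge0[] := @ph_dot_ge0 R HB _ (gm l).
Qed.

Let b0 : cRe b = 0.
Proof.
apply/eqP; rewrite eq_le b_ge0 andbT leNgt; apply/negP => bp.
(* With this e the d summands in [eps_le] add up to at most b / 4, so that every term of the sum in
   [key] beyond M is at most - b / 2. Using d + 1 keeps the denominator positive. *)
pose e := cRe b / (4 * d.+1%:R).
have e0 : 0 < e by rewrite divr_gt0 // mulr_gt0 // ltr0Sn.
have /choice[N hN] l := L0 (gm l) e0.
pose M := (\max_l N l)%N.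
have hM m : (M <= m)%N -> 2 * cRe (eps m) - cRe b <= - (cRe b / 2).
  move=> Mm; have : cRe (eps m) <= cRe b / 4.
    apply: le_trans (eps_le m) _; apply: (@le_trans _ _ (\sum_(l < d) e)).
      apply: ler_sum => l _; apply/ltW/hN; apply: leq_trans Mm; exact: leq_bigmax.
    rewrite sumr_const card_ord.
    have d0 : (0 : R) < d.+1%:R by rewrite ltr0Sn.
    have -> : e *+ d = cRe b / 4 * (d%:R / d.+1%:R).
      by rewrite -[_ *+ d]mulr_natr /e; field; rewrite addrC natr1 gt_eqF.
    rewrite ler_piMr //; first by rewrite divr_ge0 // ltW.
    by rewrite ler_pdivrMr // mul1r ler_nat.
  lra.
have bound k : \sum_(m < M + k) (2 * cRe (eps m) - cRe b) <=
   \sum_(m < M) (2 * cRe (eps m) - cRe b) - k%:R * (cRe b / 2).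
  elim: k => [|k IH]; first by rewrite addn0 mul0r subr0.
  rewrite addnS big_ord_recr /= -[k.+1%:R]natr1 mulrDl.
  have := hM (M + k)%N (leq_addr _ _); move: IH; lra.
pose c0 := \sum_(m < M) (2 * cRe (eps m) - cRe b).
(* Enough terms beyond M to outweigh the fixed initial sum c0. *)
pose k := (Num.truncn (c0 / (cRe b / 2))).+1.
have := le_trans (key (M + k)) (bound k); rewrite -/c0 leNgt => /negP; apply.
rewrite subr_lt0 -ltr_pdivrMr ?divr_gt0 //; exact: truncnS_gt.
Qed.

Let Bg l : @nrm2 R HB (g l) = 0.
Proof.
have : cRe b == 0 by rewrite b0.
rewrite cRe_sum psumr_eq0; last first.
  by move=> i _; have /cge0[] := @ph_dot_ge0 R HB _ (gm i).
by move=> /allP /(_ l (mem_index_enum l)) /eqP.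
Qed.

(** The g_i being B-null, the projection drops out of [Bstep], and B x x = B (L^n x) (T^n x) for
    every n. Cauchy-Schwarz bounds this by |L^n x| |x|, which tends to 0. *)
Lemma deflation_stable x : mem x -> forall e : R, 0 < e ->
  exists N, forall n, (N <= n)%N -> nrm2 (iter n T x) < e.
Proof.
move=> hx e; apply: (@limform0_cvg R H T deflm defl_lin defl_contr x hx _ e).
have h y z : mem y -> mem z -> B y z = B (L y) (T z).
  move=> hy hz; rewrite Bstep // big1 ?subr0 // => i _.
  have e0 : B (g i) (T z) = 0 by exact: (@dot_null R HB _ _ (gm i) (deflm hz) (Bg i)).
  by rewrite e0 mulr0.
have h1 n y z : mem y -> mem z -> B y z = B (iter n L y) (iter n T z).
  move=> hy hz.
  by elim: n => //= n ->; apply: h; [exact: Ln|exact: Tn].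
apply/eqP; rewrite -sqrf_eq0 -[_ == _]negbK; apply/negP => nz.
have a0 : 0 < @nrm2 R HB x.
  by rewrite lt0r -sqrf_eq0 nz; apply: (@nrm2_ge0 R HB).
have x0 : 0 <= nrm x by exact: nrm_ge0.
have [N hN] := L0 hx (divr_gt0 a0 (ltr_wpDl x0 (@ltr01 R))).
have := hN N (leqnn _); rewrite ltr_pdivlMr; last by rewrite ltr_wpDl.
apply/negP; rewrite -leNgt.
have -> : @nrm2 R HB x = cRe (B (iter N L x) (iter N T x)) by rewrite -h1.
apply: le_trans (ler_norm _) _; apply: le_trans (cRe_le_cabs _) _.
apply: le_trans (@CS R HB _ _ _ _) _; [exact: Ln|exact: Tn|].
apply: ler_pM; rewrite ?nrm_ge0 //; first exact: Bnrm1 (Ln _ _).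
apply: le_trans (Bnrm1 (Tn _ _)) _ => //.
apply: (@le_trans _ _ (nrm x)); last by rewrite lerDl.
by rewrite /nrm ler_sqrt ?TnC ?nrm2_ge0.
Qed.
End Stability.

(** * Integration over the unit interval *)

Section RealL2.
Variable R : realType.
Notation mu := (@lebesgue_measure R).
Notation D := (`[0%R, 1%R]%classic : set (measurableTypeR R)).
Implicit Types (u v w : R -> R).

Lemma mD : measurable D. Proof. exact: measurable_itv. Qed.
Hint Resolve mD : core.

Lemma muD : mu D = 1%:E.
Proof. by rewrite lebesgue_measure_itv /= lte_fin ltr01 sube0. Qed.

Definition rint u := mu.-integrable D (EFin \o u).
Definition Int u : R := (\int[mu]_(t in D) u t)%R.

Lemma rint_meas u : rint u -> measurable_fun D u.
Proof. by move=> /integrableP[/measurable_EFinP]. Qed.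
Lemma rintD u v : rint u -> rint v -> rint (fun t => u t + v t).
Proof. by move=> hu hv; exact: (integrableD mD hu hv). Qed.
Lemma rintB u v : rint u -> rint v -> rint (fun t => u t - v t).
Proof. by move=> hu hv; exact: (integrableB mD hu hv). Qed.
Lemma rintZ c u : rint u -> rint (fun t => c * u t).
Proof. by move=> hu; exact: (integrableZl mD c hu). Qed.
Lemma rint_cst c : rint (fun=> c).
Proof.
apply/integrableP; split; first exact: measurable_cst.
by rewrite integral_cst //= muD mule1 ltry.
Qed.
Lemma rint_abs u : rint u -> rint (fun t => `|u t|).
Proof.
by move=> hu; exact: (integrable_abse hu).
Qed.
Lemma rint_le u v : measurable_fun D u -> rint v ->
  (forall t, D t -> `|u t| <= v t) -> rint u.
Proof.
move=> mu_ hv h; apply: (le_integrable mD _ _ hv); first exact/measurable_EFinP.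
move=> t Dt /=; rewrite lee_fin; apply: le_trans (h t Dt) _; exact: ler_norm.
Qed.
Lemma IntD u v : rint u -> rint v -> Int (fun t => u t + v t) = Int u + Int v.
Proof. by move=> *; rewrite /Int RintegralD. Qed.
Lemma IntB u v : rint u -> rint v -> Int (fun t => u t - v t) = Int u - Int v.
Proof. by move=> *; rewrite /Int RintegralB. Qed.
Lemma IntZ c u : rint u -> Int (fun t => c * u t) = c * Int u.
Proof. by move=> *; rewrite /Int RintegralZl. Qed.
Lemma IntN u : rint u -> Int (fun t => - u t) = - Int u.
Proof.
by move=> h; rewrite -mulN1r -IntZ //; congr Int; apply/funext => t; rewrite mulN1r.
Qed.
Lemma Int_cst c : Int (fun=> c) = c.
Proof.
by rewrite /Int Rintegral_cst // -[X in _ * fine X]/(mu D) muD mulr1.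
Qed.
Lemma Int_le u v : rint u -> rint v -> (forall t, D t -> u t <= v t) -> Int u <= Int v.
Proof. by move=> *; exact: le_Rintegral. Qed.
Lemma Int_ge0 u : (forall t, D t -> 0 <= u t) -> 0 <= Int u.
Proof. by move=> *; exact: Rintegral_ge0. Qed.
Lemma Int_abs u : rint u -> `|Int u| <= Int (fun t => `|u t|).
Proof. by move=> *; exact: le_normr_Rintegral. Qed.
Lemma Int_EFin u : rint u -> (\int[mu]_(t in D) (u t)%:E)%E = (Int u)%:E.
Proof. by move=> h; rewrite /Int /Rintegral fineK //; exact: integrable_fin_num. Qed.
Lemma Int_ext u v : (forall t, D t -> u t = v t) -> Int u = Int v.
Proof. by move=> h; apply: eq_Rintegral => t; rewrite inE => /h. Qed.
Lemma rint_ext u v : (forall t, D t -> u t = v t) -> rint u -> rint v.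
Proof.
by move=> h; apply: eq_integrable => // t; rewrite inE => /h /= ->.
Qed.

Definition aeD (P : R -> Prop) := {ae mu, forall t : R, D t -> P t}.
Lemma ae_flt : Filter (nbhs (almost_everywhere mu)).
Proof. exact: (ae_filter_ringOfSetsType mu). Qed.
Local Existing Instance ae_flt.
Lemma aeDW (P : R -> Prop) : (forall t, D t -> P t) -> aeD P.
Proof. by move=> h; apply: aeW. Qed.
Lemma aeD_sub (P Q : R -> Prop) : (forall t, D t -> P t -> Q t) -> aeD P -> aeD Q.
Proof. by move=> h; rewrite /aeD; apply: filterS => t hP Dt; exact: h (hP Dt). Qed.
Lemma aeD_and (P Q : R -> Prop) : aeD P -> aeD Q -> aeD (fun t => P t /\ Q t).
Proof. by rewrite /aeD => hP hQ; apply: filterS2 hP hQ => t h1 h2 Dt; split; auto. Qed.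
Lemma aeD_all (I : finType) (P : I -> R -> Prop) :
  (forall i, aeD (P i)) -> aeD (fun t => forall i, P i t).
Proof.
rewrite /aeD => h; have := filter_forall ae_flt h.
by apply: filterS => t ht Dt i; exact: ht.
Qed.

(** Measurability of v has to be assumed, since a Borel function changed on a null set may cease to
    be Borel. *)
Lemma rint_ae u v : measurable_fun D v -> aeD (fun t => u t = v t) -> rint u -> rint v.
Proof.
move=> mv h hu; apply/integrableP; split; first exact/measurable_EFinP.
have /integrableP[_] := hu; congr (_ < _)%E.
have mu1 := rint_meas hu.
apply: ge0_ae_eq_integral => //.
- by apply: measurableT_comp => //; exact/measurable_EFinP.
- by apply: measurableT_comp => //; exact/measurable_EFinP.
by apply: (@filterS _ _ ae_flt _ _ _ h) => t /= ht Dt; rewrite ht.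
Qed.
Lemma Int_ae u v : rint u -> rint v -> aeD (fun t => u t = v t) -> Int u = Int v.
Proof.
move=> hu hv h; congr fine; apply: ae_eq_integral => //.
- by apply/measurable_EFinP; exact: rint_meas.
- by apply/measurable_EFinP; exact: rint_meas.
by apply: (@filterS _ _ ae_flt _ _ _ h) => t /= ht Dt; rewrite ht.
Qed.
Lemma Int0_ae u : rint u -> (forall t, D t -> 0 <= u t) -> Int u = 0 ->
  aeD (fun t => u t = 0).
Proof.
move=> hu u0 I0.
have /(ae_eq_integral_abs mu mD) : measurable_fun D (EFin \o u).
  by apply/measurable_EFinP; exact: rint_meas.
move=> [+ _]; have -> : (\int[mu]_(x in D) `|(EFin \o u) x| = 0)%E.
  transitivity (Int u)%:E; last by rewrite I0.
  rewrite -Int_EFin //; apply: eq_integral => t; rewrite inE => Dt /=.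
  by rewrite ger0_norm // u0.
by move=> /(_ erefl); apply: (@filterS _ _ ae_flt) => t h Dt; have [] := h Dt.
Qed.

Definition rL2 u := measurable_fun D u /\ rint (fun t => u t ^+ 2).

Lemma rL2_bnd u : measurable_fun D u ->
  ((\int[mu]_(t in D) ((u t) ^+ 2)%:E < +oo)%E <-> rL2 u).
Proof.
move=> mu_; split=> [h|[_ h]]; last first.
  by rewrite Int_EFin // ltry.
split => //; apply/integrableP; split.
  by apply/measurable_EFinP; exact: measurable_funX.
move: h; congr (_ < _)%E; apply: eq_integral => t _.
by rewrite /= ger0_norm // sqr_ge0.
Qed.
Lemma rL2_mul u v : rL2 u -> rL2 v -> rint (fun t => u t * v t).
Proof.
move=> [mu1 hu] [mv hv].
apply: (@rint_le _ (fun t => u t ^+ 2 + v t ^+ 2)); first exact: measurable_funM.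
  exact: rintD.
move=> t _; rewrite normrM.
have : 0 <= (`|u t| - `|v t|) ^+ 2 by exact: sqr_ge0.
rewrite -[u t ^+ 2]real_normK ?num_real // -[v t ^+ 2]real_normK ?num_real //.
rewrite sqrrB; have : 0 <= `|u t| * `|v t| by rewrite mulr_ge0.
lra.
Qed.
Lemma rL2D u v : rL2 u -> rL2 v -> rL2 (fun t => u t + v t).
Proof.
move=> hu hv; have [mu1 iu] := hu; have [mv iv] := hv; split.
  exact: measurable_funD.
apply: (@rint_ext (fun t => (u t ^+ 2 + v t ^+ 2) + 2 * (u t * v t))).
  by move=> t _; rewrite sqrrD; ring.
by apply: rintD; [exact: rintD|apply: rintZ; exact: rL2_mul].
Qed.
Lemma rL2Z c u : rL2 u -> rL2 (fun t => c * u t).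
Proof.
move=> [mu1 iu]; split; first by apply: measurable_funM => //; exact: measurable_cst.
by apply: (@rint_ext (fun t => c ^+ 2 * u t ^+ 2)); [move=> t _; rewrite exprMn|exact: rintZ].
Qed.
Lemma rL2N u : rL2 u -> rL2 (fun t => - u t).
Proof.
by move=> h; have := rL2Z (-1) h; congr rL2; apply/funext => t; rewrite mulN1r.
Qed.
Lemma rL2B u v : rL2 u -> rL2 v -> rL2 (fun t => u t - v t).
Proof. by move=> hu hv; apply: rL2D => //; exact: rL2N. Qed.
Lemma rL2_cst c : rL2 (fun=> c).
Proof. by split; [exact: measurable_cst|exact: rint_cst]. Qed.
Lemma rL2_rint u : rL2 u -> rint u.
Proof.
move=> h; apply: (@rint_ext (fun t => 1 * u t)); first by move=> t _; rewrite mul1r.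
by apply: rL2_mul => //; exact: rL2_cst.
Qed.
Lemma rint_bmul (b : R) u v : measurable_fun D u -> (forall t, D t -> `|u t| <= b) ->
  rint v -> rint (fun t => u t * v t).
Proof.
move=> mu1 hb iv.
apply: (@rint_le _ (fun t => b * `|v t|)); last first.
- move=> t Dt; rewrite normrM ler_wpM2r //; exact: hb.
- by apply: rintZ; exact: rint_abs.
- by apply: measurable_funM => //; exact: rint_meas.
Qed.
End RealL2.
Arguments mD {R}.

(** * Riesz-Fischer completeness of real L^2 *)

Section RealComplete.
Variable R : realType.
Notation mu := (@lebesgue_measure R).
Notation D := (`[0%R, 1%R]%classic : set (measurableTypeR R)).
Hint Resolve mD : core.
Local Existing Instance ae_flt.

(** By |x| <= (2^k x^2 + 2^-k) / 2, the integral of |h_(k+1) - h_k| is at most 2^-k. The sum of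
    these increments has a finite integral, so it is finite almost everywhere and bounds the
    telescoping series. *)
Lemma abs_series_ae_cvg (h : nat -> R -> R) : (forall k, rL2 (h k)) ->
  (forall k, Int (fun t => (h k.+1 t - h k t) ^+ 2) <= (4^-1) ^+ k) ->
  aeD (fun t => cvgn (fun k => h k t)).
Proof.
move=> hh hI.
pose G k t : R := `|h k.+1 t - h k t|.
have rG k : rint (G k) by apply: rint_abs; apply: rL2_rint; exact: rL2B.
have GI k : Int (G k) <= (2^-1) ^+ k.
  have r2 : rint (fun t => (h k.+1 t - h k t) ^+ 2) by have [] := rL2B (hh k.+1) (hh k).
  apply: (@le_trans _ _ (Int (fun t => 2^-1 * (2 ^+ k * (h k.+1 t - h k t) ^+ 2 + (2^-1) ^+ k)))).
    apply: Int_le => //; first by apply: rintZ; apply: rintD; [exact: rintZ|exact: rint_cst].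
    move=> t _; rewrite /G; set x := _ - _.
    have c0 : (0 : R) < 2 ^+ k by rewrite exprn_gt0.
    have -> : (2^-1 : R) ^+ k = (2 ^+ k)^-1 by rewrite exprVn.
    rewrite -[x ^+ 2]real_normK ?num_real //.
    move: (2 ^+ k) c0 => c c0.
    have -> : 2^-1 * (c * `|x| ^+ 2 + c^-1) = `|x| + 2^-1 * c * (`|x| - c^-1) ^+ 2.
      by field; rewrite gt_eqF.
    by rewrite lerDl mulr_ge0 ?sqr_ge0 // mulr_ge0 // ltW.
  rewrite IntZ; last by apply: rintD; [exact: rintZ|exact: rint_cst].
  rewrite IntD ?Int_cst ?IntZ //; [|exact: rintZ|exact: rint_cst].
  have := hI k; have -> : (4^-1 : R) ^+ k = (2^-1) ^+ k * (2^-1) ^+ k.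
    by rewrite -exprMn; congr (_ ^+ _); field.
  have : (2 : R) ^+ k * (2^-1) ^+ k = 1 by rewrite -exprMn mulfV // expr1n.
  have : (0 : R) < 2 ^+ k by rewrite exprn_gt0.
  move: (2 ^+ k) ((2^-1) ^+ k) => c e c0 ce hle.
  have : c * Int (fun t => (h k.+1 t - h k t) ^+ 2) <= e.
    by rewrite -[leRHS]mul1r -ce -mulrA ler_pM2l.
  lra.
have mG k : measurable_fun D (EFin \o G k).
  by apply/measurable_EFinP; exact: rint_meas.
have S : (\int[mu]_(t in D) (\sum_(0 <= k <oo) (G k t)%:E) < +oo)%E.
  rewrite integral_nneseries //; last by move=> k t _; rewrite lee_fin normr_ge0.
  apply: (@le_lt_trans _ _ (\sum_(0 <= k <oo) (2 / (2 ^ (k + 0.+1))%:R)%:E)%E); last first.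
    by rewrite (cvg_lim _ (@cvg_geometric_eseries_half R 2 0)) // ltry.
  apply: lee_nneseries => [k _ _|k _].
    by apply: integral_ge0 => t _; rewrite lee_fin normr_ge0.
  rewrite Int_EFin // lee_fin; apply: le_trans (GI k) _.
  by rewrite addn1 natrX exprS exprVn invfM mulrA mulfV // mul1r.
have iS : mu.-integrable D (fun t => \sum_(0 <= k <oo) (G k t)%:E)%E.
  apply/integrableP; split.
    apply: (@ge0_emeasurable_sum _ _ _ D (fun k t => (G k t)%:E) xpredT).
      by move=> k t _ _; rewrite lee_fin normr_ge0.
    by move=> k _; exact: mG.
  move: S; congr (_ < _)%E; apply: eq_integral => t _; rewrite gee0_abs //.
  by apply: nneseries_ge0 => k _ _; rewrite lee_fin normr_ge0.
have := integrable_ae mD iS; apply: (@filterS _ _ (ae_flt R)) => t ht Dt.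
have {ht} := ht Dt; set s := (\big[+%E/0%R]_(0 <= n <oo) _) => sfin.
pose u k := h k t; rewrite -/u.
have -> : u = (fun n => u 0%N + series (telescope u) n).
  by apply/funext => n; rewrite -eq_sum_telescope.
apply: is_cvgD; first exact: is_cvg_cst.
apply: normed_cvg; apply: nondecreasing_is_cvgn.
  by apply: nondecreasing_series => n _ _ /=; exact: normr_ge0.
exists (fine s) => _ [n _ <-].
rewrite -lee_fin fineK // /series /= -sumEFin.
by apply: nneseries_lim_ge => k _ _; rewrite lee_fin normr_ge0.
Qed.

(** Functions on the circle are given on the plane and integrated through a parametrization c, which
    need not be injective. Taking the limit as a pointwise limsup on X keeps it of the form f o c.
    Fatou's lemma then turns the Cauchy bounds into bounds on the distance to f. *)
Lemma rL2_complete (X : Type) (c : R -> X) (u : nat -> X -> R) :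
  (forall n, rL2 (u n \o c)) ->
  (forall e : R, 0 < e -> exists N, forall m n, (N <= m)%N -> (N <= n)%N ->
     Int (fun t => (u m (c t) - u n (c t)) ^+ 2) <= e) ->
  exists f : X -> R, rL2 (f \o c) /\ forall e : R, 0 < e ->
    exists N, forall n, (N <= n)%N -> Int (fun t => (u n (c t) - f (c t)) ^+ 2) <= e.
Proof.
move=> hu hC.
have e0 k : (0 : R) < (4^-1) ^+ k by rewrite exprn_gt0.
have /choice[N hN] k := hC _ (e0 k).
(* Running maxima make the subsequence of indices monotone as well as beyond each N k. *)
pose phi k := (\max_(i < k.+1) N i)%N.
have phiN k : (N k <= phi k)%N by rewrite /phi; exact: (leq_bigmax (@ord_max k)).
have phiS k : (phi k <= phi k.+1)%N by rewrite /phi [leqRHS]big_ord_recr leq_maxl.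
have phi_mono j k : (j <= k)%N -> (phi j <= phi k)%N.
  by move=> jk; apply: (homo_leq (@leqnn) leq_trans phiS).
pose h k t := u (phi k) (c t).
have hh k : rL2 (h k) by exact: hu.
have hcv : aeD (fun t => cvgn (fun k => h k t)).
  apply: abs_series_ae_cvg => // k; apply: hN => //.
  exact: leq_trans (phiN k) (phiS k).
pose f x := fine (limn_esup (fun k => (u (phi k) x)%:E)).
have mh k : measurable_fun D (EFin \o h k).
  by apply/measurable_EFinP; have [] := hh k.
have mf : measurable_fun D (f \o c).
  apply: (@measurableT_comp _ _ _ _ _ _ (@fine R)) => //.
  exact: (measurable_fun_limn_esup mh).
have fE : aeD (fun t => h k t @[k --> \oo] --> f (c t)).
  apply: aeD_sub hcv => t _ ht.
  have e : ((fun k => (h k t)%:E) @ \oo --> (limn (fun k => h k t))%:E)%E.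
    by apply: cvg_EFin => //; apply: nearW.
  rewrite /f; have -> : limn_esup (fun k => (u (phi k) (c t))%:E) = (limn (fun k => h k t))%:E.
    by have [] := cvg_limn_einf_sup e.
  exact: ht.
have key k n : (N k <= n)%N -> rL2 (f \o c) /\ Int (fun t => (u n (c t) - f (c t)) ^+ 2) <= (4^-1) ^+ k.
  move=> Nn.
  pose g j t : \bar R := ((u n (c t) - h j t) ^+ 2)%:E.
  have rg j : rint (fun t => (u n (c t) - h j t) ^+ 2).
    by have [] := rL2B (hu n) (hh j).
  have mg j : measurable_fun D (g j).
    by apply/measurable_EFinP; exact: rint_meas.
  have g0 j t : D t -> (0 <= g j t)%E by move=> _; rewrite lee_fin sqr_ge0.
  have F := fatou mu mD mg g0.
  have m2 : measurable_fun D (fun t => (u n (c t) - f (c t)) ^+ 2).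
    by apply: measurable_funX; apply: measurable_funB => //; have [] := hu n.
  have E : (\int[mu]_(t in D) ((u n (c t) - f (c t)) ^+ 2)%:E)%E =
           (\int[mu]_(t in D) limn_einf (g^~ t))%E.
    apply: ge0_ae_eq_integral => //.
    - exact/measurable_EFinP.
    - have -> : (fun t => limn_einf (g^~ t)) = (fun t => - limn_esup (-%E \o g^~ t))%E.
        by apply/funext => t; rewrite limn_esupN oppeK.
      apply: measurableT_comp => //.
      apply: (@measurable_fun_limn_esup _ _ _ _ (fun j t => - g j t)%E) => j.
      have mm := measurable_funN (rint_meas (rg j)).
      exact: (proj2 (measurable_EFinP _ _) mm).
    - by move=> t _; rewrite lee_fin sqr_ge0.
    - move=> t Dt; rewrite limn_einf_lim; apply: lime_ge; first exact: is_cvg_einfs.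
      by apply: nearW => j; apply: le_ereal_inf_tmp => _ [i _ <-]; exact: g0.
    apply: (@filterS _ _ (ae_flt R) _ _ _ fE) => t ht Dt; have {}ht := ht Dt.
    have e : (g^~ t @ \oo --> ((u n (c t) - f (c t)) ^+ 2)%:E)%E.
      apply: cvg_EFin; first exact: nearW.
      apply: cvgM; apply: cvgB => //; exact: cvg_cst.
    by have [] := cvg_limn_einf_sup e.
  have B : (\int[mu]_(t in D) ((u n (c t) - f (c t)) ^+ 2)%:E <= ((4^-1) ^+ k)%:E)%E.
    rewrite E; apply: le_trans F _.
    rewrite limn_einf_lim; apply: lime_le; first exact: is_cvg_einfs.
    apply: nearW => j; set v := (fun i => _).
    apply: (@le_trans _ _ (v (maxn j k))).
      by apply: ereal_inf_lbound; exists (maxn j k) => //=; exact: leq_maxl.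
    rewrite /v Int_EFin // lee_fin; apply: hN => //.
    by apply: leq_trans (phiN k) _; apply: phi_mono; exact: leq_maxr.
  have r2 : rL2 (fun t => u n (c t) - f (c t)).
    apply/rL2_bnd; last by apply: le_lt_trans B _; rewrite ltry.
    by apply: measurable_funB => //; have [] := hu n.
  split; last by rewrite -lee_fin -Int_EFin //; case: r2.
  have := rL2B (hu n) r2; congr rL2; apply/funext => t /=; ring.
exists f; split; first by case: (key 0%N (N 0%N) (leqnn _)).
move=> e epos.
have [k hk] : exists k, (4^-1 : R) ^+ k <= e.
  exists (Num.truncn e^-1); rewrite exprVn invf_ple ?posrE ?exprn_gt0 //.
  apply: le_trans (ltW (truncnS_gt _)) _.
  by rewrite -natrX ler_nat; exact: ltn_expl.
exists (N k) => n Nn; apply: le_trans hk; by case: (key k n Nn).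
Qed.
End RealComplete.

(** * Uniqueness of trigonometric coefficients *)

Section TrigUnique.
Variable R : realType.
Notation mu := (@lebesgue_measure R).
Notation D := (`[0%R, 1%R]%classic : set (measurableTypeR R)).
Hint Resolve mD : core.
Local Existing Instance ae_flt.

Lemma bernoulli_le (s : R) n : 0 <= s -> 1 + n%:R * s <= (1 + s) ^+ n.
Proof.
move=> s0; elim: n => [|n IH]; first by rewrite mul0r addr0 expr0.
rewrite exprS -[n.+1%:R]natr1.
apply: (@le_trans _ _ ((1 + s) * (1 + n%:R * s))).
  have : 0 <= s * (n%:R * s) by rewrite !mulr_ge0.
  lra.
by rewrite ler_wpM2l // addr_ge0.
Qed.
Lemma bernoulli_ge (y : R) n : 0 <= y <= 1 -> 1 - n%:R * y <= (1 - y) ^+ n.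
Proof.
move=> /andP[y0 y1]; elim: n => [|n IH]; first by rewrite mul0r subr0 expr0.
rewrite exprS -[n.+1%:R]natr1.
apply: (@le_trans _ _ ((1 - y) * (1 - n%:R * y))).
  have : 0 <= y * (n%:R * y) by rewrite !mulr_ge0.
  lra.
by rewrite ler_wpM2l // subr_ge0.
Qed.

(** With q = sqrt r and s = 1/q - 1, Bernoulli's inequality gives n s <= q^-n, hence n r^n <= q^n /
    s. *)
Lemma cvg_nat_geometric (r : R) : 0 <= r -> r < 1 -> n%:R * r ^+ n @[n --> \oo] --> (0 : R).
Proof.
move=> r0 r1; case: (eqVneq r 0) => [->|rn0].
  apply: cvg_near_cst; near=> n; rewrite expr0n gtn_eqF ?mulr0 //.
  by near: n; exact: nbhs_infty_gt.
have rp : 0 < r by rewrite lt0r rn0.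
set q := Num.sqrt r; have q0 : 0 < q by rewrite sqrtr_gt0.
have q1 : q < 1 by rewrite -(sqrtr1 R) ltr_sqrt.
have qq : q ^+ 2 = r by rewrite sqr_sqrtr.
pose s := q^-1 - 1; have s0 : 0 < s by rewrite subr_gt0 invf_gt1.
apply: (@squeeze_cvgr _ _ _ _ (cst 0) (fun n => s^-1 * q ^+ n)).
- near=> n; rewrite /= mulr_ge0 ?exprn_ge0 //= -qq -exprM mulnC exprM expr2 mulrA.
  rewrite ler_pM2r ?exprn_gt0 //.
  have := bernoulli_le n (ltW s0); rewrite /s addrCA subrr addr0 exprVn => h.
  have {}h : n%:R * s <= (q ^+ n)^-1 by apply: le_trans h; rewrite lerDr.
  rewrite -ler_pdivlMr ?exprn_gt0 // ler_pdivlMl // mulrC.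
  exact: h.
- exact: cvg_cst.
rewrite -[X in _ --> X](mulr0 s^-1); apply: cvgMl_tmp; apply: cvg_expr.
by rewrite ger0_norm // ltW.
Unshelve. all: end_near. Qed.

(** The exponent is chosen so that (n 2^n) h^n = n (2h)^n, which tends to 0 for h < 1/2 and is at
    least n otherwise. In the first case Bernoulli's inequality bounds the power from below; in the
    second, (1 - y)^N (1 + y)^N <= 1 bounds it above by 1 / (n + 1). *)
Lemma cvg_threshold (h : R) : 0 <= h <= 1 ->
  (1 - h ^+ n) ^+ (n * 2 ^ n) @[n --> \oo] --> (if h < 2^-1 then 1 else 0 : R).
Proof.
move=> /andP[h0 h1].
have hn n : 0 <= h ^+ n <= 1 by rewrite exprn_ge0 ?exprn_ile1.
have e n : (n * 2 ^ n)%:R * h ^+ n = n%:R * (2 * h) ^+ n :> R.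
  by rewrite natrM natrX exprMn mulrA.
case: ltP => hh.
  apply: (@squeeze_cvgr _ _ _ _ (fun n => 1 - n%:R * (2 * h) ^+ n) (cst 1)).
  - near=> n; rewrite -e bernoulli_ge //=.
    have /andP[a b] := hn n; apply: exprn_ile1; rewrite ?subr_ge0 //.
    by rewrite gerBl.
  - rewrite -[X in _ --> X]subr0; apply: cvgB; first exact: cvg_cst.
    apply: cvg_nat_geometric; first by rewrite mulr_ge0.
    by rewrite mulrC -ltr_pdivlMr // mul1r.
  - exact: cvg_cst.
apply: (@squeeze_cvgr _ _ _ _ (cst 0) (@harmonic R)).
- near=> n; have /andP[a b] := hn n; rewrite /= exprn_ge0 ?subr_ge0 //=.
  set N := (n * 2 ^ n)%N; set y := h ^+ n.
  have p1 : (1 - y) ^+ N * (1 + y) ^+ N <= 1.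
    rewrite -exprMn; apply: exprn_ile1.
      by rewrite mulr_ge0 ?subr_ge0 // addr_ge0.
    have -> : (1 - y) * (1 + y) = 1 - y ^+ 2 by ring.
    by rewrite gerBl sqr_ge0.
  have p2 : n.+1%:R <= (1 + y) ^+ N.
    apply: le_trans (bernoulli_le N a); rewrite e -[n.+1%:R]natr1 addrC lerD2l.
    rewrite ler_peMr // exprn_ege1 // mulrC -ler_pdivrMr // mul1r //.
  rewrite /harmonic -[leRHS]mul1r ler_pdivlMr ?ltr0Sn //.
  by apply: le_trans p1; rewrite ler_wpM2l // exprn_ge0 // subr_ge0.
- exact: cvg_cst.
exact: cvg_harmonic.
Unshelve. all: end_near. Qed.

Definition angle (t : R) : R := 2 * pi * t.

Lemma meas_cos (a : R) : measurable_fun D (fun t => cos (a * angle t)).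
Proof.
apply: measurable_funTS; apply: continuous_measurable_fun => x.
apply: (@continuous_comp _ _ _ (fun t => a * angle t) cos); last exact: continuous_cos.
rewrite /angle; apply: cvgMl_tmp; apply: cvgMl_tmp; exact: cvg_id.
Qed.
Lemma meas_sin (a : R) : measurable_fun D (fun t => sin (a * angle t)).
Proof.
apply: measurable_funTS; apply: continuous_measurable_fun => x.
apply: (@continuous_comp _ _ _ (fun t => a * angle t) sin); last exact: continuous_sin.
rewrite /angle; apply: cvgMl_tmp; apply: cvgMl_tmp; exact: cvg_id.
Qed.
Lemma cos_le1n (x : R) : `|cos x| <= 1.
Proof. by rewrite ler_norml cos_geN1 cos_le1. Qed.
Lemma sin_le1n (x : R) : `|sin x| <= 1.
Proof. by rewrite ler_norml sin_geN1 sin_le1. Qed.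

Variable u : R -> R.
Hypothesis iu : rint u.
Hypothesis uc : forall n : nat, Int (fun t => u t * cos (n%:R * angle t)) = 0.
Hypothesis us : forall n : nat, Int (fun t => u t * sin (n%:R * angle t)) = 0.

(* The class of the f such that u f has zero trigonometric coefficients contains the
   constants and is stable under products by cos and sin and under bounded limits;
   it turns out to contain the indicators of arcs. *)
Definition annul (f : R -> R) := [/\ measurable_fun D f,
  exists b : R, forall t, D t -> `|f t| <= b,
  forall n : nat, Int (fun t => u t * f t * cos (n%:R * angle t)) = 0 &
  forall n : nat, Int (fun t => u t * f t * sin (n%:R * angle t)) = 0].

Lemma annul_int f : annul f -> rint (fun t => u t * f t).
Proof.
move=> [mf [b hb] _ _].
by apply: (@rint_ext _ (fun t => f t * u t)); [move=> t _; rewrite mulrC|exact: rint_bmul hb iu].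
Qed.
Lemma rint_cosM v a : rint v -> rint (fun t => v t * cos (a * angle t)).
Proof.
move=> iv; apply: (@rint_ext _ (fun t => cos (a * angle t) * v t)).
  by move=> t _; rewrite mulrC.
by apply: (@rint_bmul _ 1) => //; [exact: meas_cos|move=> t _; exact: cos_le1n].
Qed.
Lemma rint_sinM v a : rint v -> rint (fun t => v t * sin (a * angle t)).
Proof.
move=> iv; apply: (@rint_ext _ (fun t => sin (a * angle t) * v t)).
  by move=> t _; rewrite mulrC.
by apply: (@rint_bmul _ 1) => //; [exact: meas_sin|move=> t _; exact: sin_le1n].
Qed.
Lemma annul1 : annul (fun=> 1).
Proof.
split; first exact: measurable_cst.
- by exists 1 => t _; rewrite normr1.
- by move=> n; rewrite -[RHS](uc n); apply: Int_ext => t _; rewrite mulr1.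
- by move=> n; rewrite -[RHS](us n); apply: Int_ext => t _; rewrite mulr1.
Qed.
Lemma annulD f g : annul f -> annul g -> annul (fun t => f t + g t).
Proof.
move=> hf hg; have iF := annul_int hf; have iG := annul_int hg.
have [mf [b hb] cf sf] := hf; have [mg [b' hb'] cg sg] := hg.
split; first exact: measurable_funD.
- exists (b + b') => t Dt; apply: le_trans (ler_normD _ _) _.
  by apply: lerD; [exact: hb|exact: hb'].
- move=> n; transitivity (Int (fun t => u t * f t * cos (n%:R * angle t)) + Int (fun t => u t * g t * cos (n%:R * angle t))).
    rewrite -IntD; [|exact: rint_cosM..].
    by apply: Int_ext => t _; ring.
  by rewrite cf cg addr0.
- move=> n; transitivity (Int (fun t => u t * f t * sin (n%:R * angle t)) + Int (fun t => u t * g t * sin (n%:R * angle t))).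
    rewrite -IntD; [|exact: rint_sinM..].
    by apply: Int_ext => t _; ring.
  by rewrite sf sg addr0.
Qed.
Lemma annulZ c f : annul f -> annul (fun t => c * f t).
Proof.
move=> hf; have iF := annul_int hf; have [mf [b hb] cf sf] := hf.
split; first by apply: measurable_funM => //; exact: measurable_cst.
- exists (`|c| * b) => t Dt; rewrite normrM ler_wpM2l //; exact: hb.
- move=> n; transitivity (c * Int (fun t => u t * f t * cos (n%:R * angle t))).
    rewrite -IntZ; last exact: rint_cosM.
    by apply: Int_ext => t _; ring.
  by rewrite cf mulr0.
- move=> n; transitivity (c * Int (fun t => u t * f t * sin (n%:R * angle t))).
    rewrite -IntZ; last exact: rint_sinM.
    by apply: Int_ext => t _; ring.
  by rewrite sf mulr0.
Qed.
(** Multiplication by the cosine or sine of the angle shifts frequencies by one. From n = 0 this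
    leads to the frequency -1, which parity brings back to 1. *)
Lemma annul_pred f (n : nat) : annul f ->
  Int (fun t => u t * f t * cos ((n%:R - 1) * angle t)) = 0 /\
  Int (fun t => u t * f t * sin ((n%:R - 1) * angle t)) = 0.
Proof.
move=> hf; have [mf [b hb] cf sf] := hf; case: n => [|n]; last first.
  have -> : n.+1%:R - 1 = n%:R :> R by rewrite -natr1 addrK.
  by split.
split.
  rewrite -[RHS](cf 1%N); apply: Int_ext => t _.
  by rewrite sub0r mulN1r cosN mul1r.
transitivity (- Int (fun t => u t * f t * sin (1%:R * angle t))); last by rewrite sf oppr0.
rewrite -IntN; last exact: rint_sinM (annul_int hf).
by apply: Int_ext => t _; rewrite sub0r mulN1r sinN mul1r mulrN.
Qed.
Lemma annul_half f (v w x : R -> R) (c : R) : rint (fun t => u t * f t * v t) ->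
  rint (fun t => u t * f t * w t) ->
  Int (fun t => u t * f t * v t) = 0 -> Int (fun t => u t * f t * w t) = 0 ->
  (forall t, x t = 2^-1 * (v t + c * w t)) -> Int (fun t => u t * f t * x t) = 0.
Proof.
move=> iv iw v0 w0 e.
transitivity (2^-1 * (Int (fun t => u t * f t * v t) + c * Int (fun t => u t * f t * w t))).
  rewrite -IntZ // -IntD //; last exact: rintZ.
  rewrite -IntZ; last by apply: rintD => //; exact: rintZ.
  by apply: Int_ext => t _; rewrite e; ring.
by rewrite v0 w0 mulr0 addr0 mulr0.
Qed.
Lemma annul_cos f : annul f -> annul (fun t => f t * cos (angle t)).
Proof.
move=> hf; have [mf [b hb] cf sf] := hf; have iF := annul_int hf.
split.
- by apply: measurable_funM => //; have := meas_cos 1; apply: eq_measurable_fun => t _; rewrite mul1r.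
- exists b => t Dt; rewrite normrM -[leRHS]mulr1 ler_pM //; [exact: hb|exact: cos_le1n].
- move=> n; have [pc ps] := annul_pred n hf.
  transitivity (Int (fun t => u t * f t * (cos (angle t) * cos (n%:R * angle t)))).
    by apply: Int_ext => t _; ring.
  apply: (@annul_half f _ _ _ 1 (rint_cosM n.+1%:R iF) (rint_cosM (n%:R - 1) iF)) => // t.
  by rewrite mulrBl mul1r cosB -[n.+1%:R]natr1 mulrDl mul1r cosD; field.
- move=> n; have [pc ps] := annul_pred n hf.
  transitivity (Int (fun t => u t * f t * (cos (angle t) * sin (n%:R * angle t)))).
    by apply: Int_ext => t _; ring.
  apply: (@annul_half f _ _ _ 1 (rint_sinM n.+1%:R iF) (rint_sinM (n%:R - 1) iF)) => // t.
  by rewrite mulrBl mul1r sinB -[n.+1%:R]natr1 mulrDl mul1r sinD; field.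
Qed.
Lemma annul_sin f : annul f -> annul (fun t => f t * sin (angle t)).
Proof.
move=> hf; have [mf [b hb] cf sf] := hf; have iF := annul_int hf.
split.
- by apply: measurable_funM => //; have := meas_sin 1; apply: eq_measurable_fun => t _; rewrite mul1r.
- exists b => t Dt; rewrite normrM -[leRHS]mulr1 ler_pM //; [exact: hb|exact: sin_le1n].
- move=> n; have [pc ps] := annul_pred n hf.
  transitivity (Int (fun t => u t * f t * (sin (angle t) * cos (n%:R * angle t)))).
    by apply: Int_ext => t _; ring.
  apply: (@annul_half f _ _ _ (-1) (rint_sinM n.+1%:R iF) (rint_sinM (n%:R - 1) iF)) => // t.
  by rewrite mulrBl mul1r sinB -[n.+1%:R]natr1 mulrDl mul1r sinD; field.
- move=> n; have [pc ps] := annul_pred n hf.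
  transitivity (Int (fun t => u t * f t * (sin (angle t) * sin (n%:R * angle t)))).
    by apply: Int_ext => t _; ring.
  apply: (@annul_half f _ _ _ (-1) (rint_cosM (n%:R - 1) iF) (rint_cosM n.+1%:R iF)) => // t.
  by rewrite mulrBl mul1r cosB -[n.+1%:R]natr1 mulrDl mul1r cosD; field.
Qed.

Lemma Int_dominated (f : nat -> R -> R) (g : R -> R) (b : R) v : rint v ->
  (forall n, measurable_fun D (f n)) -> (forall n t, D t -> `|f n t| <= b) ->
  (forall t, D t -> f n t @[n --> \oo] --> g t) ->
  (forall n, Int (fun t => v t * f n t) = 0) -> Int (fun t => v t * g t) = 0.
Proof.
move=> iv mf hb hcv h0.
have mv := rint_meas iv.
have mg : measurable_fun D g by apply: (measurable_fun_cvg mf).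
have [] := @dominated_convergence _ _ _ mu D mD
  (fun n t => (v t * f n t)%:E) (fun t => (v t * g t)%:E) (fun t => (b * `|v t|)%:E).
- by move=> n; apply/measurable_EFinP; exact: measurable_funM.
- by apply/measurable_EFinP; exact: measurable_funM.
- apply: aeW => t Dt; apply: cvg_EFin; first exact: nearW.
  by apply: cvgMl_tmp; exact: hcv.
- by apply: rintZ; exact: rint_abs.
- apply: aeW => t n Dt; rewrite lee_fin normrM mulrC ler_wpM2r //; exact: hb.
move=> _ _; set s := (fun n => _); have -> : s = fun=> 0%E.
  apply/funext => n; rewrite /s Int_EFin ?h0 //.
  apply: (@rint_ext _ (fun t => f n t * v t)); first by move=> t _; rewrite mulrC.
  by apply: rint_bmul iv => //; exact: hb.
move=> hc.
have : (\int[mu]_(t in D) (v t * g t)%:E = 0)%E.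
  by apply: (cvg_unique _ hc) => //; exact: cvg_cst.
by rewrite /Int /Rintegral => ->.
Qed.

Lemma annul_lim (f : nat -> R -> R) (g : R -> R) (b : R) :
  (forall n, annul (f n)) -> (forall n t, D t -> `|f n t| <= b) ->
  (forall t, D t -> f n t @[n --> \oo] --> g t) -> annul g.
Proof.
move=> hf hb hc.
have mf n : measurable_fun D (f n) by have [] := hf n.
have mg : measurable_fun D g by apply: (measurable_fun_cvg mf).
split => //.
- exists b => t Dt; have hc' : `|f n t| @[n --> \oo] --> `|g t| by apply: cvg_norm; exact: hc.
  rewrite -(cvg_lim _ hc') //; apply: limr_le; first exact: (cvgP _ hc').
  by apply: nearW => n; exact: hb.
- move=> n.
  transitivity (Int (fun t => u t * cos (n%:R * angle t) * g t)).
    by apply: Int_ext => t _; ring.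
  apply: (Int_dominated (rint_cosM n%:R iu) mf hb hc) => k.
  have [_ _ h _] := hf k; rewrite -[RHS](h n); apply: Int_ext => t _; ring.
- move=> n.
  transitivity (Int (fun t => u t * sin (n%:R * angle t) * g t)).
    by apply: Int_ext => t _; ring.
  apply: (Int_dominated (rint_sinM n%:R iu) mf hb hc) => k.
  have [_ _ _ h] := hf k; rewrite -[RHS](h n); apply: Int_ext => t _; ring.
Qed.

Lemma annul_ext f g : (forall t, D t -> f t = g t) -> annul f -> annul g.
Proof.
move=> e [mf [b hb] cf sf]; split.
- by apply: eq_measurable_fun mf => t; rewrite inE => /e.
- by exists b => t Dt; rewrite -e //; exact: hb.
- by move=> n; rewrite -[RHS](cf n); apply: Int_ext => t Dt; rewrite e.
- by move=> n; rewrite -[RHS](sf n); apply: Int_ext => t Dt; rewrite e.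
Qed.

(* Threshold of the powers of (1 - (a cos + b sin)) / 2. *)
Lemma annul_halfcircle (a b : R) f : a ^+ 2 + b ^+ 2 = 1 -> annul f ->
  annul (fun t => f t * (if 0 < a * cos (angle t) + b * sin (angle t) then 1 else 0)).
Proof.
move=> ab hf.
pose h t := 2^-1 * (1 - (a * cos (angle t) + b * sin (angle t))).
have hE t : -1 <= a * cos (angle t) + b * sin (angle t) <= 1.
  rewrite -ler_norml -(@ler_pXn2r _ 2) ?nnegrE // real_normK ?num_real // expr1n.
  have -> : (a * cos (angle t) + b * sin (angle t)) ^+ 2 = (a ^+ 2 + b ^+ 2) *
    (cos (angle t) ^+ 2 + sin (angle t) ^+ 2) - (a * sin (angle t) - b * cos (angle t)) ^+ 2 by ring.
  by rewrite ab cos2Dsin2 mulr1 gerBl sqr_ge0.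
have h01 t : 0 <= h t <= 1 by have := hE t; rewrite /h => /andP[]; lra.
have hM g : annul g -> annul (fun t => g t * h t).
  move=> hg; apply: (@annul_ext (fun t => 2^-1 * (g t + ((-a) * (g t * cos (angle t)) +
    (-b) * (g t * sin (angle t)))))).
    by move=> t _; rewrite /h; ring.
  apply: annulZ; apply: annulD => //; apply: annulD; apply: annulZ.
    exact: annul_cos.
  exact: annul_sin.
have hXn g n : annul g -> annul (fun t => g t * h t ^+ n).
  move=> hg; elim: n => [|n IH].
    by apply: annul_ext hg => t _; rewrite expr0 mulr1.
  by apply: annul_ext (hM _ IH) => t _ /=; rewrite exprSr -mulrA.
have h1Xn g n m : annul g -> annul (fun t => g t * (1 - h t ^+ n) ^+ m).
  move=> hg; elim: m => [|m IH].
    by apply: annul_ext hg => t _; rewrite expr0 mulr1.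
  apply: (@annul_ext (fun t => g t * (1 - h t ^+ n) ^+ m + (-1) *
     (g t * (1 - h t ^+ n) ^+ m * h t ^+ n))).
    by move=> t _; rewrite exprSr; ring.
  by apply: annulD => //; apply: annulZ; exact: hXn.
have [mf [c hc] _ _] := hf.
apply: (@annul_lim (fun n t => f t * (1 - h t ^+ n) ^+ (n * 2 ^ n)) _ c).
- by move=> n; exact: h1Xn.
- move=> n t Dt; rewrite normrM -[leRHS]mulr1 ler_pM //; first exact: hc.
  have /andP[h0 h1] := h01 t.
  have p0 : 0 <= h t ^+ n by rewrite exprn_ge0.
  have p1 : h t ^+ n <= 1 by rewrite exprn_ile1.
  rewrite ger0_norm ?exprn_ge0 ?subr_ge0 //; apply: exprn_ile1; rewrite ?subr_ge0 //.
  by rewrite gerBl.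
- move=> t Dt; apply: cvgMl_tmp.
  have -> : (0 < a * cos (angle t) + b * sin (angle t)) = (h t < 2^-1).
    by rewrite /h; apply/idP/idP; lra.
  exact: cvg_threshold.
Qed.

Lemma aeD_neq (a : R) : aeD (fun t => t != a).
Proof.
apply: (@negligibleS _ _ _ mu [set a]); last first.
  by apply/negligibleP => //; exact: lebesgue_measure_set1.
by move=> t /= /existsNP[_ /negP]; rewrite negbK => /eqP.
Qed.

Lemma sin_angle_gt0 t : 0 < t < 2^-1 -> 0 < sin (angle t).
Proof.
move=> /andP[t0 t1]; apply: sin_gt0_pi; have := pi_gt0 R; rewrite /angle => p0.
by apply/andP; split; [rewrite !mulr_gt0|rewrite mulrC mulrA gtr_pMl //; lra].
Qed.
Lemma sin_angle_ge0 t : 0 <= t <= 2^-1 -> 0 <= sin (angle t).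
Proof.
move=> /andP[t0 t1]; apply: sin_ge0_pi; have := pi_gt0 R; rewrite /angle => p0.
apply/andP; split; first by rewrite !mulr_ge0 // ltW.
by rewrite mulrC mulrA ger_pMl //; lra.
Qed.
Lemma sin_angle_half t : sin (angle t) = - sin (angle (t - 2^-1)).
Proof.
have -> : angle t = angle (t - 2^-1) + pi by rewrite /angle; field.
by rewrite sinDpi.
Qed.

(** Such an arc is the intersection of two open half circles: s sin (2 pi t) > 0 selects j < t < j +
    1/2, and sin (2 pi (x - t)) > 0 cuts it at x. The two choices of s and j give the upper and the
    lower half circle. *)
Lemma annul_arc (s j x : R) : (s = 1 /\ j = 0) \/ (s = -1 /\ j = 2^-1) ->
  j < x <= j + 2^-1 -> annul (fun t => if (j < t) && (t < x) then 1 else 0).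
Proof.
move=> hs /andP[jx xj].
have s2 : 0 ^+ 2 + s ^+ 2 = 1 by case: hs => -[-> _]; ring.
have x2 : sin (angle x) ^+ 2 + (- cos (angle x)) ^+ 2 = 1.
  by rewrite sqrrN addrC cos2Dsin2.
have := annul_halfcircle x2 (annul_halfcircle s2 annul1).
apply: annul_ext => t /=; rewrite in_itv /= => /andP[t0 t1].
rewrite mul1r mul0r add0r.
have sgn : (0 < s * sin (angle t)) = (j < t) && (t < j + 2^-1).
  case: hs => -[-> ->]; rewrite ?mul1r ?mulN1r ?oppr_gt0.
    rewrite add0r; case: (ltP t 2^-1) => h; rewrite ?andbT ?andbF.
      case: (ltP 0 t) => h0; first by rewrite sin_angle_gt0 // h0.
      have -> : t = 0 by lra.
      by rewrite /angle mulr0 sin0 ltxx.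
    apply/negP/negP; rewrite -leNgt sin_angle_half oppr_le0; apply: sin_angle_ge0; lra.
  have -> : 2^-1 + 2^-1 = 1 :> R by field.
  case: (ltP 2^-1 t) => h /=; last first.
    by apply/negP/negP; rewrite -leNgt; apply: sin_angle_ge0; lra.
  rewrite sin_angle_half oppr_lt0; case: (ltP t 1) => h1; first by apply: sin_angle_gt0; lra.
  have -> : t - 2^-1 = 2^-1 by lra.
  have -> : angle 2^-1 = pi by rewrite /angle; field.
  by rewrite sinpi ltxx.
rewrite sgn; have -> : sin (angle x) * cos (angle t) + - cos (angle x) * sin (angle t) = sin (angle (x - t)).
  by rewrite /angle mulrBr sinB mulNr.
case: (ltP j t) => jt /=; last by rewrite mul0r.
case: (ltP t (j + 2^-1)) => tj /=; last first.
  have -> : (t < x) = false by apply/negP/negP; rewrite -leNgt; lra.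
  by rewrite mul0r.
rewrite mul1r; case: (ltP t x) => tx.
  by rewrite sin_angle_gt0 //; lra.
have -> : angle (x - t) = - angle (t - x) by rewrite /angle; ring.
have : 0 <= sin (angle (t - x)) by apply: sin_angle_ge0; lra.
by rewrite sinN oppr_gt0 leNgt => /negbTE ->.
Qed.

Lemma annul_Int f : annul f -> Int (fun t => u t * f t) = 0.
Proof.
move=> [_ _ h _]; rewrite -[RHS](h 0%N); apply: Int_ext => t _.
by rewrite mul0r cos0 mulr1.
Qed.

(** Up to finitely many points, the part of [0, 1] below y is empty, an arc of the upper half
    circle, or that half together with an arc of the lower one. *)
Lemma Int_initial (y : R) : Int (fun t => u t * (if t <= y then 1 else 0)) = 0.
Proof.
have rr (P : pred R) : measurable_fun D (fun t => P t) ->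
    rint (fun t => u t * (if P t then 1 else 0)).
  move=> mP; apply: (@rint_ext _ (fun t => (if P t then 1 else 0) * u t)).
    by move=> t _; rewrite mulrC.
  apply: (@rint_bmul _ 1) => //; last by move=> t _; case: (P t); rewrite ?normr1 ?normr0.
  by apply: measurable_fun_if => //; apply: measurable_cst.
have mlt (a : R) : measurable_fun D (fun t : R => (t < a)).
  by apply: measurable_fun_ltr => //; exact: measurable_cst.
have mle (a : R) : measurable_fun D (fun t : R => (t <= a)).
  by apply: measurable_fun_ler => //; exact: measurable_cst.
have mgt (a : R) : measurable_fun D (fun t : R => (a < t)).
  by apply: measurable_fun_ltr => //; exact: measurable_cst.
case: (leP y 0) => y0.
  transitivity (Int (fun=> 0 : R)); last by rewrite Int_cst.
  apply: Int_ae; [exact: rr|exact: rint_cst|].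
  apply: aeD_sub (aeD_neq 0) => t /=; rewrite in_itv /= => /andP[t0 t1] tn.
  have -> : (t <= y) = false; last by rewrite mulr0.
  apply/negP/negP; rewrite -ltNge; apply: le_lt_trans y0 _.
  by rewrite lt0r tn.
case: (leP y 2^-1) => y1.
  have := annul_Int (annul_arc (s := 1) (j := 0) (x := y) (or_introl (conj erefl erefl)) _).
  rewrite y0 add0r y1 => /(_ isT) e0; rewrite -[RHS]e0; apply: Int_ae; [exact: rr| |].
    by apply: rr; apply: measurable_and.
  apply: aeD_sub (aeD_and (aeD_neq 0) (aeD_neq y)) => t /=; rewrite in_itv /=.
  move=> /andP[t0 t1] [tn ty]; rewrite [0 < t]lt0r tn t0 /=.
  by rewrite [t < y]lt_neqAle ty.
pose z := Num.min y 1.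
have z0 : 2^-1 < z by rewrite lt_min y1 /=; lra.
have z1 : z <= 1 by rewrite ge_min lexx orbT.
have h1 := annul_Int (annul_arc (s := 1) (j := 0) (x := 2^-1) (or_introl (conj erefl erefl)) _).
have h2 := annul_Int (annul_arc (s := -1) (j := 2^-1) (x := z) (or_intror (conj erefl erefl)) _).
have e1 : Int (fun t => u t * (if (0 < t) && (t < 2^-1) then 1 else 0)) = 0 by apply: h1; lra.
have e2 : Int (fun t => u t * (if (2^-1 < t) && (t < z) then 1 else 0)) = 0 by apply: h2; lra.
have r1 : rint (fun t => u t * (if (0 < t) && (t < 2^-1) then 1 else 0)).
  by apply: rr; apply: measurable_and.
have r2 : rint (fun t => u t * (if (2^-1 < t) && (t < z) then 1 else 0)).
  by apply: rr; apply: measurable_and.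
rewrite -[RHS]addr0 -[X in _ = X + _]e1 -[X in _ = _ + X]e2 -IntD //; apply: Int_ae; [exact: rr|exact: rintD|].
apply: aeD_sub (aeD_and (aeD_and (aeD_neq 0) (aeD_neq 2^-1)) (aeD_and (aeD_neq y) (aeD_neq 1))).
move=> t /=; rewrite in_itv /= => /andP[t0 t1] [[tn thalf] [ty t1n]].
rewrite -mulrDr [0 < t]lt0r tn t0 /= lt_min [t < 1]lt_neqAle t1n t1 andbT.
rewrite [t < y]lt_neqAle ty /=.
case: (ltP t 2^-1) => hh.
  have -> : (2^-1 < t) = false by apply/negP/negP; rewrite -leNgt ltW.
  have -> : t <= y by lra.
  by rewrite /= addr0.
have -> : 2^-1 < t by rewrite lt_neqAle eq_sym thalf.
by rewrite add0r /= andbT.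
Qed.

(** The integrals of u over all initial intervals vanish, and by Lebesgue differentiation u is
    almost everywhere the derivative of this zero function. *)
Lemma trig_unique : aeD (fun t => u t = 0).
Proof.
pose f := u \_ D.
have fint y : mu.-integrable [set` `]-oo, y]] (EFin \o f).
  apply: (@integrableS _ _ _ mu setT) => //.
  have /(integrable_mkcond _ mD) := iu.
  by apply: eq_integrable => // t _; rewrite /f /= /patch; case: ifP.
have locf : locally_integrable [set: R] f by apply: integrable_locally.
have := FTC1 fint locf.
set G := (fun x => _).
have G0 : G = cst 0.
  apply/funext => y /=; rewrite -[RHS](Int_initial y) /G /Int.
  rewrite Rintegral_mkcond [RHS]Rintegral_mkcond; congr (Rintegral mu setT _).
  apply/funext => t; rewrite /f /patch /=.
  by rewrite !mem_setE !in_itv /=; case: (t <= y); case: (_ && _) => //=; rewrite ?mulr1 ?mulr0.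
rewrite /= G0; apply: (@filterS _ _ (ae_flt R)) => t ht Dt.
have [|_ h] := ht; first exact: ltNyr.
have : f t = 0 by rewrite -h; exact: (derive1_cst (0 : R) t).
by rewrite /f /patch mem_set.
Qed.
End TrigUnique.

(** * Integration over the circle *)

Section Circle.
Variable R : realType.
Notation C := R[i].
Notation D := (`[0%R, 1%R]%classic : set (measurableTypeR R)).
Implicit Types (f g h : C -> C).

Definition cint g := rint (fun t => cRe (g (circ t))) /\ rint (fun t => cIm (g (circ t))).

Lemma cRe_intT g : cRe (intT g) = Int (fun t => cRe (g (circ t))). Proof. by []. Qed.
Lemma cIm_intT g : cIm (intT g) = Int (fun t => cIm (g (circ t))). Proof. by []. Qed.

Lemma cint_meas g : cint g -> measT g.
Proof. by move=> [h1 h2]; split; exact: rint_meas. Qed.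
Lemma cintD f g : cint f -> cint g -> cint (fun z => f z + g z).
Proof.
move=> [f1 f2] [g1 g2]; split.
  by apply: rint_ext (rintD f1 g1) => t _; rewrite cReD.
by apply: rint_ext (rintD f2 g2) => t _; rewrite cImD.
Qed.
Lemma intTD f g : cint f -> cint g -> intT (fun z => f z + g z) = intT f + intT g.
Proof.
move=> [f1 f2] [g1 g2]; apply: complex_eq; rewrite ?cReD ?cImD ?cRe_intT ?cIm_intT.
  by rewrite -IntD //; apply: Int_ext => t _; rewrite cReD.
by rewrite -IntD //; apply: Int_ext => t _; rewrite cImD.
Qed.
Lemma cintZ c f : cint f -> cint (fun z => c * f z).
Proof.
move=> [f1 f2]; split.
  by apply: rint_ext (rintB (rintZ (cRe c) f1) (rintZ (cIm c) f2)) => t _; rewrite cReM.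
by apply: rint_ext (rintD (rintZ (cRe c) f2) (rintZ (cIm c) f1)) => t _; rewrite cImM.
Qed.
Lemma intTZ c f : cint f -> intT (fun z => c * f z) = c * intT f.
Proof.
move=> [f1 f2]; apply: complex_eq; rewrite ?cReM ?cImM ?cRe_intT ?cIm_intT.
  rewrite -!IntZ // -IntB //; [|exact: rintZ..].
  by apply: Int_ext => t _; rewrite cReM.
rewrite -!IntZ // -IntD //; [|exact: rintZ..].
by apply: Int_ext => t _; rewrite cImM.
Qed.
Lemma intTJ f : cint f -> intT (fun z => (f z)^*) = (intT f)^*.
Proof.
move=> [f1 f2]; apply: complex_eq; rewrite ?cRe_conj ?cIm_conj ?cRe_intT ?cIm_intT.
  by apply: Int_ext => t _; rewrite cRe_conj.
by rewrite -IntN //; apply: Int_ext => t _; rewrite cIm_conj.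
Qed.
Lemma cint0 : cint (fun _ : C => 0).
Proof. by split; exact: rint_cst. Qed.
Lemma intT_cst c : intT (fun _ : C => c) = c.
Proof. by apply: complex_eq; rewrite ?cRe_intT ?cIm_intT Int_cst. Qed.
Lemma cint_cst c : cint (fun _ : C => c).
Proof. by split; exact: rint_cst. Qed.
Lemma cint_sum (I : Type) (r : seq I) (P : pred I) (F : I -> C -> C) :
  (forall i, cint (F i)) -> cint (fun z => \sum_(i <- r | P i) F i z).
Proof.
move=> hF; elim: r => [|i r IH].
  by have := cint0; congr cint; apply/funext => z; rewrite big_nil.
have -> : (fun z => \sum_(j <- i :: r | P j) F j z) =
  (fun z => (if P i then F i z else 0) + \sum_(j <- r | P j) F j z).
  by apply/funext => z; rewrite big_cons; case: (P i); rewrite ?add0r.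
by apply: cintD => //; case: (P i) => //; exact: cint0.
Qed.
Lemma intT_sum (I : Type) (r : seq I) (P : pred I) (F : I -> C -> C) :
  (forall i, cint (F i)) ->
  intT (fun z => \sum_(i <- r | P i) F i z) = \sum_(i <- r | P i) intT (F i).
Proof.
move=> hF; elim: r => [|i r IH].
  rewrite big_nil -[RHS](intT_cst 0); congr intT; apply/funext => z.
  by rewrite big_nil.
have -> : (fun z => \sum_(j <- i :: r | P j) F j z) =
  (fun z => (if P i then F i z else 0) + \sum_(j <- r | P j) F j z).
  by apply/funext => z; rewrite big_cons; case: (P i); rewrite ?add0r.
rewrite intTD ?IH ?big_cons; last exact: cint_sum.
  by case: (P i) => //; rewrite intT_cst add0r.
by case: (P i) => //; exact: cint0.
Qed.
Lemma intT_ext f g : (forall t, f (circ t) = g (circ t)) -> intT f = intT g.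
Proof. by move=> e; apply: complex_eq; apply: Int_ext => t _; rewrite e. Qed.
Lemma cint_ext f g : (forall t, f (circ t) = g (circ t)) -> cint f -> cint g.
Proof.
by move=> e [f1 f2]; split; [apply: rint_ext f1|apply: rint_ext f2] => t _; rewrite e.
Qed.

Lemma aeTE (P : C -> Prop) : aeT P = aeD (fun t : R => P (circ t)).
Proof. by []. Qed.
Lemma aeTW (P : C -> Prop) : (forall t : R, P (circ t)) -> aeT P.
Proof. by move=> h; rewrite aeTE; apply: aeDW => t _; exact: h. Qed.
Lemma aeT_sub (P Q : C -> Prop) : (forall t : R, P (circ t) -> Q (circ t)) -> aeT P -> aeT Q.
Proof. by move=> h; rewrite !aeTE; apply: aeD_sub => t _; exact: h. Qed.
Lemma aeT_and (P Q : C -> Prop) : aeT P -> aeT Q -> aeT (fun z => P z /\ Q z).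
Proof. by rewrite !aeTE; exact: aeD_and. Qed.
Lemma aeT_all (I : finType) (P : I -> C -> Prop) :
  (forall i, aeT (P i)) -> aeT (fun z => forall i, P i z).
Proof. by move=> h; rewrite aeTE; apply: aeD_all => i; exact: h. Qed.

Lemma intT_ae f g : cint f -> cint g -> eqT f g -> intT f = intT g.
Proof.
move=> [f1 f2] [g1 g2] e; apply: complex_eq; apply: Int_ae => //;
  by move: e; rewrite /eqT aeTE; apply: aeD_sub => t _ ->.
Qed.

Lemma meas_ext (u v : R -> R) : (forall t, v t = u t) ->
  measurable_fun D u -> measurable_fun D v.
Proof. by move=> /funext ->. Qed.
Lemma measT_cst c : measT (fun _ : C => c).
Proof. by split; exact: measurable_cst. Qed.
Lemma measTD f g : measT f -> measT g -> measT (fun z => f z + g z).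
Proof.
move=> [f1 f2] [g1 g2]; split.
  by apply: (meas_ext _ (measurable_funD f1 g1)) => t; rewrite cReD.
by apply: (meas_ext _ (measurable_funD f2 g2)) => t; rewrite cImD.
Qed.
Lemma measTM f g : measT f -> measT g -> measT (fun z => f z * g z).
Proof.
move=> [f1 f2] [g1 g2]; split.
  apply: (meas_ext _ (measurable_funB (measurable_funM f1 g1) (measurable_funM f2 g2))) => t.
  by rewrite cReM.
apply: (meas_ext _ (measurable_funD (measurable_funM f1 g2) (measurable_funM f2 g1))) => t.
by rewrite cImM.
Qed.
Lemma measTJ f : measT f -> measT (fun z => (f z)^*).
Proof.
move=> [f1 f2]; split; first by apply: meas_ext f1 => t; rewrite cRe_conj.
by apply: (meas_ext _ (measurable_funN f2)) => t; rewrite cIm_conj.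
Qed.
Lemma measT_sum (I : Type) (r : seq I) (P : pred I) (F : I -> C -> C) :
  (forall i, measT (F i)) -> measT (fun z => \sum_(i <- r | P i) F i z).
Proof.
move=> hF; elim: r => [|i r IH].
  by have := measT_cst 0; congr measT; apply/funext => z; rewrite big_nil.
have -> : (fun z => \sum_(j <- i :: r | P j) F j z) =
  (fun z => (if P i then F i z else 0) + \sum_(j <- r | P j) F j z).
  by apply/funext => z; rewrite big_cons; case: (P i); rewrite ?add0r.
by apply: measTD => //; case: (P i) => //; exact: measT_cst.
Qed.
Lemma circ_angle (t : R) : circ t = cos (angle t) +i* sin (angle t). Proof. by []. Qed.
Lemma measT_id : measT (fun z : C => z).
Proof.
split.
  by apply: (meas_ext _ (@meas_cos R 1)) => t; rewrite mul1r.
by apply: (meas_ext _ (@meas_sin R 1)) => t; rewrite mul1r.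
Qed.
Lemma measT_X f n : measT f -> measT (fun z => f z ^+ n).
Proof.
move=> hf; elim: n => [|n IH]; first exact: measT_cst.
by have := measTM hf IH; congr measT; apply/funext => z; rewrite exprS.
Qed.
Lemma measT_cabs f : measT f -> measurable_fun D (fun t => cabs (f (circ t))).
Proof.
move=> [f1 f2].
have -> : (fun t => cabs (f (circ t))) =
  (fun t => Num.sqrt (cRe (f (circ t)) ^+ 2 + cIm (f (circ t)) ^+ 2)).
  by apply/funext => t; rewrite -cabs2 sqrtr_sqr ger0_norm // cabs_ge0.
apply: (@measurableT_comp _ _ _ _ _ _ (@Num.sqrt R)).
  by apply: continuous_measurable_fun; exact: sqrt_continuous.
by apply: measurable_funD; exact: measurable_funX.
Qed.

Lemma circ_expn (t : R) n : circ t ^+ n = cos (n%:R * angle t) +i* sin (n%:R * angle t).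
Proof.
elim: n => [|n IH].
  by rewrite expr0 mul0r cos0 sin0.
rewrite exprS IH circ_angle -[n.+1%:R]natr1 mulrDl mul1r cosD sinD.
by apply: complex_eq; rewrite /=; ring.
Qed.
Lemma cabs_circ (t : R) : cabs (circ t) = 1.
Proof.
apply/eqP; rewrite -(@eqrXn2 _ 2) ?cabs_ge0 // cabs2 expr1n circ_angle /=.
by rewrite cos2Dsin2.
Qed.
Lemma circ_conjK (t : R) : circ t * (circ t)^* = 1.
Proof. by rewrite mul_conjcC cabs_circ expr1n. Qed.

Lemma cint_cabs g : cint g -> rint (fun t => cabs (g (circ t))).
Proof.
move=> hg; have [g1 g2] := hg.
apply: (rint_le _ (rintD (rint_abs g1) (rint_abs g2))).
  exact: measT_cabs (cint_meas hg).
by move=> t _; rewrite ger0_norm ?cabs_ge0 //; exact: cabs_le.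
Qed.
Lemma cint_le g v : measT g -> rint v -> (forall t, cabs (g (circ t)) <= v t) -> cint g.
Proof.
move=> [g1 g2] hv h; split; apply: (rint_le _ hv) => // t _.
  exact: le_trans (cRe_le_cabs _) (h t).
exact: le_trans (cIm_le_cabs _) (h t).
Qed.
(** Real and imaginary parts are estimated separately. The factor 2 that this costs reappears in the
    constants of [intT_sqn_le] and [app_neg]. *)
Lemma intT_cabs_le g : cint g -> cabs (intT g) <= 2 * Int (fun t => cabs (g (circ t))).
Proof.
move=> hg; have [g1 g2] := hg; have ha := cint_cabs hg.
apply: le_trans (cabs_le _) _; rewrite cRe_intT cIm_intT.
have -> : 2 * Int (fun t => cabs (g (circ t))) =
  Int (fun t => cabs (g (circ t))) + Int (fun t => cabs (g (circ t))) by ring.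
apply: lerD.
  apply: le_trans (Int_abs g1) _; apply: Int_le => //; first exact: rint_abs.
  by move=> t _; exact: cRe_le_cabs.
apply: le_trans (Int_abs g2) _; apply: Int_le => //; first exact: rint_abs.
by move=> t _; exact: cIm_le_cabs.
Qed.
Lemma cint_bmul (b : R) f g : measT f -> (forall t, cabs (f (circ t)) <= b) -> cint g ->
  cint (fun z => f z * g z).
Proof.
move=> mf hb hg; apply: (cint_le _ (rintZ b (cint_cabs hg))).
  by apply: measTM => //; exact: cint_meas.
by move=> t; rewrite cabsM ler_wpM2r ?cabs_ge0.
Qed.
Lemma cabs_exp (z : C) n : cabs (z ^+ n) = cabs z ^+ n.
Proof. by apply: complexI; rewrite -normcC normrX normcC rmorphXn. Qed.
Lemma cint_zX n g : cint g -> cint (fun z => z ^+ n * g z).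
Proof.
apply: (@cint_bmul 1); first by apply: measT_X; exact: measT_id.
by move=> t; rewrite cabs_exp cabs_circ expr1n.
Qed.
Lemma cint_zJX n g : cint g -> cint (fun z => (z ^+ n)^* * g z).
Proof.
apply: (@cint_bmul 1); first by apply: measTJ; apply: measT_X; exact: measT_id.
by move=> t; rewrite cabsJ cabs_exp cabs_circ expr1n.
Qed.
Lemma cint_cabs0 g : cint g -> Int (fun t => cabs (g (circ t))) = 0 -> eqT g (fun=> 0).
Proof.
move=> hg /(Int0_ae (cint_cabs hg)) h.
rewrite /eqT aeTE; apply: aeD_sub (h _) => [t _|t _]; last exact: cabs_ge0.
exact: cabs0_eq0.
Qed.

(** On the circle the sum and the difference of z^n and its conjugate are 2 cos and 2 i sin of n
    times the angle. So the real and the imaginary part of g each have vanishing trigonometric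
    coefficients. *)
Lemma fourier_unique g : cint g -> (forall n, intT (fun z => z ^+ n * g z) = 0) ->
  (forall n, intT (fun z => (z ^+ n)^* * g z) = 0) -> eqT g (fun=> 0).
Proof.
move=> hg h1 h2.
have hc n : intT (fun z => (z ^+ n + (z ^+ n)^*) * g z) = 0.
  transitivity (intT (fun z => z ^+ n * g z) + intT (fun z => (z ^+ n)^* * g z)).
    rewrite -intTD; [|exact: cint_zX|exact: cint_zJX].
    by apply: intT_ext => t; rewrite mulrDl.
  by rewrite h1 h2 addr0.
have hs n : intT (fun z => (z ^+ n - (z ^+ n)^*) * g z) = 0.
  transitivity (intT (fun z => z ^+ n * g z) + (-1) * intT (fun z => (z ^+ n)^* * g z)).
    rewrite -intTZ -?intTD; [|exact: cint_zX|by apply: cintZ; exact: cint_zJX|exact: cint_zJX].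
    by apply: intT_ext => t; ring.
  by rewrite h1 h2 mulr0 addr0.
have [g1 g2] := hg.
have half (v w : R -> R) : (forall t, w t = 2 * v t) -> rint v -> Int w = 0 -> Int v = 0.
  move=> e iv; rewrite (@Int_ext _ w (fun t => 2 * v t)); last by move=> t _.
  rewrite IntZ // => /eqP; rewrite mulf_eq0 => /orP[/eqP h|/eqP //].
  by move: h => /eqP; rewrite pnatr_eq0.
have u1 : aeD (fun t => cRe (g (circ t)) = 0).
  apply: trig_unique => // n.
    have := congr1 (@complex.Re R) (hc n); rewrite cRe_intT /=.
    apply: half; last exact: rint_cosM.
    by move=> t; rewrite circ_expn /= ; case: (g _) => a b /=; ring.
  have := congr1 (@complex.Im R) (hs n); rewrite cIm_intT /=.
  apply: half; last exact: rint_sinM.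
  by move=> t; rewrite circ_expn /= ; case: (g _) => a b /=; ring.
have u2 : aeD (fun t => cIm (g (circ t)) = 0).
  apply: trig_unique => // n.
    have := congr1 (@complex.Im R) (hc n); rewrite cIm_intT /=.
    apply: half; last exact: rint_cosM.
    by move=> t; rewrite circ_expn /= ; case: (g _) => a b /=; ring.
  have := congr1 (fun z => - cRe z) (hs n); rewrite cRe_intT /= oppr0.
  rewrite -IntN; last first.
    have [] : cint (fun z => (z ^+ n - (z ^+ n)^*) * g z); last by [].
    apply: (@cint_ext (fun z => z ^+ n * g z + (-1) * ((z ^+ n)^* * g z))).
      by move=> t; ring.
    by apply: cintD; [exact: cint_zX|apply: cintZ; exact: cint_zJX].
  apply: half; last exact: rint_sinM.
  by move=> t; rewrite circ_expn /= ; case: (g _) => a b /=; ring.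
rewrite /eqT aeTE; apply: aeD_sub (aeD_and u1 u2) => t _ [a b].
by apply: complex_eq.
Qed.

Lemma Int_deriv (F f : R -> R) : (forall t, is_derive t (1 : R) F (f t)) ->
  continuous f -> F 1 = F 0 -> Int f = 0.
Proof.
move=> dF cf e; rewrite /Int /Rintegral.
rewrite (@continuous_FTC2 _ f F 0 1) //.
- by rewrite e subee.
- by apply: continuous_subspaceT.
- split.
  + by move=> t _; have [] := dF t.
  + apply: cvg_at_right_filter; apply: differentiable_continuous.
    by apply/derivable1_diffP; have [] := dF 0.
  + apply: cvg_at_left_filter; apply: differentiable_continuous.
    by apply/derivable1_diffP; have [] := dF 1.
- by move=> t _; rewrite derive1E; have [_ ->] := dF t.
Qed.

Lemma intT_zX n : intT (fun z : C => z ^+ n.+1) = 0.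
Proof.
have p0 : (pi : R) != 0 by rewrite gt_eqF // pi_gt0.
have n0 : (n.+1%:R : R) != 0 by rewrite pnatr_eq0.
pose k : R := n.+1%:R * (2 * pi).
have k0 : k != 0 by rewrite !mulf_neq0.
have kE t : n.+1%:R * angle t = k * t by rewrite /k /angle; ring.
have c k' : continuous (fun t : R => k' * t).
  by move=> t; apply: cvgMl_tmp; exact: cvg_id.
have per : cos (k * 1) = 1 /\ sin (k * 1) = 0 :> R.
  rewrite mulr1 /k.
  elim: (n.+1) => [|j [IH1 IH2]]; first by rewrite mul0r cos0 sin0.
  rewrite -[j.+1%:R]natr1 mulrDl mul1r cosD sinD IH1 IH2.
  have -> : 2 * pi = pi + pi :> R by ring.
  rewrite cosDpi sinDpi cospi sinpi; split; ring.
apply: complex_eq; rewrite ?cRe_intT ?cIm_intT.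
  rewrite (@Int_ext _ _ (fun t => cos (k * t))); last by move=> t _; rewrite circ_expn kE.
  apply: (@Int_deriv (fun t => k^-1 * sin (k * t))).
  - by move=> t; apply: is_derive_eq; rewrite /= ?scaler1 /GRing.scale /=; field.
  - by move=> t; apply: (@continuous_comp _ _ _ (fun t => k * t) cos); [exact: c|exact: continuous_cos].
  - by rewrite mulr0 sin0; have [_ ->] := per; rewrite mulr0.
rewrite (@Int_ext _ _ (fun t => sin (k * t))); last by move=> t _; rewrite circ_expn kE.
apply: (@Int_deriv (fun t => - k^-1 * cos (k * t))).
- by move=> t; apply: is_derive_eq; rewrite /= ?scaler1 /GRing.scale /=; field.
- by move=> t; apply: (@continuous_comp _ _ _ (fun t => k * t) sin); [exact: c|exact: continuous_sin].
- by rewrite mulr0 cos0; have [-> _] := per.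
Qed.

End Circle.

(** * Finite-dimensional Hilbert spaces *)

Section FdHilbert.
Variable R : realType.
Notation C := R[i].
Implicit Types (E : fdHilbert R).

Lemma ip_lin E (c : C) (u v w : E) : ip (c *: u + v) w = c * ip u w + ip v w.
Proof. by rewrite /ip linearPl. Qed.
Lemma ipC E (u v : E) : ip v u = (ip u v)^*.
Proof. by rewrite /ip hermC expr0 mul1r. Qed.
Lemma ip_ge0 E (u : E) : 0 <= ip u u.
Proof.
case: (eqVneq u 0) => [->|u0]; first by rewrite /ip linear0r.
exact/ltW/neq0_dnorm_gt0.
Qed.

Definition fdPH E : preHilbert R := @PreHilbert R (fdH_vect E) setT (@ip R E)
  I (fun _ _ _ _ _ => I) (fun c x y z _ _ _ => ip_lin c x y z)
  (fun x y _ _ => ipC x y) (fun x _ => ip_ge0 x).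

Definition dotv k (u v : 'rV[C]_k) : C := \sum_i u 0 i * (v 0 i)^*.
Lemma dotv_linl k z : GRing.linear_for (@GRing.mul C) ((@dotv k)^~ z).
Proof.
move=> c x y; rewrite /dotv mulr_sumr -big_split; apply: eq_bigr => i _ /=.
by rewrite !mxE; ring.
Qed.
Lemma dotv_herm k (u v : 'rV[C]_k) : dotv u v = (-1) ^+ false * (dotv v u)^*.
Proof.
rewrite expr0 mul1r /dotv rmorph_sum; apply: eq_bigr => i _ /=.
by rewrite rmorphM /= conjCK mulrC.
Qed.
Lemma dotv_linr k z : GRing.linear_for (Num.conj \; *%R) (@dotv k z).
Proof.
move=> c x y /=; rewrite /dotv mulr_sumr -big_split; apply: eq_bigr => i _ /=.
by rewrite !mxE rmorphD rmorphM /=; ring.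
Qed.
Lemma dotv_gt0 k (u : 'rV[C]_k) : u != 0 -> 0 < dotv u u.
Proof.
move=> u0; rewrite lt0r; apply/andP; split; last first.
  by apply: sumr_ge0 => i _; exact: mul_conjC_ge0.
apply: contra u0; rewrite psumr_eq0; last by move=> i _; exact: mul_conjC_ge0.
move=> /allP h; apply/eqP/rowP => i; rewrite mxE; apply/eqP.
by rewrite -mul_conjC_eq0; exact: (h i (mem_index_enum i)).
Qed.
HB.instance Definition _ k := bilinear_isBilinear.Build C 'rV[C]_k 'rV[C]_k C
  *%R (Num.conj \; *%R) (@dotv k) (@dotv_linl k, @dotv_linr k).
HB.instance Definition _ k := isHermitianSesquilinear.Build C 'rV[C]_k false Num.conj
  (@dotv k) (@dotv_herm k).
HB.instance Definition _ k := isDotProduct.Build C 'rV[C]_k (@dotv k) (@dotv_gt0 k).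

(** The auxiliary coefficient spaces constructed below have the length of an orthonormal family as
    dimension, and are taken of this form. *)
Definition Cn k : fdHilbert R := @FdHilbert R 'rV[C]_k (@dotv k).
End FdHilbert.

Section FdHilbertTheory.
Variable R : realType.
Notation C := R[i].
Implicit Types (E : fdHilbert R).

Lemma ip0l E (u : E) : ip 0 u = 0. Proof. exact: (@dot0l R (fdPH E)). Qed.
Lemma ipBl E (u v w : E) : ip (u - v) w = ip u w - ip v w.
Proof. exact: (@dotBl R (fdPH E)). Qed.
Lemma ipZl E c (u w : E) : ip (c *: u) w = c * ip u w.
Proof. exact: (@dotZl R (fdPH E)). Qed.
Lemma ipZr E c (u w : E) : ip w (c *: u) = c^* * ip w u.
Proof. exact: (@dotZr R (fdPH E)). Qed.
Lemma ip_suml E (I : Type) (r : seq I) (P : pred I) (F : I -> E) w :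
  ip (\sum_(i <- r | P i) F i) w = \sum_(i <- r | P i) ip (F i) w.
Proof. exact: (@dot_suml R (fdPH E)). Qed.
Lemma ip_sumr E (I : Type) (r : seq I) (P : pred I) (F : I -> E) w :
  ip w (\sum_(i <- r | P i) F i) = \sum_(i <- r | P i) ip w (F i).
Proof. exact: (@dot_sumr R (fdPH E)). Qed.
Lemma hnorm_nrm E (u : E) : hnorm u = @nrm R (fdPH E) u. Proof. by []. Qed.
Lemma hnorm2 E (u : E) : (hnorm u) ^+ 2 = cRe (ip u u).
Proof. by rewrite hnorm_nrm nrmK. Qed.
Lemma ip_hnorm E (u : E) : ip u u = (hnorm u ^+ 2)%:C.
Proof. by rewrite hnorm2; exact: (@dotxx R (fdPH E)). Qed.
Lemma hnorm_ge0 E (u : E) : 0 <= hnorm u. Proof. exact: sqrtr_ge0. Qed.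
Lemma ip_eq0 E (u : E) : ip u u = 0 -> u = 0.
Proof.
move=> h; apply/eqP; apply: contraPT h => u0.
by apply/eqP; rewrite gt_eqF // /ip; exact: neq0_dnorm_gt0.
Qed.
Lemma hnorm_eq0 E (u : E) : hnorm u = 0 -> u = 0.
Proof. by move=> h; apply: ip_eq0; rewrite ip_hnorm h expr0n. Qed.
Lemma fdpheq E (u v : E) : @pheq R (fdPH E) u v -> u = v.
Proof.
move=> h; apply/subr0_eq/ip_eq0; apply: etrans (@dotxx R (fdPH E) (u - v) I) _.
by rewrite (h : nrm2 _ = 0).
Qed.
Lemma ip_extl E (u v : E) : (forall w, ip u w = ip v w) -> u = v.
Proof. by move=> h; apply/subr0_eq/ip_eq0; rewrite ipBl h subrr. Qed.

Lemma fdH_onb E : exists k (e : 'I_k -> E), @onf R (fdPH E) k e /\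
  forall x, x = \sum_i ip x (e i) *: e i.
Proof.
have hT : @subsp R (fdPH E) setT by split.
have [] := @span_onb R (fdPH E) _ (fun i : 'I_(\dim {:E}) => (vbasis {:E})`_i) setT hT.
- by [].
- move=> x _; exists (fun i => coord (vbasis {:E}) i x).
  by rewrite {1}(coord_vbasis (memvf x)); exact: (@pheq_refl R (fdPH E)).
move=> k [e [h1 _ h2]]; exists k, e; split => // x.
exact: fdpheq (h2 x I).
Qed.
Definition edim E : nat := projT1 (cid (fdH_onb E)).
Definition eb E : 'I_(edim E) -> E := projT1 (cid (projT2 (cid (fdH_onb E)))).
Lemma ebP E : @onf R (fdPH E) _ (@eb E).
Proof. exact: (projT2 (cid (projT2 (cid (fdH_onb E))))).1. Qed.
Lemma eb_exp E (x : E) : x = \sum_i ip x (eb i) *: eb i.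
Proof. exact: ((projT2 (cid (projT2 (cid (fdH_onb E))))).2 x). Qed.
Lemma eb_ip E (i j : 'I_(edim E)) : ip (eb i) (eb j) = (i == j)%:R.
Proof. exact: (ebP E).2. Qed.
Lemma ip_coord E (x y : E) : ip x y = \sum_i ip x (eb i) * (ip y (eb i))^*.
Proof.
by rewrite {1}(eb_exp x) ip_suml; apply: eq_bigr => i _; rewrite ipZl (ipC y).
Qed.
Lemma hnorm2_coord E (x : E) : hnorm x ^+ 2 = \sum_i cabs (ip x (eb i)) ^+ 2.
Proof.
by rewrite hnorm2 ip_coord cRe_sum; apply: eq_bigr => i _; rewrite mul_conjcC.
Qed.
Lemma cabs_ip_le E (x v : E) : cabs (ip x v) <= hnorm x * hnorm v.
Proof. exact: (@CS R (fdPH E)). Qed.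
Lemma eb_ext E (x y : E) : (forall i, ip x (eb i) = ip y (eb i)) -> x = y.
Proof. by move=> h; rewrite (eb_exp x) (eb_exp y); apply: eq_bigr => i _; rewrite h. Qed.
Lemma ip_eb_sum E (a : 'I_(edim E) -> C) j : ip (\sum_i a i *: eb i) (eb j) = a j.
Proof. exact: (@onf_dot_lc R (fdPH E) _ _ a j (ebP E)). Qed.

Lemma hadj_exists E F (A : 'Hom(fdH_vect E, fdH_vect F)) :
  exists B : 'Hom(fdH_vect F, fdH_vect E), forall u v, ip (A u) v = ip u (B v).
Proof.
pose b (v : F) : E := \sum_i ip v (A (eb i)) *: eb i.
have bl : linear b.
  move=> c x y; rewrite /b scaler_sumr -big_split; apply: eq_bigr => i _ /=.
  by rewrite ip_lin scalerDl scalerA.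
pose bL := GRing.isLinear.Build _ _ _ _ b bl.
pose bH : {linear F -> E} := HB.pack b bL.
exists (linfun bH) => u v; rewrite lfunE /= /b ip_sumr {1}(eb_exp u) linear_sum ip_suml.
by apply: eq_bigr => i _; rewrite linearZ /= ipZl ipZr -ipC mulrC.
Qed.
Lemma hadjP E F (A : 'Hom(fdH_vect E, fdH_vect F)) u v : ip (A u) v = ip u (hadj A v).
Proof.
rewrite /hadj; case: xgetP => [B _ /= h|h]; first exact: h.
by have [B hB] := hadj_exists A; case: (h B).
Qed.
Lemma hadj_isoP E F (A : 'Hom(fdH_vect E, fdH_vect F)) :
  (hadj A \o A)%VF = \1%VF <-> forall u v, ip (A u) (A v) = ip u v.
Proof.
split=> [h u v|h].
  by rewrite hadjP -[hadj A (A v)]comp_lfunE h id_lfunE.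
apply/lfunP => u; rewrite comp_lfunE id_lfunE /=; apply: ip_extl => w.
by rewrite ipC -hadjP h -ipC.
Qed.
End FdHilbertTheory.

(** * The Hardy space *)

Section ScalarL2.
Variable R : realType.
Notation C := R[i].
Notation D := (`[0%R, 1%R]%classic : set (measurableTypeR R)).
Implicit Types (f g h : C -> C).

Definition cL2 g := measT g /\ rint (fun t => cabs (g (circ t)) ^+ 2).
Definition sqn g : R := Int (fun t => cabs (g (circ t)) ^+ 2).
Lemma sqn_ge0 g : 0 <= sqn g.
Proof. by apply: Int_ge0 => t _; exact: sqr_ge0. Qed.

Lemma cL2_parts g : cL2 g <-> rL2 (fun t => cRe (g (circ t))) /\ rL2 (fun t => cIm (g (circ t))).
Proof.
split.
  move=> [[g1 g2] ig]; split; split=> //; apply: (rint_le _ ig).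
  - exact: measurable_funX.
  - by move=> t _; rewrite normrX cabs2 real_normK ?num_real // lerDl sqr_ge0.
  - exact: measurable_funX.
  - by move=> t _; rewrite normrX cabs2 real_normK ?num_real // lerDr sqr_ge0.
move=> [[g1 i1] [g2 i2]]; split; first by split.
by apply: rint_ext (rintD i1 i2) => t _; rewrite cabs2.
Qed.
Lemma cL2_meas g : cL2 g -> measT g. Proof. by case. Qed.
Lemma cL2D f g : cL2 f -> cL2 g -> cL2 (fun z => f z + g z).
Proof.
move=> /cL2_parts[f1 f2] /cL2_parts[g1 g2]; apply/cL2_parts; split.
  by have := rL2D f1 g1; congr rL2; apply/funext => t; rewrite cReD.
by have := rL2D f2 g2; congr rL2; apply/funext => t; rewrite cImD.
Qed.
Lemma cL2Z c f : cL2 f -> cL2 (fun z => c * f z).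
Proof.
move=> [mf hf]; split; first by apply: measTM => //; exact: measT_cst.
by apply: rint_ext (rintZ (cabs c ^+ 2) hf) => t _; rewrite cabsM exprMn.
Qed.
Lemma cL2B f g : cL2 f -> cL2 g -> cL2 (fun z => f z - g z).
Proof.
move=> hf hg; have := cL2D hf (cL2Z (-1) hg); congr cL2.
by apply/funext => z; rewrite mulN1r.
Qed.
Lemma cL2_cst c : cL2 (fun _ : C => c).
Proof. by split; [exact: measT_cst|exact: rint_cst]. Qed.
Lemma cL2_sum (I : Type) (r : seq I) (P : pred I) (F : I -> C -> C) :
  (forall i, cL2 (F i)) -> cL2 (fun z => \sum_(i <- r | P i) F i z).
Proof.
move=> hF; elim: r => [|i r IH].
  by have := cL2_cst 0; congr cL2; apply/funext => z; rewrite big_nil.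
have -> : (fun z => \sum_(j <- i :: r | P j) F j z) =
  (fun z => (if P i then F i z else 0) + \sum_(j <- r | P j) F j z).
  by apply/funext => z; rewrite big_cons; case: (P i); rewrite ?add0r.
by apply: cL2D => //; case: (P i) => //; exact: cL2_cst.
Qed.
Lemma cL2_bmul (b : R) f g : measT f -> (forall t, cabs (f (circ t)) <= b) -> cL2 g ->
  cL2 (fun z => f z * g z).
Proof.
move=> mf hb [mg hg]; split; first exact: measTM.
apply: (rint_le _ (rintZ (b ^+ 2) hg)).
  by apply: measurable_funX; exact: (measT_cabs (measTM mf mg)).
move=> t _; rewrite normrX ger0_norm ?cabs_ge0 // cabsM exprMn ler_wpM2r ?sqr_ge0 //.
by rewrite lerXn2r ?nnegrE ?cabs_ge0 // (le_trans (cabs_ge0 _) (hb t)).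
Qed.
Lemma cL2_zX n g : cL2 g -> cL2 (fun z => z ^+ n * g z).
Proof.
apply: (@cL2_bmul 1); first by apply: measT_X; exact: measT_id.
by move=> t; rewrite cabs_exp cabs_circ expr1n.
Qed.
Lemma cL2_zJX n g : cL2 g -> cL2 (fun z => (z ^+ n)^* * g z).
Proof.
apply: (@cL2_bmul 1); first by apply: measTJ; apply: measT_X; exact: measT_id.
by move=> t; rewrite cabsJ cabs_exp cabs_circ expr1n.
Qed.
Lemma cL2J f : cL2 f -> cL2 (fun z => (f z)^*).
Proof.
move=> [mf hf]; split; first exact: measTJ.
by apply: rint_ext hf => t _; rewrite cabsJ.
Qed.
Lemma cabs_mul_rint f g : cL2 f -> cL2 g ->
  rint (fun t => cabs (f (circ t)) * cabs (g (circ t))).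
Proof.
move=> [mf hf] [mg hg]; apply: rL2_mul; split => //; exact: measT_cabs.
Qed.
Lemma cL2_mul f g : cL2 f -> cL2 g -> cint (fun z => f z * g z).
Proof.
move=> hf hg; apply: (cint_le _ (cabs_mul_rint hf hg)).
  by apply: measTM; exact: cL2_meas.
by move=> t; rewrite cabsM.
Qed.
Lemma cL2_mulJ f g : cL2 f -> cL2 g -> cint (fun z => f z * (g z)^*).
Proof. by move=> hf hg; apply: cL2_mul => //; exact: cL2J. Qed.
Lemma cL2_cint f : cL2 f -> cint f.
Proof.
move=> hf; apply: (@cint_ext _ (fun z => 1 * f z)); first by move=> t; rewrite mul1r.
by apply: cL2_mul => //; exact: cL2_cst.
Qed.
Lemma cL2_ext f g : (forall t, f (circ t) = g (circ t)) -> cL2 f -> cL2 g.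
Proof.
move=> e [[f1 f2] hf]; split; last by apply: rint_ext hf => t _; rewrite e.
by split; [apply: meas_ext f1|apply: meas_ext f2] => t; rewrite e.
Qed.
Lemma cL2_ae f g : measT g -> eqT f g -> cL2 f -> cL2 g.
Proof.
move=> mg e [mf hf]; split => //; apply: rint_ae hf.
  by apply: measurable_funX; exact: measT_cabs.
by move: e; rewrite /eqT aeTE; apply: aeD_sub => t _ ->.
Qed.
(** Weighted arithmetic-geometric mean, linear in both square norms. The free weight d lets a fixed
    factor be traded against a small one, as in [app_bound]. *)
Lemma mul_small f g (d : R) : 0 < d -> cL2 f -> cL2 g ->
  Int (fun t => cabs (f (circ t)) * cabs (g (circ t))) <= 2^-1 * (d * sqn f + d^-1 * sqn g).
Proof.
move=> d0 hf hg; have [mf rf] := hf; have [mg rg] := hg.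
rewrite -!IntZ // -IntD; [|exact: rintZ..].
rewrite -IntZ; last by apply: rintD; exact: rintZ.
apply: Int_le; first exact: cabs_mul_rint.
  by apply: rintZ; apply: rintD; exact: rintZ.
move=> t _; set x := cabs _; set y := cabs _.
have -> : 2^-1 * (d * x ^+ 2 + d^-1 * y ^+ 2) = x * y + 2^-1 * d * (x - d^-1 * y) ^+ 2.
  by field; rewrite gt_eqF.
by rewrite lerDl mulr_ge0 ?sqr_ge0 // mulr_ge0 // ltW.
Qed.
Lemma sqn0 g : cL2 g -> sqn g = 0 -> eqT g (fun=> 0).
Proof.
move=> [mg rg] /(Int0_ae rg) h; rewrite /eqT aeTE.
apply: aeD_sub (h _) => [t _|t _]; last exact: sqr_ge0.
by move/eqP; rewrite sqrf_eq0 => /eqP /cabs0_eq0.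
Qed.
Lemma eq_sqn f g : eqT f g -> cL2 f -> cL2 g -> sqn f = sqn g.
Proof.
move=> e [_ hf] [_ hg]; apply: Int_ae => //.
by move: e; rewrite /eqT aeTE; apply: aeD_sub => t _ ->.
Qed.
Lemma intT_sqn g : cL2 g -> intT (fun z => g z * (g z)^*) = (sqn g)%:C.
Proof.
move=> hg; apply: complex_eq; rewrite ?cRe_intT ?cIm_intT /=.
  by apply: Int_ext => t _; rewrite mul_conjcC.
by rewrite -[RHS](Int_cst (0 : R)); apply: Int_ext => t _; rewrite mul_conjcC.
Qed.

Lemma cL2_complete (u : nat -> C -> C) : (forall n, cL2 (u n)) ->
  (forall e : R, 0 < e -> exists N, forall m n, (N <= m)%N -> (N <= n)%N ->
     sqn (fun z => u m z - u n z) <= e) ->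
  exists2 f, cL2 f & forall e : R, 0 < e ->
    exists N, forall n, (N <= n)%N -> sqn (fun z => u n z - f z) <= e.
Proof.
move=> hu hC.
have hp n := proj1 (cL2_parts _) (hu n).
have hd m n := cL2B (hu m) (hu n).
have hdp m n := proj1 (cL2_parts _) (hd m n).
have [f1 [rf1 h1]] : exists f : C -> R, rL2 (f \o @circ R) /\ forall e : R, 0 < e ->
    exists N, forall n, (N <= n)%N -> Int (fun t => (cRe (u n (circ t)) - f (circ t)) ^+ 2) <= e.
  apply: (@rL2_complete R C (@circ R) (fun n z => cRe (u n z))).
    by move=> n; have [] := hp n.
  move=> e e0; have [N hN] := hC e e0; exists N => m n Nm Nn.
  apply: le_trans (hN m n Nm Nn); apply: Int_le; last 1 first.
  - by move=> t _; rewrite cabs2 cReD cReN lerDl sqr_ge0.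
  - by have [[_ h] _] := hdp m n; apply: rint_ext h => t _; rewrite cReD cReN.
  - by have [] := hd m n.
have [f2 [rf2 h2]] : exists f : C -> R, rL2 (f \o @circ R) /\ forall e : R, 0 < e ->
    exists N, forall n, (N <= n)%N -> Int (fun t => (cIm (u n (circ t)) - f (circ t)) ^+ 2) <= e.
  apply: (@rL2_complete R C (@circ R) (fun n z => cIm (u n z))).
    by move=> n; have [] := hp n.
  move=> e e0; have [N hN] := hC e e0; exists N => m n Nm Nn.
  apply: le_trans (hN m n Nm Nn); apply: Int_le; last 1 first.
  - by move=> t _; rewrite cabs2 cImD cImN lerDr sqr_ge0.
  - by have [_ [_ h]] := hdp m n; apply: rint_ext h => t _; rewrite cImD cImN.
  - by have [] := hd m n.
exists (fun z => f1 z +i* f2 z); first by apply/cL2_parts; split.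
move=> e e0; have e2 : 0 < e / 2 by rewrite divr_gt0.
have [N1 hN1] := h1 _ e2; have [N2 hN2] := h2 _ e2.
exists (maxn N1 N2) => n; rewrite geq_max => /andP[n1 n2].
have -> : sqn (fun z => u n z - f1 z +i* f2 z) =
  Int (fun t => (cRe (u n (circ t)) - f1 (circ t)) ^+ 2) +
  Int (fun t => (cIm (u n (circ t)) - f2 (circ t)) ^+ 2).
  rewrite -IntD.
  - by apply: Int_ext => t _; rewrite cabs2 cReD cReN cImD cImN.
  - by have [] := rL2B (hp n).1 rf1.
  - by have [] := rL2B (hp n).2 rf2.
have := hN1 n n1; have := hN2 n n2; lra.
Qed.
End ScalarL2.

(** * Vector-valued L^2 and H^2 in coordinates *)

Section VectorH2.
Variables (R : realType) (E : fdHilbert R).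
Notation C := R[i].
Notation D := (`[0%R, 1%R]%classic : set (measurableTypeR R)).
Notation fn := (C -> fdH_vect E).
Implicit Types (f g h : fn) (c : C).

Definition fc f (i : 'I_(edim E)) (z : C) : C := ip (f z) (eb i).
Lemma fcB f g i z : fc (f - g) i z = fc f i z - fc g i z.
Proof. by rewrite /fc -ipBl. Qed.
Lemma fcL c f g i z : fc (c *: f + g) i z = c * fc f i z + fc g i z.
Proof. by rewrite /fc -ip_lin. Qed.
Lemma fc_exp f z : f z = \sum_i fc f i z *: eb i.
Proof. exact: eb_exp. Qed.
Lemma ip_fc f v z : ip (f z) v = \sum_i (ip v (eb i))^* * fc f i z.
Proof. by rewrite ip_coord; apply: eq_bigr => i _; rewrite mulrC. Qed.
Lemma ip_fc2 f g z : ip (f z) (g z) = \sum_i fc f i z * (fc g i z)^*.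
Proof. exact: ip_coord. Qed.
Lemma hnorm_fc f z : hnorm (f z) ^+ 2 = \sum_i cabs (fc f i z) ^+ 2.
Proof. exact: hnorm2_coord. Qed.

Lemma rint_sum (I : Type) (r : seq I) (P : pred I) (F : I -> R -> R) :
  (forall i, rint (F i)) -> rint (fun t => \sum_(i <- r | P i) F i t).
Proof.
move=> hF; elim: r => [|i r IH].
  by have := rint_cst (0 : R); congr rint; apply/funext => z; rewrite big_nil.
have -> : (fun z => \sum_(j <- i :: r | P j) F j z) =
  (fun z => (if P i then F i z else 0) + \sum_(j <- r | P j) F j z).
  by apply/funext => z; rewrite big_cons; case: (P i); rewrite ?add0r.
by apply: rintD => //; case: (P i) => //; exact: rint_cst.
Qed.
Lemma Int_sum (I : Type) (r : seq I) (P : pred I) (F : I -> R -> R) :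
  (forall i, rint (F i)) ->
  Int (fun t => \sum_(i <- r | P i) F i t) = \sum_(i <- r | P i) Int (F i).
Proof.
move=> hF; elim: r => [|i r IH].
  rewrite big_nil -[RHS](Int_cst (0 : R)); congr Int; apply/funext => z.
  by rewrite big_nil.
have -> : (fun z => \sum_(j <- i :: r | P j) F j z) =
  (fun z => (if P i then F i z else 0) + \sum_(j <- r | P j) F j z).
  by apply/funext => z; rewrite big_cons; case: (P i); rewrite ?add0r.
rewrite IntD ?IH ?big_cons; last exact: rint_sum.
  by case: (P i) => //; rewrite Int_cst add0r.
by case: (P i) => //; exact: rint_cst.
Qed.
Lemma meas_sum (I : Type) (r : seq I) (P : pred I) (F : I -> R -> R) :
  (forall i, measurable_fun D (F i)) -> measurable_fun D (fun t => \sum_(i <- r | P i) F i t).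
Proof.
move=> hF; elim: r => [|i r IH].
  by apply: (meas_ext _ (measurable_cst (0 : R))) => t; rewrite big_nil.
have h : measurable_fun D (fun z => if P i then F i z else 0).
  by case: (P i) => //; exact: measurable_cst.
apply: (meas_ext _ (measurable_funD h IH)) => t /=.
by rewrite big_cons; case: (P i); rewrite ?add0r.
Qed.

Lemma measT_fc f : (forall i, measT (fc f i)) <-> (forall v, measT (fun z => ip (f z) v)).
Proof.
split=> h v; last exact: h.
have -> : (fun z => ip (f z) v) = (fun z => \sum_i (ip v (eb i))^* * fc f i z).
  by apply/funext => z; rewrite ip_fc.
by apply: measT_sum => i; apply: measTM => //; exact: measT_cst.
Qed.
Lemma meas_hnorm f : (forall i, measT (fc f i)) ->
  measurable_fun D (fun t => hnorm (f (circ t))).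
Proof.
move=> h.
have m : measurable_fun D (fun t => \sum_i cabs (fc f i (circ t)) ^+ 2).
  by apply: meas_sum => i; apply: measurable_funX; exact: measT_cabs.
have -> : (fun t => hnorm (f (circ t))) =
  (fun t => Num.sqrt (\sum_i cabs (fc f i (circ t)) ^+ 2)).
  by apply/funext => t; rewrite -hnorm_fc sqrtr_sqr ger0_norm // hnorm_ge0.
apply: (@measurableT_comp _ _ _ _ _ _ (@Num.sqrt R)) => //.
by apply: continuous_measurable_fun; exact: sqrt_continuous.
Qed.
Lemma L2P f : L2 f <-> forall i, cL2 (fc f i).
Proof.
split=> [[mf sf] i|h].
  have mc : forall i, measT (fc f i) by apply/measT_fc.
  have [_ rf] : rL2 (fun t => hnorm (f (circ t))) by apply/rL2_bnd => //; exact: meas_hnorm.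
  split=> //; apply: (rint_le _ rf); first by apply: measurable_funX; exact: measT_cabs.
  move=> t _; rewrite normrX ger0_norm ?cabs_ge0 // hnorm_fc (bigD1 i) //= lerDl.
  by apply: sumr_ge0 => j _; exact: sqr_ge0.
have mc i : measT (fc f i) by have [] := h i.
split; first exact/measT_fc.
apply/rL2_bnd; first exact: meas_hnorm.
split; first exact: meas_hnorm.
apply: (@rint_ext _ (fun t => \sum_i cabs (fc f i (circ t)) ^+ 2)).
  by move=> t _; rewrite hnorm_fc.
by apply: rint_sum => i; have [] := h i.
Qed.
Lemma scalarH2P (g : C -> C) : scalarH2 g <->
  cL2 g /\ forall n, intT (fun z => z ^+ n.+1 * g z) = 0.
Proof.
split=> [[mg sg h]|[[mg rg] h]].
  split=> //; split => //.
  by have [] : rL2 (fun t => cabs (g (circ t))) by apply/rL2_bnd => //; exact: measT_cabs.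
split=> //; apply/(rL2_bnd (measT_cabs mg)); split => //; exact: measT_cabs.
Qed.
Lemma H2P f : H2 E f <-> forall i, scalarH2 (fc f i).
Proof.
split=> [[/L2P hf h0] i|h].
  by apply/scalarH2P; split; [exact: hf|exact: h0].
have hc i : cL2 (fc f i) by have /scalarH2P[] := h i.
split; first exact/L2P.
move=> v n.
transitivity (intT (fun z => \sum_i (ip v (eb i))^* * (z ^+ n.+1 * fc f i z))).
  apply: intT_ext => t; rewrite ip_fc mulr_sumr; apply: eq_bigr => i _; ring.
rewrite intT_sum; last by move=> i; apply: cintZ; apply: cint_zX; exact: cL2_cint.
rewrite big1 // => i _; rewrite intTZ; last by apply: cint_zX; exact: cL2_cint.
by have /scalarH2P[_ ->] := h i; rewrite mulr0.
Qed.
Lemma L2_lin c f g : L2 f -> L2 g -> L2 (c *: f + g).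
Proof.
move=> /L2P hf /L2P hg; apply/L2P => i.
by apply: cL2_ext (cL2D (cL2Z c (hf i)) (hg i)) => t; rewrite fcL.
Qed.
Lemma L2_0 : L2 (0 : fn).
Proof.
apply/L2P => i; apply: cL2_ext (@cL2_cst R 0) => t.
by rewrite /fc (_ : (0 : fn) _ = 0) // ip0l.
Qed.
Lemma ip2E f g : L2 f -> L2 g ->
  ip2 f g = \sum_i intT (fun z => fc f i z * (fc g i z)^*).
Proof.
move=> /L2P hf /L2P hg; rewrite /ip2 -intT_sum; last by move=> i; exact: cL2_mulJ.
by apply: intT_ext => t; rewrite ip_fc2.
Qed.
Lemma ip2_sqn f : L2 f -> ip2 f f = (\sum_i sqn (fc f i))%:C.
Proof.
move=> hf; have /L2P hc := hf.
by rewrite ip2E // sumRC; apply: eq_bigr => i _; rewrite intT_sqn.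
Qed.
Lemma ip2_lin c f g h : L2 f -> L2 g -> L2 h ->
  ip2 (c *: f + g) h = c * ip2 f h + ip2 g h.
Proof.
move=> hf hg hh; have hl := L2_lin c hf hg.
have /L2P cf := hf; have /L2P cg := hg; have /L2P ch := hh.
rewrite !ip2E // mulr_sumr -big_split; apply: eq_bigr => i _ /=.
rewrite -intTZ -?intTD; [|by apply: cintZ; exact: cL2_mulJ|exact: cL2_mulJ..].
by apply: intT_ext => t; rewrite fcL; ring.
Qed.
Lemma ip2C f g : L2 f -> L2 g -> ip2 g f = (ip2 f g)^*.
Proof.
move=> hf hg; have /L2P cf := hf; have /L2P cg := hg.
rewrite !ip2E // rmorph_sum; apply: eq_bigr => i _ /=.
rewrite -intTJ; last exact: cL2_mulJ.
by apply: intT_ext => t; rewrite rmorphM /= conjCK mulrC.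
Qed.
Lemma ip2_ge0 f : L2 f -> 0 <= ip2 f f.
Proof.
move=> hf; rewrite ip2_sqn // ler0c; apply: sumr_ge0 => i _; exact: sqn_ge0.
Qed.
Definition L2PH : preHilbert R := @PreHilbert R fn (@L2 R E) (@ip2 R E)
  L2_0 L2_lin ip2_lin ip2C ip2_ge0.

Lemma H2L2 f : H2 E f -> L2 f. Proof. by case. Qed.
Lemma scalarH2_ext (f g : C -> C) : (forall t, f (circ t) = g (circ t)) -> scalarH2 f -> scalarH2 g.
Proof.
move=> e /scalarH2P[hf h]; apply/scalarH2P; split; first exact: cL2_ext e hf.
by move=> n; rewrite -[RHS](h n); apply: intT_ext => t; rewrite e.
Qed.
Lemma scalarH2_lin c (f g : C -> C) : scalarH2 f -> scalarH2 g -> scalarH2 (fun z => c * f z + g z).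
Proof.
move=> /scalarH2P[hf h1] /scalarH2P[hg h2]; apply/scalarH2P; split.
  by apply: cL2D => //; exact: cL2Z.
move=> n; transitivity (c * intT (fun z => z ^+ n.+1 * f z) + intT (fun z => z ^+ n.+1 * g z)).
  have c1 := cint_zX n.+1 (cL2_cint hf); have c2 := cint_zX n.+1 (cL2_cint hg).
  rewrite -intTZ // -intTD //; last exact: cintZ.
  by apply: intT_ext => t; ring.
by rewrite h1 h2 mulr0 addr0.
Qed.
Lemma H2_lin c f g : H2 E f -> H2 E g -> H2 E (c *: f + g).
Proof.
move=> /H2P hf /H2P hg; apply/H2P => i.
by apply: scalarH2_ext (scalarH2_lin c (hf i) (hg i)) => t; rewrite fcL.
Qed.
Lemma scalarH2_cst c : scalarH2 (fun _ : C => c).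
Proof.
apply/scalarH2P; split; first exact: cL2_cst.
move=> n; transitivity (c * intT (fun z : C => z ^+ n.+1)); last by rewrite intT_zX mulr0.
rewrite -intTZ; first by apply: intT_ext => t; rewrite mulrC.
apply: (@cint_ext _ (fun z => z ^+ n.+1 * 1)); first by move=> t; rewrite mulr1.
by apply: cint_zX; exact: cint_cst.
Qed.
Lemma H2_0 : H2 E 0.
Proof.
apply/H2P => i; apply: scalarH2_ext (scalarH2_cst 0) => t.
by rewrite /fc (_ : (0 : fn) _ = 0) // ip0l.
Qed.
Definition H2PH : preHilbert R := @PreHilbert R fn (H2 E) (@ip2 R E)
  H2_0 H2_lin (fun c x y z hx hy hz => ip2_lin c (H2L2 hx) (H2L2 hy) (H2L2 hz))
  (fun x y hx hy => ip2C (H2L2 hx) (H2L2 hy)) (fun x hx => ip2_ge0 (H2L2 hx)).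

Lemma norm2E f : norm2 f = @nrm R H2PH f. Proof. by []. Qed.

Lemma eqT_fc f g : eqT f g <-> forall i, eqT (fc f i) (fc g i).
Proof.
split=> [h i|h].
  by apply: aeT_sub h => t h; rewrite /fc h.
have : aeT (fun z => forall i, fc f i z = fc g i z) by exact: aeT_all.
by apply: aeT_sub => t ht; exact: eb_ext.
Qed.
Lemma L2_eqT f g : L2 f -> L2 g -> cRe (ip2 (f - g) (f - g)) = 0 <-> eqT f g.
Proof.
move=> hf hg; have hd : L2 (f - g) by exact: (@phmB R L2PH).
have /L2P cd := hd.
rewrite ip2_sqn //=; split.
  move=> /eqP; rewrite psumr_eq0; last by move=> i _; exact: sqn_ge0.
  move=> /allP h; apply/eqT_fc => i.
  have /eqP/(sqn0 (cd i)) := h i (mem_index_enum i).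
  by apply: aeT_sub => t; rewrite fcB => /subr0_eq.
move=> e; rewrite big1 // => i _.
have : eqT (fc (f - g) i) (fun=> 0).
  by move/eqT_fc: e => /(_ i); apply: aeT_sub => t h; rewrite fcB h subrr.
move=> /eq_sqn -> //; last exact: cL2_cst.
rewrite /sqn -[RHS](Int_cst (0 : R)); apply: Int_ext => t _.
by rewrite cabs0 expr0n.
Qed.
Lemma pheq_eqT f g : H2 E f -> H2 E g -> @pheq R H2PH f g <-> eqT f g.
Proof. by move=> /H2L2 hf /H2L2 hg; exact: L2_eqT. Qed.
Lemma eqT_refl (X : Type) (f : C -> X) : eqT f f. Proof. exact: aeTW. Qed.
Lemma eqT_sym (X : Type) (f g : C -> X) : eqT f g -> eqT g f.
Proof. by apply: aeT_sub. Qed.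
Lemma eqT_trans (X : Type) (g f h : C -> X) : eqT f g -> eqT g h -> eqT f h.
Proof. by move=> h1 h2; apply: aeT_sub (aeT_and h1 h2) => t [-> ->]. Qed.
Lemma eqT_lin c f g f' g' : eqT f f' -> eqT g g' -> eqT (c *: f + g) (c *: f' + g').
Proof.
by move=> h1 h2; apply: aeT_sub (aeT_and h1 h2) => t [a b]; rewrite !fctE a b.
Qed.
Lemma L2_ae f g : (forall v, measT (fun z => ip (g z) v)) -> eqT f g -> L2 f -> L2 g.
Proof.
move=> /measT_fc hg /eqT_fc e /L2P hf; apply/L2P => i.
exact: cL2_ae (hg i) (e i) (hf i).
Qed.
End VectorH2.

(** * Completeness, backward shift and Taylor coefficients in H^2 *)

Section HardySpace.
Variables (R : realType) (E : fdHilbert R).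
Notation C := R[i].
Notation fn := (C -> fdH_vect E).
Notation H := (H2PH E).
Local Notation hn := (@nrm R H).
Local Notation hn2 := (@nrm2 R H).
Implicit Types (f g h : fn) (c : C).

Lemma nrm2_sqn f : L2 f -> hn2 f = \sum_i sqn (fc f i).
Proof. by move=> hf; rewrite -[LHS]/(cRe (ip2 f f)) ip2_sqn. Qed.

(** The unit interval is a probability space, and the variance of v is nonnegative. *)
Lemma sqrt_Int_le (v : R -> R) : rL2 v -> Int v ^+ 2 <= Int (fun t => v t ^+ 2).
Proof.
move=> hv; have iv := rL2_rint hv; have [_ i2] := hv; set m := Int v.
have : 0 <= Int (fun t => (v t - m) ^+ 2) by apply: Int_ge0 => t _; exact: sqr_ge0.
have -> : Int (fun t => (v t - m) ^+ 2) = Int (fun t => v t ^+ 2) - m ^+ 2.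
  transitivity (Int (fun t => v t ^+ 2) + Int (fun t => (- 2 * m) * v t) + Int (fun=> m ^+ 2)).
    have r1 := rintZ (- 2 * m) iv; have r2 := rintD i2 r1; have r3 := rint_cst (m ^+ 2).
    rewrite -IntD // -IntD //.
    by apply: Int_ext => t _; ring.
  by rewrite IntZ // Int_cst -/m; ring.
by rewrite subr_ge0.
Qed.
Lemma intT_sqn_le (g : C -> C) : cL2 g -> cabs (intT g) ^+ 2 <= 4 * sqn g.
Proof.
move=> hg; have [mg rg] := hg.
have hv : rL2 (fun t => cabs (g (circ t))) by split=> //; exact: measT_cabs.
have h1 := intT_cabs_le (cL2_cint hg); have h2 := sqrt_Int_le hv.
have := @lerXn2r _ 2 (cabs (intT g)) (2 * Int (fun t => cabs (g (circ t)))).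
rewrite !nnegrE cabs_ge0 => /(_ isT).
rewrite mulr_ge0 ?Int_ge0 //; last by move=> t _; exact: cabs_ge0.
by move=> /(_ isT h1) h; apply: le_trans h _; rewrite exprMn -natrX ler_pM2l.
Qed.

Lemma H2_complete : completeH H.
Proof.
move=> u mu cu.
have mL n : L2 (u n) by exact: H2L2 (mu n).
have cc n i : cL2 (fc (u n) i) by have /L2P := mL n; apply.
have sle (f : fn) i : L2 f -> sqn (fc f i) <= hn2 f.
  move=> hf; rewrite nrm2_sqn // (bigD1 i) //= lerDl; apply: sumr_ge0 => j _; exact: sqn_ge0.
have sub (f g : fn) i : sqn (fc (f - g) i) = sqn (fun z => fc f i z - fc g i z).
  by apply: Int_ext => t _; rewrite fcB.
have hC i : forall e : R, 0 < e -> exists N, forall m n, (N <= m)%N -> (N <= n)%N ->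
     sqn (fun z => fc (u m) i z - fc (u n) i z) <= e.
  move=> e e0; have se : 0 < Num.sqrt e by rewrite sqrtr_gt0.
  have [N hN] := cu _ se; exists N => m n Nm Nn.
  have d := @phmB R H _ _ (mu m) (mu n).
  rewrite -sub; apply: le_trans (sle _ i (H2L2 d)) _.
  rewrite -nrmK // -[leRHS](sqr_sqrtr (ltW e0)).
  by rewrite lerXn2r ?nnegrE ?nrm_ge0 ?sqrtr_ge0 //; apply: ltW; exact: hN.
have /choice[a ha] i : exists f : C -> C, cL2 f /\ forall e : R, 0 < e ->
    exists N, forall n, (N <= n)%N -> sqn (fun z => fc (u n) i z - f z) <= e.
  by have [f h1 h2] := cL2_complete (fun n => cc n i) (hC i); exists f.
pose f : fn := fun z => \sum_i a i z *: eb i.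
have fE i z : fc f i z = a i z by rewrite /fc ip_eb_sum.
have hf : H2 E f.
  apply/H2P => i; apply: (@scalarH2_ext R (a i)); first by move=> t; rewrite fE.
  have [ca hcv] := ha i; apply/scalarH2P; split => // n.
  apply: cabs0_eq0; apply/eqP; rewrite -sqrf_eq0 eq_le sqr_ge0 andbT leNgt; apply/negP => p0.
  (* Fourier coefficients depend continuously on the function: by [intT_sqn_le], so good an
     approximation by functions without this coefficient would make its square at most half of
     itself. *)
  have e0 : 0 < cabs (intT (fun z => z ^+ n.+1 * a i z)) ^+ 2 / 8 by rewrite divr_gt0.
  have [N hN] := hcv _ e0.
  have := hN N (leqnn _).
  have cd := cL2B (cc N i) ca.
  have := intT_sqn_le (cL2_zX n.+1 cd).
  have -> : sqn (fun z => z ^+ n.+1 * (fc (u N) i z - a i z)) = sqn (fun z => fc (u N) i z - a i z).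
    by apply: Int_ext => t _; rewrite cabsM cabs_exp cabs_circ expr1n mul1r.
  have -> : intT (fun z => z ^+ n.+1 * (fc (u N) i z - a i z)) = - intT (fun z => z ^+ n.+1 * a i z).
    have /H2P /(_ i) /scalarH2P[_ h0] := mu N.
    rewrite -[RHS]add0r -(h0 n) -mulN1r -intTZ; last by apply: cint_zX; exact: cL2_cint.
    rewrite -intTD; first by apply: intT_ext => t; ring.
      by apply: cint_zX; exact: cL2_cint.
    by apply: cintZ; apply: cint_zX; exact: cL2_cint.
  by rewrite cabsN; lra.
exists f => // e e0.
pose k : R := (edim E).+1%:R; have k0 : 0 < k by rewrite ltr0Sn.
have e1 : 0 < e ^+ 2 / (2 * k) by rewrite divr_gt0 ?exprn_gt0 // mulr_gt0.
have /choice[N hN] i := (ha i).2 _ e1.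
exists (\max_i N i)%N => n hn.
have d := @phmB R H _ _ (mu n) hf.
rewrite -(@ltr_pXn2r _ 2) ?nnegrE ?nrm_ge0 ?(ltW e0) // nrmK // nrm2_sqn; last exact: H2L2.
apply: (@le_lt_trans _ _ (\sum_(i < edim E) e ^+ 2 / (2 * k))).
  apply: ler_sum => i _; rewrite sub.
  have -> : (fun z => fc (u n) i z - fc f i z) = (fun z => fc (u n) i z - a i z).
    by apply/funext => z; rewrite fE.
  by apply: hN; apply: leq_trans hn; exact: leq_bigmax.
rewrite sumr_const card_ord -[_ *+ _]mulr_natr.
have e2 : 0 < e ^+ 2 by rewrite exprn_gt0.
have -> : e ^+ 2 / (2 * k) * (edim E)%:R = e ^+ 2 * ((edim E)%:R / (2 * k)).
  by field; rewrite gt_eqF.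
rewrite gtr_pMr // ltr_pdivrMr ?mulr_gt0 // mul1r.
have : (edim E)%:R < k by rewrite ltr_nat.
lra.
Qed.

Lemma h2D f g : H2 E f -> H2 E g -> H2 E (f + g). Proof. exact: (@phmD R H). Qed.
Lemma h2B f g : H2 E f -> H2 E g -> H2 E (f - g). Proof. exact: (@phmB R H). Qed.
Lemma h2Z c f : H2 E f -> H2 E (c *: f). Proof. exact: (@phmZ R H). Qed.
Lemma ip2Dl f g h : H2 E f -> H2 E g -> H2 E h -> ip2 (f + g) h = ip2 f h + ip2 g h.
Proof. exact: (@dotDl R H). Qed.
Lemma ip2Bl f g h : H2 E f -> H2 E g -> H2 E h -> ip2 (f - g) h = ip2 f h - ip2 g h.
Proof. exact: (@dotBl R H). Qed.
Lemma ip2Br f g h : H2 E f -> H2 E g -> H2 E h -> ip2 h (f - g) = ip2 h f - ip2 h g.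
Proof. exact: (@dotBr R H). Qed.
Lemma ip2Zr c f h : H2 E f -> H2 E h -> ip2 h (c *: f) = c^* * ip2 h f.
Proof. exact: (@dotZr R H). Qed.
Lemma ip20l h : H2 E h -> ip2 0 h = 0. Proof. exact: (@dot0l R H). Qed.
Lemma ip2C' f g : H2 E f -> H2 E g -> ip2 g f = (ip2 f g)^*.
Proof. exact: (@dotC R H). Qed.
Lemma ip2_eqTl f g h : H2 E f -> H2 E g -> H2 E h -> eqT f g -> ip2 f h = ip2 g h.
Proof. by move=> hf hg hh /(pheq_eqT hf hg); exact: (@pheq_dotl R H). Qed.
Lemma ip2_eqTr f g h : H2 E f -> H2 E g -> H2 E h -> eqT f g -> ip2 h f = ip2 h g.
Proof. by move=> hf hg hh /(pheq_eqT hf hg); exact: (@pheq_dotr R H). Qed.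
Lemma ip2_eq0 f : H2 E f -> ip2 f f = 0 -> eqT f 0.
Proof.
move=> hf h; apply/(pheq_eqT hf (H2_0 E)); apply/(@pheq0 R H).
by rewrite -[LHS]/(cRe (ip2 f f)) h.
Qed.
Lemma nrm2_eqT f g : H2 E f -> H2 E g -> eqT f g -> hn2 f = hn2 g.
Proof. by move=> hf hg /(pheq_eqT hf hg); exact: (@pheq_nrm2 R H). Qed.

Definition zX (n : nat) f : fn := fun z => z ^+ n *: f z.
Lemma fc_zX n f i z : fc (zX n f) i z = z ^+ n * fc f i z.
Proof. by rewrite /fc ipZl. Qed.
Lemma zX_H2 n f : H2 E f -> H2 E (zX n f).
Proof.
move=> /H2P hf; apply/H2P => i; have /scalarH2P[h1 h2] := hf i; apply/scalarH2P; split.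
  by apply: cL2_ext (cL2_zX n h1) => t; rewrite fc_zX.
move=> m; rewrite -[RHS](h2 (m + n)%N); apply: intT_ext => t.
by rewrite fc_zX mulrA -exprD addSn.
Qed.
Lemma shift_zX f : shiftH2 E f = zX 1 f.
Proof. by apply/funext => z; rewrite /zX expr1. Qed.
Lemma zXS n f : zX n.+1 f = zX 1 (zX n f).
Proof. by apply/funext => z; rewrite /zX scalerA exprS expr1. Qed.
Lemma zX0 f : zX 0 f = f.
Proof. by apply/funext => z; rewrite /zX expr0 scale1r. Qed.
Lemma zX_lin n c f g : zX n (c *: f + g) = c *: zX n f + zX n g.
Proof. by apply/funext => z; rewrite !fctE /zX scalerDr !scalerA mulrC. Qed.
Lemma zX_iso n f g : L2 f -> L2 g -> ip2 (zX n f) (zX n g) = ip2 f g.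
Proof.
move=> hf hg; apply: intT_ext => t; rewrite /zX ipZl ipZr mulrA.
by rewrite mul_conjcC cabs_exp cabs_circ !expr1n mul1r.
Qed.

Definition cst1 (v : E) : fn := fun _ => v.
Lemma cst_H2 v : H2 E (cst1 v).
Proof. by apply/H2P => i; exact: (scalarH2_cst (ip v (eb i))). Qed.
Lemma fc_cst v i z : fc (cst1 v) i z = ip v (eb i). Proof. by []. Qed.
Lemma mono_H2 n v : H2 E (zX n (cst1 v)). Proof. exact: zX_H2 (cst_H2 v). Qed.

Lemma at0E f : (forall i, cint (fc f i)) -> at0 f = \sum_j intT (fc f j) *: eb j.
Proof.
move=> hf; rewrite /at0.
transitivity (\sum_(i < \dim {:E}) (\sum_j intT (fc f j) * coord (vbasis {:E}) i (eb j)) *: (vbasis {:E})`_i).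
  apply: eq_bigr => i _; congr (_ *: _).
  transitivity (intT (fun z => \sum_j coord (vbasis {:E}) i (eb j) * fc f j z)).
    apply: intT_ext => t; rewrite {1}(fc_exp f (circ t)) linear_sum.
    by apply: eq_bigr => j _; rewrite linearZ /= mulrC.
  rewrite intT_sum; last by move=> j; exact: cintZ.
  by apply: eq_bigr => j _; rewrite intTZ // mulrC.
under eq_bigr do rewrite scaler_suml.
rewrite exchange_big; apply: eq_bigr => j _ /=.
rewrite [in RHS](coord_vbasis (memvf (eb j))) scaler_sumr.
by apply: eq_bigr => i _; rewrite scalerA.
Qed.
Lemma L2_cint f i : L2 f -> cint (fc f i).
Proof. by move=> /L2P h; exact: cL2_cint. Qed.
Lemma ip_at0 f v : L2 f -> ip (at0 f) v = intT (fun z => ip (f z) v).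
Proof.
move=> hf; rewrite at0E; last by move=> i; exact: L2_cint.
rewrite ip_suml.
transitivity (intT (fun z => \sum_j (ip v (eb j))^* * fc f j z)).
  rewrite intT_sum; last by move=> j; apply: cintZ; exact: L2_cint.
  apply: eq_bigr => j _; rewrite ipZl -ipC intTZ; last exact: L2_cint.
  by rewrite mulrC.
by apply: intT_ext => t; rewrite ip_fc.
Qed.
Lemma at0_lin c f g : L2 f -> L2 g -> at0 (c *: f + g) = c *: at0 f + at0 g.
Proof.
move=> hf hg; apply: ip_extl => v; rewrite ip_lin !ip_at0 //; last exact: L2_lin.
have ci h : L2 h -> cint (fun z => ip (h z) v).
  move=> hh; apply: (@cint_ext _ (fun z => \sum_i (ip v (eb i))^* * fc h i z)).
    by move=> t; rewrite ip_fc.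
  by apply: cint_sum => i; apply: cintZ; exact: L2_cint.
rewrite -intTZ; last exact: ci.
rewrite -intTD; [|by apply: cintZ; exact: ci|exact: ci].
by apply: intT_ext => t; rewrite -ip_lin.
Qed.
Lemma at0_ae f g : L2 f -> L2 g -> eqT f g -> at0 f = at0 g.
Proof.
move=> hf hg /eqT_fc e; rewrite !at0E; [|by move=> i; exact: L2_cint..].
by apply: eq_bigr => i _; rewrite (intT_ae _ _ (e i)) //; exact: L2_cint.
Qed.
Lemma at0_cst v : at0 (cst1 v) = v.
Proof.
apply: ip_extl => w; rewrite ip_at0; last exact: H2L2 (cst_H2 v).
exact: (intT_cst (ip v w)).
Qed.
Lemma ip2_cst f v : L2 f -> ip2 f (cst1 v) = ip (at0 f) v.
Proof. by move=> hf; rewrite ip_at0. Qed.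

(* On the circle z^* = z^-1; this is a concrete form of [bshift], see [bshiftP]. *)
Definition bs f : fn := fun z => z^* *: (f z - at0 f).
Lemma bs_cst v : bs (cst1 v) = 0.
Proof. by apply/funext => z; rewrite /bs at0_cst /cst1 subrr scaler0. Qed.
Lemma fc_bs f i z : fc (bs f) i z = z^* * (fc f i z - ip (at0 f) (eb i)).
Proof. by rewrite /fc /bs ipZl ipBl. Qed.
Lemma fc_at0 f i : L2 f -> ip (at0 f) (eb i) = intT (fc f i).
Proof. by move=> hf; rewrite ip_at0. Qed.
Lemma bs_H2 f : H2 E f -> H2 E (bs f).
Proof.
move=> hf; have /H2P hc := hf; apply/H2P => i; have /scalarH2P[h1 h2] := hc i.
have a0 := fc_at0 i (H2L2 hf); set a := ip _ _ in a0.
have cd : cL2 (fun z => fc f i z - a) by apply: cL2B => //; exact: cL2_cst.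
apply/scalarH2P; split.
  apply: cL2_ext (cL2_zJX 1 cd) => t; rewrite fc_bs expr1 //.
move=> n.
transitivity (intT (fun z => z ^+ n * fc f i z) - a * intT (fun z => z ^+ n * 1)).
  have c1 : cint (fun z => z ^+ n * fc f i z) by apply: cint_zX; exact: cL2_cint.
  have c2 : cint (fun z : C => z ^+ n * 1) by apply: cint_zX; exact: cint_cst.
  rewrite -mulN1r mulrA -intTZ // -intTD //; last exact: cintZ.
  apply: intT_ext => t; rewrite fc_bs -/a exprSr.
  transitivity ((circ t * (circ t)^*) * (circ t ^+ n * (fc f i (circ t) - a))); first by ring.
  by rewrite circ_conjK; ring.
case: n => [|n].
  rewrite -[X in X - _ = _](_ : a = _); last first.
    by rewrite a0; apply: intT_ext => t; rewrite expr0 mul1r.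
  rewrite (_ : intT _ = 1) ?mulr1 ?subrr //.
  by rewrite -[RHS](@intT_cst R 1); apply: intT_ext => t; rewrite expr0 mul1r.
rewrite h2 (_ : intT _ = 0) ?mulr0 ?subrr //.
by rewrite -[RHS](@intT_zX R n); apply: intT_ext => t; rewrite mulr1.
Qed.
Lemma bs_lin c f g : H2 E f -> H2 E g -> bs (c *: f + g) = c *: bs f + bs g.
Proof.
move=> hf hg; apply/funext => z; rewrite /bs at0_lin; [|exact: H2L2..].
rewrite !fctE scalerA mulrC -scalerA -scalerDr; congr (_ *: _).
by rewrite scalerBr opprD addrACA.
Qed.
Lemma bs_eq f t : f (circ t) = at0 f + circ t *: bs f (circ t).
Proof. by rewrite /bs scalerA circ_conjK scale1r addrC subrK. Qed.
Lemma bs_adj h g : H2 E h -> H2 E g -> ip2 (bs h) g = ip2 h (zX 1 g).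
Proof.
move=> hh hg; have zg := zX_H2 1 hg.
have e : ip2 (cst1 (at0 h)) (zX 1 g) = 0.
  rewrite (ip2C (H2L2 zg) (H2L2 (cst_H2 _))) (ip2_cst _ (H2L2 zg)) ip_at0; last exact: H2L2.
  have [_ h0] := hg; rewrite (_ : intT _ = 0) ?rmorph0 //.
  by rewrite -[RHS](h0 (at0 h) 0%N); apply: intT_ext => t; rewrite /zX ipZl.
have hd := @phmB R H _ _ hh (cst_H2 (at0 h)).
transitivity (ip2 (h - cst1 (at0 h)) (zX 1 g)); last first.
  by rewrite ip2Bl ?e ?subr0 //; exact: cst_H2.
by apply: intT_ext => t; rewrite /bs /zX ipZl ipZr expr1.
Qed.
Lemma bs_zX f : H2 E f -> eqT (bs (zX 1 f)) f.
Proof.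
move=> hf; have a0 : at0 (zX 1 f) = 0.
  apply: ip_extl => v; rewrite ip0l ip_at0; last exact: H2L2 (zX_H2 1 hf).
  have [_ h0] := hf.
  by rewrite -[RHS](h0 v 0%N); apply: intT_ext => t; rewrite /zX ipZl.
apply: aeTW => t; rewrite /bs a0 subr0 /zX expr1 scalerA mulrC circ_conjK.
by rewrite scale1r.
Qed.
(** Orthogonal splitting of f into its value at 0 and z times its backward shift. Iterated, it is
    Parseval's identity with a remainder. *)
Lemma bs_nrm2 f : H2 E f -> hn2 f = hnorm (at0 f) ^+ 2 + hn2 (bs f).
Proof.
move=> hf; have hb := bs_H2 hf; have zb := zX_H2 1 hb; have hc := cst_H2 (at0 f).
have e : eqT f (cst1 (at0 f) + zX 1 (bs f)).
  by apply: aeTW => t; rewrite [LHS]bs_eq !fctE /zX expr1.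
have hs : H2 E (cst1 (at0 f) + zX 1 (bs f)) by exact: (@phmD R H).
rewrite (@pheq_nrm2 R H _ _ hf hs); last exact/pheq_eqT.
rewrite nrm2D //.
have -> : hn2 (zX 1 (bs f)) = hn2 (bs f).
  by rewrite -[LHS]/(cRe (ip2 _ _)) zX_iso //; exact: H2L2.
have -> : hn2 (cst1 (at0 f)) = hnorm (at0 f) ^+ 2.
  by rewrite -[LHS]/(cRe (ip2 _ _)) ip2_cst ?at0_cst ?hnorm2 //; exact: H2L2.
have -> : @ph_dot R H (cst1 (at0 f)) (zX 1 (bs f)) = 0.
  rewrite -[LHS]/(ip2 _ _) -bs_adj //.
  have -> : bs (cst1 (at0 f)) = 0; last exact: ip20l.
  by apply/funext => z; rewrite /bs at0_cst subrr scaler0.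
by rewrite mulr0 addr0.
Qed.
Lemma bs_contr f : H2 E f -> hn2 (bs f) <= hn2 f.
Proof. by move=> hf; rewrite (bs_nrm2 hf) lerDr sqr_ge0. Qed.

Lemma bs_pheq_iter n f : H2 E f -> H2 E (iter n bs f).
Proof. exact: (@iterm R H bs bs_H2 n f). Qed.
Lemma bs_iter_lin n c f g : H2 E f -> H2 E g ->
  iter n bs (c *: f + g) = c *: iter n bs f + iter n bs g.
Proof. exact: (@iter_lin R H bs bs_H2 bs_lin). Qed.
Lemma bs_iter_contr n f : H2 E f -> hn2 (iter n bs f) <= hn2 f.
Proof.
move=> hf; elim: n => //= n IH; apply: le_trans IH; apply: bs_contr; exact: bs_pheq_iter.
Qed.
Lemma nrm_eqT0 f : H2 E f -> eqT f 0 -> hn f = 0.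
Proof.
by move=> hf h; rewrite /nrm (nrm2_eqT hf (H2_0 E) h) (@nrm20 R H) sqrtr0.
Qed.

Lemma ip2_mono n f v : H2 E f -> ip2 f (zX n (cst1 v)) = ip (at0 (iter n bs f)) v.
Proof.
elim: n f => [|n IH] f hf; first by rewrite zX0 ip2_cst //; exact: H2L2.
by rewrite zXS -bs_adj ?IH ?iterSr //; [exact: bs_H2|exact: mono_H2].
Qed.

(** Membership in [H2] settles the negative frequencies and the hypothesis the others;
    [fourier_unique] then applies to each coordinate. *)
Lemma H2_unique f : H2 E f -> (forall n v, ip2 f (zX n (cst1 v)) = 0) -> eqT f 0.
Proof.
move=> hf h0; have hL := H2L2 hf; have /H2P hc := hf; apply/eqT_fc => i.
have /scalarH2P[c2 hn] := hc i.
have k n : intT (fun z => (z ^+ n)^* * fc f i z) = 0.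
  have := h0 n (eb i); rewrite (ip2E hL (H2L2 (mono_H2 n (eb i)))) => <-.
  rewrite (bigD1 i) //=.
  rewrite big1 ?addr0 => [|j ji].
    by apply: intT_ext => t; rewrite fc_zX fc_cst eb_ip eqxx mulr1 mulrC.
  rewrite -[RHS](@intT_cst R 0); apply: intT_ext => t.
  by rewrite fc_zX fc_cst eb_ip eq_sym (negbTE ji) mulr0 rmorph0 mulr0.
have : eqT (fc f i) (fun=> 0).
  apply: fourier_unique => [|n|//]; first exact: cL2_cint.
  case: n => [|n]; last exact: hn.
  by rewrite -[RHS](k 0%N); apply: intT_ext => t; rewrite expr0 rmorph1.
move=> h1; apply: (eqT_trans h1); apply: aeTW => t.
by rewrite /fc (_ : (0 : fn) _ = 0) // ip0l.
Qed.
Lemma H2_ext f g : H2 E f -> H2 E g ->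
  (forall n v, ip2 f (zX n (cst1 v)) = ip2 g (zX n (cst1 v))) -> eqT f g.
Proof.
move=> hf hg h; have hd := h2B hf hg.
apply/(pheq_eqT hf hg); rewrite /pheq -[LHS]/(cRe (ip2 (f - g) (f - g))).
have /(nrm2_eqT hd (H2_0 E)) : eqT (f - g) 0.
  apply: H2_unique => // n v; rewrite ip2Bl ?h ?subrr //; exact: mono_H2.
by rewrite (@nrm20 R H).
Qed.

Definition pl (n : nat) (a : nat -> E) : fn := \sum_(i < n) zX i (cst1 (a i)).
Lemma plE n a z : pl n a z = \sum_(i < n) z ^+ i *: a i.
Proof. by rewrite /pl fct_sumE. Qed.
Lemma pl_H2 n a : H2 E (pl n a).
Proof. by apply: (@phm_sum R H) => i; exact: mono_H2. Qed.
Lemma pl_poly n a : poly_fun (pl n a).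
Proof. by exists n, a; apply/funext => z; rewrite plE. Qed.
Lemma poly_pl p : poly_fun p -> exists n a, p = pl n a.
Proof.
move=> [n [a ->]]; exists n, (fun i => if insub i is Some j then a j else 0).
by apply/funext => z; rewrite plE; apply: eq_bigr => i _; rewrite valK.
Qed.
Lemma pl_widen n m a : (n <= m)%N -> pl n a = pl m (fun i => if (i < n)%N then a i else 0).
Proof.
move=> nm; apply/funext => z; rewrite !plE (big_ord_widen m (fun i => z ^+ i *: a i) nm).
by rewrite big_mkcond; apply: eq_bigr => i _; case: ifP => // _; rewrite scaler0.
Qed.
Lemma pl_lin c n a m b : exists k d, c *: pl n a + pl m b = pl k d.
Proof.
rewrite (pl_widen a (leq_addr m n)) (pl_widen b (leq_addl n m)).
exists (n + m)%N, (fun i => c *: (if (i < n)%N then a i else 0) + (if (i < m)%N then b i else 0)).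
apply/funext => z; rewrite !fctE !plE scaler_sumr -big_split; apply: eq_bigr => i _ /=.
by rewrite scalerDr !scalerA mulrC.
Qed.

(** Let W be the closure of the polynomials. The difference between f and its projection on W is
    orthogonal to all monomials, hence null by uniqueness of coefficients. *)
Lemma poly_dense f : H2 E f -> forall e : R, 0 < e -> exists n a, hn (f - pl n a) < e.
Proof.
move=> hf.
pose W : set fn := [set g | H2 E g /\ forall e : R, 0 < e -> exists n a, hn (g - pl n a) < e].
have sW : @subsp R H W.
  split; first by move=> x [].
    split; first exact: H2_0.
    move=> e e0; exists 0%N, (fun=> 0); rewrite /pl big_ord0 subr0.
    by rewrite nrm_eqT0 //; [exact: H2_0|exact: eqT_refl].
  move=> c x y [hx px] [hy py]; split; first exact: H2_lin.
  move=> e e0; pose k := cabs c + 1; have k0 : 0 < k by rewrite ltr_wpDl ?cabs_ge0.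
  have e1 : 0 < e / 2 by rewrite divr_gt0.
  have e2 : 0 < e / 2 / k by rewrite divr_gt0.
  have [n [a ha]] := px _ e2; have [m [b hb]] := py _ e1.
  have [q [d hd]] := pl_lin c n a m b; exists q, d; rewrite -hd.
  have -> : c *: x + y - (c *: pl n a + pl m b) = c *: (x - pl n a) + (y - pl m b).
    by rewrite scalerBr opprD addrACA.
  have h1 := h2B hx (pl_H2 n a); have h2 := h2B hy (pl_H2 m b).
  apply: le_lt_trans (@nrmD R H _ _ (h2Z c h1) h2) _.
  have -> : hn (c *: (x - pl n a)) = cabs c * hn (x - pl n a).
    by rewrite /nrm nrm2Z // sqrtrM ?sqr_ge0 // sqrtr_sqr ger0_norm ?cabs_ge0.
  have : cabs c * hn (x - pl n a) <= e / 2.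
    apply: (@le_trans _ _ (k * hn (x - pl n a))).
      by rewrite ler_wpM2r ?nrm_ge0 // /k lerDl.
    by rewrite mulrC -ler_pdivlMr //; exact: ltW.
  by move: hb; lra.
have cW : @closedW R H W.
  move=> x hx px; split => // e e0; have e1 : 0 < e / 2 by rewrite divr_gt0.
  have [y [hy py] hxy] := px _ e1; have [n [a ha]] := py _ e1; exists n, a.
  by have := @nrmB_tri R H y x (pl n a) hx hy (pl_H2 n a); lra.
have [m [hm pm] orth] := proj_exists H2_complete sW cW hf.
have /(pheq_eqT hf hm) e : eqT f m.
  apply: H2_ext => // n v; apply/subr0_eq; rewrite -ip2Bl //; last exact: mono_H2.
  apply: orth; split; first exact: mono_H2.
  move=> e e0; exists n.+1, (fun i => if i == n then v else 0).
  have -> : pl n.+1 (fun i => if i == n then v else 0) = zX n (cst1 v).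
    apply/funext => z; rewrite plE big_ord_recr /= eqxx big1 ?add0r // => i _.
    by rewrite ltn_eqF // scaler0.
  by rewrite subrr nrm_eqT0 //; [exact: H2_0|exact: eqT_refl].
move=> e0 e00; have [n [a ha]] := pm _ e00; exists n, a.
apply: le_lt_trans ha; apply: le_trans (@nrmB_tri R H m f (pl n a) hf hm (pl_H2 n a)) _.
have -> : hn (f - m) = 0 by apply/(@nrm2_eq0 R H); [exact: h2B|exact: e].
by rewrite add0r.
Qed.

Lemma at0_mono n v : at0 (zX n.+1 (cst1 v)) = 0.
Proof.
apply: ip_extl => w; rewrite ip0l ip_at0; last exact: H2L2 (mono_H2 _ _).
have [_ h] := cst_H2 v; rewrite -[RHS](h w n); apply: intT_ext => t.
by rewrite /zX ipZl.
Qed.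
Lemma bs_pl n a : eqT (bs (pl n.+1 a)) (pl n (fun i => a i.+1)).
Proof.
have h0 := cst_H2 (a 0%N).
pose q := pl n (fun i => a i.+1); have hq := pl_H2 n (fun i => a i.+1).
have e : pl n.+1 a = 1 *: cst1 (a 0%N) + zX 1 q.
  apply/funext => z; rewrite !fctE plE big_ord_recl /= expr0 !scale1r /zX expr1 /q plE.
  by rewrite scaler_sumr; congr (_ + _); apply: eq_bigr => i _; rewrite scalerA -exprS.
rewrite e bs_lin //; last exact: zX_H2.
have -> : bs (cst1 (a 0%N)) = 0.
  by apply/funext => z; rewrite /bs at0_cst subrr scaler0.
rewrite scaler0 add0r; exact: bs_zX.
Qed.
Lemma bs_iter_eqT n f g : H2 E f -> H2 E g -> eqT f g -> eqT (iter n bs f) (iter n bs g).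
Proof.
move=> hf hg h; apply/(pheq_eqT (bs_pheq_iter n hf) (bs_pheq_iter n hg)).
rewrite /pheq; have -> : iter n bs f - iter n bs g = iter n bs (f - g).
  by have := bs_iter_lin n (-1) hg hf; rewrite !scaleN1r [f - g]addrC => ->; rewrite addrC.
apply/eqP; rewrite eq_le; apply/andP; split; last first.
  by apply: (@nrm2_ge0 R H); apply: bs_pheq_iter; exact: h2B.
apply: le_trans (bs_iter_contr n (h2B hf hg)) _.
by have -> : hn2 (f - g) = 0 by exact/(pheq_eqT hf hg).
Qed.
Lemma bs_iter_pl n a : eqT (iter n bs (pl n a)) 0.
Proof.
elim: n a => [|n IH] a; first by rewrite /= /pl big_ord0; exact: eqT_refl.
rewrite iterSr; apply: eqT_trans (IH (fun i => a i.+1)).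
apply: bs_iter_eqT (bs_pl n a); [exact: bs_H2 (pl_H2 _ _)|exact: pl_H2].
Qed.
(** The backward shift annihilates a polynomial after finitely many steps and is a contraction, so
    the decay follows from density. *)
Lemma bs_stable f : H2 E f -> forall e : R, 0 < e ->
  exists N, forall n, (N <= n)%N -> hn (iter n bs f) < e.
Proof.
move=> hf e e0; have [N [a ha]] := poly_dense hf e0; exists N => n Nn.
have hp := pl_H2 N a; have hd := h2B hf hp.
have e1 : eqT (iter n bs (pl N a)) 0.
  rewrite -(subnK Nn) iterD.
  apply: eqT_trans (bs_iter_eqT (n - N) (bs_pheq_iter N hp) (H2_0 E) (bs_iter_pl N a)) _.
  have := bs_iter_lin (n - N) 1 (H2_0 E) (H2_0 E); rewrite !scale1r addr0 => h.
  have -> : iter (n - N) bs 0 = 0 by apply: (addrI (iter (n - N) bs 0)); rewrite addr0 -h.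
  exact: eqT_refl.
have e2 : iter n bs f = iter n bs (f - pl N a) + iter n bs (pl N a).
  have := bs_iter_lin n 1 hd hp; rewrite !scale1r subrK => ->.
  by [].
rewrite e2; apply: le_lt_trans (@nrmD R H _ _ (bs_pheq_iter n hd) (bs_pheq_iter n hp)) _.
rewrite (nrm_eqT0 (bs_pheq_iter n hp) e1) addr0.
apply: le_lt_trans ha; rewrite /nrm ler_sqrt; first exact: bs_iter_contr.
exact: (@nrm2_ge0 R H).
Qed.
Lemma taylor N f t : H2 E f ->
  f (circ t) = pl N (fun k => at0 (iter k bs f)) (circ t) + circ t ^+ N *: iter N bs f (circ t).
Proof.
move=> hf; elim: N => [|N IH]; first by rewrite /pl big_ord0 expr0 scale1r add0r.
rewrite {1}IH !plE big_ord_recr /= -addrA; congr (_ + _).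
by rewrite (bs_eq (iter N bs f) t) scalerDr scalerA -exprSr.
Qed.
End HardySpace.

Section Adjoints.
Variables (R : realType) (E F : fdHilbert R).
Notation C := R[i].

Lemma adjH2P (T : (C -> E) -> (C -> F)) g g' : H2 E g' ->
  (forall h, H2 E h -> ip2 (T h) g = ip2 h g') ->
  H2 E (adjH2 T g) /\ eqT (adjH2 T g) g'.
Proof.
move=> hg' hT; rewrite /adjH2; case: xgetP => [k _ [hk kT]|h]; last by case: (h g').
split=> //; have hd := h2B hk hg'.
apply/(pheq_eqT hk hg'); rewrite /pheq -[LHS]/(cRe (ip2 (k - g') (k - g'))).
by rewrite ip2Br // -kT // -hT // subrr.
Qed.
(** With analytic symbols, the products to be projected already agree with elements of H^2;
    orthogonality of f - k to H^2 then determines k up to null sets. *)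
Lemma projH2P (f g : C -> F) : L2 f -> H2 F g -> eqT f g ->
  H2 F (projH2 f) /\ eqT (projH2 f) g.
Proof.
move=> hf hg e.
have key k : H2 F k -> (forall h, H2 F h -> ip2 (f - k) h = 0) -> eqT k g.
  move=> hk kp; have hd := h2B hk hg.
  apply/(pheq_eqT hk hg); rewrite /pheq -[LHS]/(cRe (ip2 (k - g) (k - g))).
  have z : ip2 (f - g) (k - g) = 0.
    apply: (@dot_null R (L2PH F)); [exact: (@phmB R (L2PH F) _ _ hf (H2L2 hg))|exact: H2L2|].
    by apply/(L2_eqT hf (H2L2 hg)).
  have e1 : ip2 (f - g - (k - g)) (k - g) = ip2 (f - g) (k - g) - ip2 (k - g) (k - g).
    exact: (@dotBl R (L2PH F) (f - g) (k - g) (k - g)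
      (@phmB R (L2PH F) _ _ hf (H2L2 hg)) (H2L2 hd) (H2L2 hd)).
  have := kp _ hd; have -> : f - k = (f - g) - (k - g) by rewrite opprB addrA subrK.
  by rewrite e1 z sub0r => /eqP; rewrite oppr_eq0 => /eqP ->.
rewrite /projH2; case: xgetP => [k _ [hk kp]|h]; first by split=> //; exact: key.
case: (h g); split=> // k hk.
apply: (@dot_null R (L2PH F)); [exact: (@phmB R (L2PH F) _ _ hf (H2L2 hg))|exact: H2L2|].
by apply/(L2_eqT hf (H2L2 hg)).
Qed.
End Adjoints.

Section Bshift.
Variables (R : realType) (E : fdHilbert R).
Lemma bshiftP (g : R[i] -> E) : H2 E g -> H2 E (bshift E g) /\ eqT (bshift E g) (bs g).
Proof.
move=> hg; apply: adjH2P; first exact: bs_H2.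
move=> h hh; rewrite shift_zX (ip2C' hg (zX_H2 1 hh)) -bs_adj //.
by rewrite -ip2C' //; exact: bs_H2.
Qed.
Lemma projConstP (h : R[i] -> E) : H2 E h -> H2 E (projConst h) /\ eqT (projConst h) (cst1 (at0 h)).
Proof.
move=> hh; have [hb eb] := bshiftP hh; split.
  by apply: h2B => //; rewrite shift_zX; exact: zX_H2.
apply: aeT_sub eb => t e; rewrite /projConst !fctE /shiftH2 e.
by rewrite {1}(bs_eq h t) addrK.
Qed.
End Bshift.

(** * Multiplication by analytic symbols *)

Section IsoRange.
Variables (R : realType) (H1 H2 : preHilbert R) (V : ph_sort H1 -> ph_sort H2).
Variable M : set (ph_sort H1).
Hypotheses (cH : completeH H1) (sM : subsp M) (cM : closedW M).
Hypothesis Vm : forall x, M x -> ph_mem (V x).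
Hypothesis Vlin : forall c x y, M x -> M y -> pheq (V (c *: x + y)) (c *: V x + V y).
Hypothesis Viso : forall x, M x -> nrm2 (V x) = nrm2 x.

Definition iso_range := [set k | ph_mem k /\ exists2 x, M x & pheq k (V x)].

Lemma iso_diff x y : M x -> M y -> nrm2 (V x - V y) = nrm2 (x - y).
Proof.
move=> Mx My; have h := Vlin (-1) My Mx; rewrite !scaleN1r addrC in h.
have Md : M (x - y) by exact: subspB sM _ _ Mx My.
rewrite -(Viso Md) [in RHS]addrC; have m1 := Vm Mx; have m2 := Vm My.
rewrite [in RHS]addrC; symmetry; apply: pheq_nrm2; [exact: Vm|ph|].
by rewrite [V x - V y]addrC.
Qed.

Lemma iso_range_subsp : subsp iso_range.
Proof.
have V0 : pheq 0 (V 0).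
  have h := Viso (subsp0 sM); rewrite nrm20 in h.
  by rewrite /pheq sub0r nrm2N //; apply: Vm; exact: subsp0.
split; first by move=> x [].
  split; first exact: phm0.
  by exists 0 => //; exact: subsp0.
move=> c x y [mx [a Ma xa]] [my [b Mb yb]]; split; first by ph.
have Mab : M (c *: a + b) by exact: (subspL sM).
exists (c *: a + b) => //.
have mVa := Vm Ma; have mVb := Vm Mb.
apply: (@pheq_trans _ _ (c *: V a + V b)); [ph|ph|exact: Vm| |].
  by apply: pheq_lin => //; ph.
by apply: pheq_sym; [exact: Vm|ph|exact: Vlin].
Qed.

(** Approximants V (a n) of x form a Cauchy sequence, hence so do the a n by [iso_diff].
    Completeness and closedness of M provide their limit, a preimage of x. *)
Lemma iso_range_closed : closedW iso_range.
Proof.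
move=> x mx hx; split=> //.
have e0 n : (0 : R) < n.+1%:R^-1 by rewrite invr_gt0 ltr0Sn.
have /choice[a ha] n : exists a, M a /\ nrm (x - V a) < n.+1%:R^-1.
  have [y [my [a Ma ya]] h] := hx _ (e0 n); exists a; split=> //.
  have mVa := Vm Ma.
  apply: le_lt_trans h; apply: le_trans (nrmB_tri mx my mVa) _.
  by rewrite /nrm [nrm2 (y - _)]ya sqrtr0 addr0.
have ma n : ph_mem (a n) by apply: (subspm sM); case: (ha n).
have small e : 0 < e -> exists N, forall n, (N <= n)%N -> nrm (x - V (a n)) < e / 2.
  move=> ep; exists (Num.truncn (2 / e)) => n hn; have [_ h] := ha n.
  apply: lt_trans h _; rewrite -[ltLHS]mul1r ltr_pdivrMr ?ltr0Sn // mulrAC.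
  rewrite ltr_pdivlMr // mul1r mulrC -ltr_pdivrMr //.
  by apply: lt_le_trans (truncnS_gt _) _; rewrite ler_nat.
have ca : cauchyseq a.
  move=> e ep; have [N hN] := small e ep; exists N => m n Nm Nn.
  have [Mm _] := ha m; have [Mn _] := ha n.
  rewrite /nrm -iso_diff // -/(nrm _).
  have h1 := hN m Nm; have h2 := hN n Nn; rewrite nrmBsym // in h1; last exact: Vm.
  have := nrmB_tri (Vm Mm) mx (Vm Mn); lra.
have [b mb cb] := cH ma ca.
have Mb : M b.
  apply: cM => // e ep; have [N hN] := cb e ep; exists (a N); first by case: (ha N).
  by rewrite nrmBsym //; exact: hN.
exists b => //.
have mVa n : ph_mem (V (a n)) by apply: Vm; case: (ha n).
apply: (@cvg_to_pheq _ _ (fun n => V (a n))) => //; first exact: Vm.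
  move=> e ep; have [N hN] := small e ep; exists N => n Nn; rewrite nrmBsym //.
  by apply: lt_trans (hN n Nn) _; lra.
move=> e ep; have [N hN] := cb e ep; exists N => n Nn.
by rewrite /nrm iso_diff //; [exact: hN|case: (ha n)].
Qed.
End IsoRange.

Lemma Int_le_ae (R : realType) (u v : R -> R) : rint u -> rint v ->
  aeD (fun t => u t <= v t) -> Int u <= Int v.
Proof.
move=> iu iv h; pose w t := Num.max (u t) (v t).
have e : aeD (fun t => v t = w t).
  by apply: aeD_sub h => t _ k; rewrite /w max_r.
have iw : rint w.
  exact: (rint_ae (measurable_maxr (rint_meas iu) (rint_meas iv)) e iv).
rewrite (Int_ae iv iw e); apply: Int_le => // t _.
by rewrite /w le_max lexx.
Qed.

(** * Closedness of multiplication by an H^2 symbol *)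

Section Symbols.
Variables (R : realType) (E F : fdHilbert R).
Notation C := R[i].
Variable Phi : C -> 'Hom(fdH_vect E, fdH_vect F).
Hypothesis hPhi : opH2 Phi.
Implicit Types (h : C -> E).

Definition app h : C -> F := fun z => Phi z (h z).

Lemma ip_app h v z : ip (app h z) v = \sum_i fc h i z * ip (Phi z (eb i)) v.
Proof.
rewrite /app {1}(fc_exp h z) linear_sum ip_suml; apply: eq_bigr => i _.
by rewrite linearZ /= ipZl.
Qed.
Lemma symb_cL2 u v : cL2 (fun z => ip (Phi z u) v).
Proof. by have /scalarH2P[] := hPhi u v. Qed.
Lemma app_cint h v : L2 h -> cint (fun z => ip (app h z) v).
Proof.
move=> /L2P hh; apply: (@cint_ext _ (fun z => \sum_i fc h i z * ip (Phi z (eb i)) v)).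
  by move=> t; rewrite ip_app.
by apply: cint_sum => i; apply: cL2_mul => //; exact: symb_cL2.
Qed.
Lemma app_meas h v : L2 h -> measT (fun z => ip (app h z) v).
Proof. by move=> hh; exact: cint_meas (app_cint v hh). Qed.

Definition symb_const v : R := \sum_i sqn (fun z => ip (Phi z (eb i)) v).
Lemma symb_const_ge0 v : 0 <= symb_const v.
Proof. by apply: sumr_ge0 => i _; exact: sqn_ge0. Qed.
(** Entries of Phi are only square-integrable, so Phi h is only integrable. This is the continuity
    from L^2 to L^1, with a weight d left free. *)
Lemma app_bound h v (d : R) : 0 < d -> L2 h ->
  Int (fun t => cabs (ip (app h (circ t)) v)) <= 2^-1 * (d * symb_const v + d^-1 * @nrm2 R (H2PH E) h).
Proof.
move=> d0 hL; have /L2P hh := hL.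
have r i : rint (fun t => cabs (fc h i (circ t)) * cabs (ip (Phi (circ t) (eb i)) v)).
  exact: (cabs_mul_rint (hh i) (symb_cL2 (eb i) v)).
apply: (@le_trans _ _ (\sum_i Int (fun t => cabs (fc h i (circ t)) * cabs (ip (Phi (circ t) (eb i)) v)))).
  rewrite -Int_sum //; apply: Int_le; first exact: (cint_cabs (app_cint v hL)).
    exact: rint_sum.
  move=> t _; rewrite ip_app; apply: le_trans (cabs_sum _ _ _) _.
  by apply: ler_sum => i _; rewrite cabsM.
rewrite nrm2_sqn // /symb_const !mulr_sumr -big_split mulr_sumr; apply: ler_sum => i _ /=.
have d1 : 0 < d^-1 by rewrite invr_gt0.
have := mul_small d1 (hh i) (symb_cL2 (eb i) v); rewrite invrK.
lra.
Qed.
Lemma app_lin c h g : app (c *: h + g) = c *: app h + app g.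
Proof. by apply/funext => z; rewrite /app !fctE linearP. Qed.
Lemma appB h g : app (h - g) = app h - app g.
Proof. by apply/funext => z; rewrite /app !fctE linearB. Qed.
Lemma app_eqT h g : eqT h g -> eqT (app h) (app g).
Proof. by apply: aeT_sub => t e; rewrite /app e. Qed.
Lemma app_zX n h : app (zX n h) = zX n (app h).
Proof. by apply/funext => z; rewrite /app /zX linearZ. Qed.
Lemma app_cst0 : app (cst1 0) = cst1 0.
Proof. by apply/funext => z; rewrite /app linear0. Qed.

Lemma app_small h v (e : R) : 0 < e -> exists2 s : R, 0 < s &
  forall g, H2 E g -> @nrm R (H2PH E) g < s -> Int (fun t => cabs (ip (app g (circ t)) v)) <= e.
Proof.
move=> e0; set A := symb_const v; have A0 : 0 <= A := symb_const_ge0 v.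
(* This d gives d A <= e, and the threshold sqrt (e d) gives d^-1 nrm2 g <= e; the bound of
   [app_bound] is half their sum. *)
pose d := e / (A + 1); have d0 : 0 < d by rewrite divr_gt0 // ltr_wpDl.
have ed : 0 < e * d by rewrite mulr_gt0.
exists (Num.sqrt (e * d)); first by rewrite sqrtr_gt0.
move=> g hg hn; apply: le_trans (app_bound v d0 (H2L2 hg)) _; rewrite -/A.
have n2 : @nrm2 R (H2PH E) g <= e * d.
  rewrite -nrmK // -[leRHS](sqr_sqrtr (ltW ed)).
  by rewrite lerXn2r ?nnegrE ?nrm_ge0 ?sqrtr_ge0 // ltW.
have h1 : d * A <= e.
  by rewrite /d mulrAC ler_pdivrMr ?ltr_wpDl // ler_wpM2l ?(ltW e0) // lerDl.
have h2 : d^-1 * @nrm2 R (H2PH E) g <= e.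
  by rewrite ler_pdivrMl // mulrC.
lra.
Qed.

(** The common sequence tends to f in L^2 and to Phi h coordinatewise in L^1, so the two limits
    agree almost everywhere. This replaces boundedness of multiplication by Phi, which may fail. *)
Lemma app_limit (f : C -> F) h (fN : nat -> C -> F) (hN : nat -> C -> E) :
  H2 F f -> H2 E h -> (forall n, H2 F (fN n)) -> (forall n, H2 E (hN n)) ->
  (forall n, eqT (fN n) (app (hN n))) ->
  @cvg_to R (H2PH F) fN f -> @cvg_to R (H2PH E) hN h -> eqT f (app h).
Proof.
move=> hf hh hfN hhN e cf ch; apply/eqT_fc => i.
have cg : cint (fun z => fc f i z + (-1) * fc (app h) i z).
  apply: cintD; first by apply: L2_cint; exact: H2L2.
  by apply: cintZ; exact: app_cint (H2L2 hh).
have : eqT (fun z => fc f i z + (-1) * fc (app h) i z) (fun=> 0).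
  apply: cint_cabs0 => //; apply/eqP; rewrite eq_le; apply/andP; split; last first.
    by apply: Int_ge0 => t _; exact: cabs_ge0.
  rewrite leNgt; apply/negP => p0.
  set I0 := Int _ in p0; have e0 : 0 < I0 / 3 by rewrite divr_gt0.
  have [s s0 hs] := app_small h (eb i) e0.
  have [N1 h1] := cf _ e0; have [N2 h2] := ch _ s0.
  pose n := maxn N1 N2.
  have d1 := h2B (hfN n) hf; have d2 := h2B (hhN n) hh.
  have b1 : Int (fun t => cabs (fc (fN n - f) i (circ t))) <= I0 / 3.
    have /L2P /(_ i) cd := H2L2 d1; have [md rd] := cd.
    have r2 : rL2 (fun t => cabs (fc (fN n - f) i (circ t))) by split=> //; exact: measT_cabs.
    rewrite -(@ler_pXn2r _ 2) ?nnegrE ?(ltW e0) ?Int_ge0 //; last by move=> t _; exact: cabs_ge0.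
    apply: le_trans (sqrt_Int_le r2) _.
    apply: (@le_trans _ _ (@nrm2 R (H2PH F) (fN n - f))).
      rewrite nrm2_sqn; last exact: H2L2.
      by rewrite (bigD1 i) //= lerDl; apply: sumr_ge0 => j _; exact: sqn_ge0.
    rewrite -nrmK // lerXn2r ?nnegrE ?nrm_ge0 ?(ltW e0) //; apply/ltW/h1; exact: leq_maxl.
  have b2 : Int (fun t => cabs (ip (app (hN n - h) (circ t)) (eb i))) <= I0 / 3.
    by apply: hs => //; apply: h2; exact: leq_maxr.
  have c1 := cint_cabs (L2_cint i (H2L2 d1)).
  have c2 := cint_cabs (app_cint (eb i) (H2L2 d2)).
  have : I0 <= Int (fun t => cabs (fc (fN n - f) i (circ t))) +
    Int (fun t => cabs (ip (app (hN n - h) (circ t)) (eb i))).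
    rewrite -IntD //; apply: (Int_le_ae (cint_cabs cg) (rintD c1 c2)).
    move: (e n); rewrite /eqT aeTE; apply: aeD_sub => t _ k.
    rewrite -[X in _ <= X + _]cabsN; apply: le_trans (cabsD _ _).
    rewrite appB fcB /fc k ipBl le_eqVlt; apply/orP; left; apply/eqP.
    by congr (cabs _); ring.
  lra.
apply: aeT_sub => t; rewrite mulN1r; exact: subr0_eq.
Qed.

(** For polynomial h the integral is a finite sum of negative coefficients of entries of Phi.
    Continuity into L^1 carries the vanishing over to all h by density. *)
Lemma app_neg h v n : H2 E h -> intT (fun z => z ^+ n.+1 * ip (app h z) v) = 0.
Proof.
move=> hh; apply: cabs0_eq0; apply/eqP; rewrite eq_le cabs_ge0 andbT leNgt; apply/negP.
set L := intT _ => L0; have e0 : 0 < cabs L / 4 by rewrite divr_gt0.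
have [s s0 hs] := app_small h v e0; have [N [a ha]] := poly_dense hh s0.
have hp := pl_H2 N a; have hd := h2B hh hp.
have c0 := cint_zX n.+1 (app_cint v (H2L2 hd)).
have p0 : intT (fun z => z ^+ n.+1 * ip (app (pl N a) z) v) = 0.
  transitivity (intT (fun z => \sum_(k < N) z ^+ (k + n).+1 * ip (Phi z (a k)) v)).
    apply: intT_ext => t; rewrite /app plE linear_sum ip_suml mulr_sumr.
    apply: eq_bigr => k _; rewrite linearZ /= ipZl mulrA -exprD addSn addnC //.
  rewrite intT_sum; last by move=> k; apply: cint_zX; apply: cL2_cint; exact: symb_cL2.
  by rewrite big1 // => k _; have /scalarH2P[_ ->] := hPhi (a k) v.
have e : L = intT (fun z => z ^+ n.+1 * ip (app (h - pl N a) z) v).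
  rewrite -[RHS]addr0 -p0 -intTD //; last by apply: cint_zX; exact: app_cint (H2L2 hp).
  by apply: intT_ext => t; rewrite appB !fctE ipBl mulrBr subrK.
have := intT_cabs_le c0; rewrite -e.
have -> : Int (fun t => cabs (circ t ^+ n.+1 * ip (app (h - pl N a) (circ t)) v)) =
  Int (fun t => cabs (ip (app (h - pl N a) (circ t)) v)).
  by apply: Int_ext => t _; rewrite cabsM cabs_exp cabs_circ expr1n mul1r.
have := hs _ hd ha; lra.
Qed.
Lemma app_H2 h : H2 E h -> L2 (app h) -> H2 F (app h).
Proof. by move=> hh hL; split=> // v n; exact: app_neg. Qed.
Lemma toeplitzP h : H2 E h -> H2 F (app h) ->
  H2 F (toeplitz Phi h) /\ eqT (toeplitz Phi h) (app h).
Proof. by move=> hh ha; apply: projH2P => //; [exact: H2L2|exact: eqT_refl]. Qed.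
End Symbols.

(** * Multiplication by an inner function *)

Section Inner.
Variables (R : realType) (E F : fdHilbert R).
Notation C := R[i].
Variable Theta : C -> 'Hom(fdH_vect E, fdH_vect F).
Hypothesis hT : inner_fun Theta.
Implicit Types (h g : C -> E).
Notation app := (app Theta).

Lemma inner_opH2 : opH2 Theta.
Proof. by move=> u v; have [] := hT.1 u v. Qed.
Lemma inner_iso : aeT (fun z => forall u v, ip (Theta z u) (Theta z v) = ip u v).
Proof. by apply: aeT_sub hT.2 => t /hadj_isoP. Qed.
Lemma inner_app_L2 h : L2 h -> L2 (app h).
Proof.
move=> hL; have mv v : measT (fun z => ip (app h z) v) by exact: (app_meas inner_opH2 v hL).
have mf : forall i, measT (fc (app h) i) by apply/measT_fc.
have [mh sh] := hL; split=> //.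
apply/(rL2_bnd (meas_hnorm mf)); split; first exact: meas_hnorm.
have mh' : forall i, measT (fc h i) by apply/measT_fc.
have [_ r] : rL2 (fun t => hnorm (h (circ t))) by apply/rL2_bnd => //; exact: meas_hnorm.
apply: rint_ae r; first by apply: measurable_funX; exact: meas_hnorm.
move: inner_iso; rewrite aeTE; apply: aeD_sub => t _ k.
by rewrite !hnorm2 /app k.
Qed.
Lemma inner_app_H2 h : H2 E h -> H2 F (app h).
Proof. by move=> hh; apply: (app_H2 inner_opH2 hh); apply: inner_app_L2; exact: H2L2. Qed.
Lemma inner_ip2 h g : H2 E h -> H2 E g -> ip2 (app h) (app g) = ip2 h g.
Proof.
move=> hh hg.
have ci (K : fdHilbert R) (f k : C -> K) : H2 K f -> H2 K k -> cint (fun z => ip (f z) (k z)).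
  move=> /H2L2/L2P hf /H2L2/L2P hk.
  apply: (@cint_ext _ (fun z => \sum_i fc f i z * (fc k i z)^*)).
    by move=> t; rewrite ip_fc2.
  by apply: cint_sum => i; exact: cL2_mulJ.
apply: intT_ae; [by apply: ci; exact: inner_app_H2|exact: ci|].
by apply: aeT_sub inner_iso => t k; rewrite /app k.
Qed.
Lemma inner_nrm2 h : H2 E h -> @nrm2 R (H2PH F) (app h) = @nrm2 R (H2PH E) h.
Proof.
by move=> hh; rewrite -[LHS]/(cRe (ip2 _ _)) inner_ip2.
Qed.
Lemma inner_toeplitz h : H2 E h -> H2 F (toeplitz Theta h) /\ eqT (toeplitz Theta h) (app h).
Proof. by move=> hh; apply: toeplitzP => //; exact: inner_app_H2. Qed.

Definition inner_range : set (C -> F) :=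
  [set x | H2 F x /\ exists2 h, H2 E h & eqT x (app h)].

Lemma H2_subsp (K : fdHilbert R) : @subsp R (H2PH K) (H2 K).
Proof. by split=> //; [exact: H2_0|exact: H2_lin]. Qed.
Lemma inner_rangeE : inner_range = @iso_range R (H2PH E) (H2PH F) app (H2 E).
Proof.
apply/seteqP; split=> x [hx [h hh e]]; split=> //; exists h => //.
  by apply/pheq_eqT => //; exact: inner_app_H2.
by apply/(pheq_eqT hx (inner_app_H2 hh)).
Qed.
Lemma inner_range_subsp : @subsp R (H2PH F) inner_range.
Proof.
rewrite inner_rangeE; apply: iso_range_subsp.
- exact: H2_subsp.
- by move=> x hx; exact: inner_app_H2.
- by move=> c x y hx hy; rewrite app_lin; exact: pheq_refl.
- by move=> x hx; exact: inner_nrm2.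
Qed.
Lemma inner_range_closed : @closedW R (H2PH F) inner_range.
Proof.
rewrite inner_rangeE; apply: iso_range_closed.
- exact: H2_complete.
- exact: H2_subsp.
- by move=> x hx _.
- by move=> x hx; exact: inner_app_H2.
- by move=> c x y hx hy; rewrite app_lin; exact: pheq_refl.
- by move=> x hx; exact: inner_nrm2.
Qed.

Lemma inner_proj (g : C -> F) : H2 F g -> exists2 h, H2 E h &
  forall h', H2 E h' -> ip2 (g - app h) (app h') = 0.
Proof.
move=> hg; have [m [hm [h hh e]] orth] := proj_exists (@H2_complete R F)
  inner_range_subsp inner_range_closed hg.
exists h => // h' hh'.
have ha := inner_app_H2 hh; have ha' := inner_app_H2 hh'.
rewrite -[RHS](orth (app h')); last by split=> //; exists h' => //; exact: eqT_refl.
apply: ip2_eqTl => //; [exact: h2B|exact: h2B|].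
by apply: aeT_sub e => t k; rewrite !fctE k.
Qed.
Lemma inner_adj (g : C -> F) h : H2 F g -> H2 E h ->
  (forall h', H2 E h' -> ip2 (g - app h) (app h') = 0) ->
  H2 E (adjH2 (toeplitz Theta) g) /\ eqT (adjH2 (toeplitz Theta) g) h.
Proof.
move=> hg hh orth; apply: adjH2P => // k hk.
have [ht et] := inner_toeplitz hk; have ha := inner_app_H2 hh; have hak := inner_app_H2 hk.
rewrite (ip2_eqTl ht hak hg et) -(inner_ip2 hk hh).
apply/eqP; rewrite -subr_eq0 -ip2Br //.
by rewrite (ip2C' (h2B hg ha) hak) orth // rmorph0.
Qed.
End Inner.

(** A condition that fails everywhere cannot hold almost everywhere: the constants 1 and 0 have
    different integrals. *)
Lemma aeT_ex (R : realType) (P : R[i] -> Prop) : aeT P -> exists t : R, P (circ t).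
Proof.
move=> h; apply: contrapT => /forallNP hn.
have : Int (fun _ : R => 1 : R) = Int (fun _ : R => 0 : R).
  apply: Int_ae; [exact: rint_cst|exact: rint_cst|].
  by move: h; rewrite aeTE; apply: aeD_sub => t _ /hn.
by rewrite !Int_cst => /eqP; rewrite oner_eq0.
Qed.

Section ColSym.
Variables (R : realType) (F : fdHilbert R) (k : nat).
Notation C := R[i].
Variable w : 'I_k -> (C -> F).

Definition colsym_fun (z : C) (u : 'rV[C]_k) : fdH_vect F := \sum_i u 0 i *: w i z.
Lemma colsym_linear z : linear (colsym_fun z).
Proof.
move=> c x y; rewrite /colsym_fun scaler_sumr -big_split; apply: eq_bigr => i _ /=.
by rewrite !mxE scalerDl scalerA.
Qed.
Definition colsym (z : C) : 'Hom(fdH_vect (Cn R k), fdH_vect F) :=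
  linfun (HB.pack_for {linear 'rV[C]_k -> fdH_vect F} (colsym_fun z)
    (GRing.isLinear.Build _ _ _ _ (colsym_fun z) (colsym_linear z))).
Lemma colsymE z (u : 'rV[C]_k) : colsym z u = \sum_i u 0 i *: w i z.
Proof. by rewrite /colsym lfunE. Qed.
Hypothesis hw : forall i, H2 F (w i).
Lemma colsym_opH2 : opH2 colsym.
Proof.
move=> u v.
have : scalarH2 (fun z => ip ((\sum_i u 0 i *: w i) z) v).
  have hs : H2 F (\sum_i u 0 i *: w i) by exact: (@phm_lc R (H2PH F)).
  have [[mf sf] h0] := hs.
  apply/scalarH2P; split; last exact: h0.
  have /L2P hc := H2L2 hs.
  apply: (@cL2_ext _ (fun z => \sum_i (ip v (eb i))^* * fc (\sum_i u 0 i *: w i) i z)).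
    by move=> t; rewrite -ip_fc.
  by apply: cL2_sum => i; exact: cL2Z.
apply: scalarH2_ext => t; rewrite colsymE fct_sumE; congr (ip _ v).
Qed.
End ColSym.

(** * The Beurling-Lax theorem *)

Section BeurlingLax.
Variables (R : realType) (F : fdHilbert R) (N : set (R[i] -> F)).
Notation C := R[i].
Hypotheses (sN : @subsp R (H2PH F) N) (cN : @closedW R (H2PH F) N).
Hypothesis zN : forall x, N x -> N (zX 1 x).

Lemma beurling_H2 x : N x -> H2 F x.
Proof. exact: (@subspm R (H2PH F)). Qed.
Lemma beurling_zX n x : N x -> N (zX n x).
Proof. by move=> hx; elim: n => [|n IH]; rewrite ?zX0 // zXS; exact: zN. Qed.

(** The wandering subspace, complement of z N in N. An orthonormal basis of it will form the columns
    of Theta. *)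
Definition wander : set (C -> F) :=
  [set x | N x /\ forall y, N y -> ip2 x (zX 1 y) = 0].

Lemma wander_subsp : @subsp R (H2PH F) wander.
Proof.
split=> [x [/beurling_H2 //]||c x y [hx ox] [hy oy]].
  by split=> [|y hy]; [exact: subsp0 sN|rewrite ip20l //; apply: zX_H2; exact: beurling_H2].
split=> [|g hg]; first exact: (subspL sN).
have mg := zX_H2 1 (beurling_H2 hg).
by rewrite (@ip2_lin R F) ?ox ?oy ?mulr0 ?addr0 //; apply: H2L2 => //; exact: beurling_H2.
Qed.

(** The Fourier coefficients of <x(z), y(z)> at nonzero frequencies are scalar products of one
    function with a shift z^n of the other, n > 0, and these vanish. Only the mean remains. *)
Lemma wander_const x y : wander x -> wander y -> aeT (fun z => ip (x z) (y z) = ip2 x y).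
Proof.
move=> [Nx ox] [Ny oy]; have hx := beurling_H2 Nx; have hy := beurling_H2 Ny.
have ci : cint (fun z => ip (x z) (y z)).
  have /L2P cx := H2L2 hx; have /L2P cy := H2L2 hy.
  apply: (@cint_ext _ (fun z => \sum_i fc x i z * (fc y i z)^*)) => [t|]; first by rewrite ip_fc2.
  by apply: cint_sum => i; exact: cL2_mulJ.
have cc : cint (fun _ : C => - ip2 x y) by exact: cint_cst.
have c0 := cintD ci cc.
suff : eqT (fun z => ip (x z) (y z) - ip2 x y) (fun=> 0).
  by apply: aeT_sub => t; exact: subr0_eq.
have h0 : intT (fun z => ip (x z) (y z) - ip2 x y) = 0.
  by rewrite intTD // intT_cst subrr.
apply: fourier_unique => // -[|n].
- by rewrite -[RHS]h0; apply: intT_ext => t; rewrite expr0 mul1r.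
- transitivity (intT (fun z => z ^+ n.+1 * ip (x z) (y z)) + - ip2 x y * intT (fun z : C => z ^+ n.+1)).
    have cz : cint (fun z : C => z ^+ n.+1).
      by apply: (@cint_ext _ (fun z => z ^+ n.+1 * 1)) => [t|]; rewrite ?mulr1 //; exact/cint_zX/cint_cst.
    rewrite -(intTZ _ cz) -intTD; [|exact: cint_zX|exact: cintZ].
    by apply: intT_ext => t; ring.
  rewrite intT_zX mulr0 addr0.
  transitivity (ip2 (zX n.+1 x) y); first by apply: intT_ext => t; rewrite ipZl.
  by rewrite (ip2C' hy (zX_H2 _ hx)) zXS oy ?rmorph0 //; exact: beurling_zX.
- by rewrite -[RHS]h0; apply: intT_ext => t; rewrite expr0 rmorph1 mul1r.
- transitivity (intT (fun z => (z ^+ n.+1)^* * ip (x z) (y z)) + - ip2 x y * intT (fun z : C => (z ^+ n.+1)^*)).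
    have cz : cint (fun z : C => (z ^+ n.+1)^*).
      by apply: (@cint_ext _ (fun z => (z ^+ n.+1)^* * 1)) => [t|]; rewrite ?mulr1 //; exact/cint_zJX/cint_cst.
    rewrite -(intTZ _ cz) -intTD; [|exact: cint_zJX|exact: cintZ].
    by apply: intT_ext => t; ring.
  have -> : intT (fun z : C => (z ^+ n.+1)^*) = 0.
    rewrite intTJ ?intT_zX ?rmorph0 //.
    by apply: (@cint_ext _ (fun z => z ^+ n.+1 * 1)) => [t|]; rewrite ?mulr1 //; exact/cint_zX/cint_cst.
  rewrite mulr0 addr0.
  transitivity (ip2 x (zX n.+1 y)); first by apply: intT_ext => t; rewrite ipZr.
  by rewrite zXS ox //; exact: beurling_zX.
Qed.

Lemma wander_onf k (w : 'I_k -> C -> F) : @onf R (H2PH F) k w -> (forall i, wander (w i)) ->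
  aeT (fun z => forall i j, ip (w i z) (w j z) = (i == j)%:R).
Proof.
move=> [_ ow] Lw; apply: aeT_all => i; apply: aeT_all => j.
by apply: aeT_sub (wander_const (Lw i) (Lw j)) => t ->; exact: ow.
Qed.
(** By [wander_onf] the family is pointwise orthonormal almost everywhere; one such point bounds its
    length by that of a basis of F. *)
Lemma wander_dim k (w : 'I_k -> C -> F) : @onf R (H2PH F) k w -> (forall i, wander (w i)) ->
  (k <= edim F)%N.
Proof.
move=> ow Lw; have [t ht] := aeT_ex (wander_onf ow Lw).
apply: (@onf_bound R (fdPH F) k _ (fun i => w i (circ t)) (@eb R F)
  (\matrix_(i, j) ip (w i (circ t)) (eb j))) => // i.
rewrite [X in pheq X _](eb_exp (w i (circ t))).
have -> : \sum_j (\matrix_(i, j) ip (w i (circ t)) (eb j)) i j *: (eb j : ph_sort (fdPH F)) =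
  \sum_i0 ip (w i (circ t)) (eb i0) *: eb i0 by apply: eq_bigr => j _; rewrite mxE.
exact: pheq_refl.
Qed.

Lemma colsym_inner k (w : 'I_k -> C -> F) : (forall i, H2 F (w i)) ->
  aeT (fun z => forall i j, ip (w i z) (w j z) = (i == j)%:R) -> inner_fun (colsym w).
Proof.
move=> hw ow.
have iso : aeT (fun z => forall u v, ip (colsym w z u) (colsym w z v) = ip u v).
  apply: aeT_sub ow => t o u v; rewrite !colsymE ip_suml /ip /= /dotv.
  apply: eq_bigr => i _; rewrite -/(ip _ _) ipZl ip_sumr (bigD1 i) //= ipZr o eqxx mulr1.
  rewrite big1 ?addr0 // => j ji; rewrite ipZr o eq_sym (negbTE ji) mulr0 //.
split; last by apply: aeT_sub iso => t /hadj_isoP.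
move=> u v; split; first exact: colsym_opH2.
exists (hnorm u * hnorm v); apply: aeT_sub iso => t h.
rewrite normcC lecR; apply: le_trans (cabs_ip_le _ _) _.
by rewrite ler_wpM2r ?hnorm_ge0 // /hnorm h.
Qed.

Theorem beurling_lax : exists k (Theta : C -> 'Hom(fdH_vect (Cn R k), fdH_vect F)),
  inner_fun Theta /\ N = inner_range Theta.
Proof.
have [k [w [ow Lw sw]]] := max_onb wander_subsp wander_dim.
have hw i : H2 F (w i) := ow.1 i.
have hT := colsym_inner hw (wander_onf ow Lw).
set Theta := colsym w in hT; exists k, Theta; split=> //.
have range_sub h : H2 (Cn R k) h -> N (app Theta h).
  move=> hh; apply: cN; first exact: inner_app_H2.
  move=> e e0; have [n [a ha]] := poly_dense hh e0.
  exists (app Theta (pl n a)).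
    have -> : app Theta (pl n a) = \sum_(j < n) 1 *: \sum_i (a j : 'rV_k) 0 i *: zX j (w i).
      apply/funext => z; rewrite /app plE linear_sum fct_sumE; apply: eq_bigr => j _.
      rewrite linearZ /= colsymE scale1r fct_sumE scaler_sumr; apply: eq_bigr => i _.
      by rewrite !fctE /zX !scalerA mulrC.
    apply: (subsp_lc sN) => j; apply: (subsp_lc sN) => i; apply: beurling_zX.
    by case: (Lw i).
  have hp := pl_H2 n a.
  by rewrite -appB /nrm inner_nrm2 //; exact: h2B.
(* The part of N orthogonal to Theta H^2. Each of its elements is z times another one, hence
   divisible by every power of z, hence null. *)
pose Q r := N r /\ forall h, H2 (Cn R k) h -> ip2 r (app Theta h) = 0.
have step r : Q r -> exists2 y, Q y & eqT r (zX 1 y).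
  move=> [Nr or]; have hr := beurling_H2 Nr.
  have zVm x : N x -> H2 F (zX 1 x) by move=> Nx; apply: zX_H2; exact: beurling_H2.
  have zVl c x y : N x -> N y -> @pheq R (H2PH F) (zX 1 (c *: x + y)) (c *: zX 1 x + zX 1 y).
    by move=> _ _; rewrite zX_lin; exact: pheq_refl.
  have zVi x : N x -> @nrm2 R (H2PH F) (zX 1 x) = @nrm2 R (H2PH F) x.
    by move=> Nx; rewrite -[LHS]/(cRe (ip2 _ _)) zX_iso //; apply: H2L2; exact: beurling_H2.
  have [m [hm [y Ny ey]] om] := proj_exists (@H2_complete R F)
    (@iso_range_subsp R (H2PH F) (H2PH F) (zX 1) N sN zVm zVl zVi)
    (@iso_range_closed R (H2PH F) (H2PH F) (zX 1) N (@H2_complete R F) sN cN zVm zVl zVi) hr.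
  have hzy := zVm _ Ny.
  have Nm : N m.
    by apply: (closedW_pheq cN hm (zN Ny)).
  have hd : H2 F (r - m) := h2B hr hm.
  have Ld : wander (r - m).
    split; first exact: (subspB sN).
    move=> g Ng; apply: om; split; first exact: zVm.
    by exists g => //; exact: pheq_refl.
  (* r - m is wandering, so it is Theta u for a constant u and is orthogonal to r. It is also
     orthogonal to m, the projection of r on z N. *)
  have d0 : ip2 (r - m) (r - m) = 0.
    rewrite ip2Br // [ip2 (r - m) m](om m) ?subr0; last by split=> //; exists y.
    rewrite (ip2C' hr hd) -[RHS](rmorph0 Num.conj); congr (_^*).
    pose u : Cn R k := \row_i ip2 (r - m) (w i).
    have eu : app Theta (cst1 u) = @onproj R (H2PH F) k w (r - m).
      apply/funext => z; rewrite /app colsymE /onproj fct_sumE.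
      by apply: eq_bigr => i _; rewrite mxE.
    rewrite -(or (cst1 u)); last exact: cst_H2.
    have ha : H2 F (app Theta (cst1 u)) by apply: inner_app_H2 => //; exact: cst_H2.
    apply: ip2_eqTr => //; rewrite eu; apply/pheq_eqT => //; last exact: sw.
    exact: (@onprojm R (H2PH F)).
  have erm : eqT r (zX 1 y).
    apply: (@eqT_trans _ _ m); last by apply/pheq_eqT.
    by move: (ip2_eq0 hd d0); apply: aeT_sub => t; rewrite !fctE => /subr0_eq.
  exists y => //; split=> // h hh.
  have hy := beurling_H2 Ny; have ha := inner_app_H2 hT hh.
  rewrite -(zX_iso 1 (H2L2 hy) (H2L2 ha)) -[RHS](or (zX 1 h)); last exact: zX_H2.
  rewrite -app_zX.
  apply: ip2_eqTl => //; last exact: eqT_sym.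
  by apply: inner_app_H2 => //; exact: zX_H2.
have stepn n r : Q r -> exists2 y, Q y & eqT r (zX n y).
  elim: n r => [|n IH] r Qr; first by exists r => //; rewrite zX0; exact: eqT_refl.
  have [y Qy e] := step r Qr; have [y' Qy' e'] := IH y Qy; exists y' => //.
  apply: eqT_trans e _; rewrite (zXS n y').
  by apply: aeT_sub e' => t h; rewrite [LHS]/zX h.
have Q0 r : Q r -> eqT r 0.
  move=> Qr; have hr := beurling_H2 Qr.1; apply: H2_unique => // n v.
  (* One power more than n is divided out, so that the Taylor coefficient of order n vanishes. *)
  have [y Qy e] := stepn n.+1 r Qr; have hy := beurling_H2 Qy.1.
  have hm := mono_H2 n v.
  rewrite (ip2_eqTl hr (zX_H2 n.+1 hy) hm e).
  have -> : zX n.+1 y = zX n (zX 1 y).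
    by apply/funext => z; rewrite /zX expr1 scalerA -exprSr.
  have h1 := zX_H2 1 hy; have hc := cst_H2 v.
  rewrite (zX_iso n (H2L2 h1) (H2L2 hc)) (ip2C' hc h1) -bs_adj //.
  rewrite bs_cst.
  by rewrite ip20l // rmorph0.
apply/seteqP; split=> x.
  move=> Nx; have hx := beurling_H2 Nx; split=> //.
  have [h hh oh] := inner_proj hT hx; exists h => //.
  have /Q0 : Q (x - app Theta h) by split=> //; apply: (subspB sN) => //; exact: range_sub.
  by apply: aeT_sub => t; rewrite !fctE => /subr0_eq.
move=> [hx [h hh e]]; apply: (closedW_pheq cN hx (range_sub h hh)).
by apply/(pheq_eqT hx); first exact: inner_app_H2.
Qed.
End BeurlingLax.
(** * Defect spaces *)

Section DefectTheory.
Variables (R : realType) (F : fdHilbert R).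
Notation C := R[i].
Notation H := (H2PH F).
Implicit Types (W M : set (C -> F)).

Lemma h2_lc (I : Type) (r : seq I) (P : pred I) (a : I -> C) (w : I -> C -> F) :
  (forall i, H2 F (w i)) -> H2 F (\sum_(i <- r | P i) a i *: w i).
Proof. exact: (@phm_lc R H). Qed.

Lemma eqT_lc (I : finType) (a : I -> C) (w v : I -> C -> F) :
  (forall i, eqT (w i) (v i)) -> eqT (\sum_i a i *: w i) (\sum_i a i *: v i).
Proof.
move=> h; have : aeT (fun z => forall i, w i z = v i z) by exact: aeT_all.
by apply: aeT_sub => t e; rewrite !fct_sumE; apply: eq_bigr => i _; rewrite !fctE e.
Qed.

Lemma closed_subspaceP M : closed_subspace M -> @subsp R H M /\ @closedW R H M.
Proof. by case=> s m0 ml mc; split; [split|]. Qed.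

Lemma closed_subspace_eqT M f g : closed_subspace M -> M f -> H2 F g -> eqT g f -> M g.
Proof.
move=> cM Mf hg e; have [sM cl] := closed_subspaceP cM.
by apply: (closedW_pheq cl hg Mf); apply/pheq_eqT => //; exact: (subspm sM).
Qed.

Definition lspan (J : finType) (w : J -> C -> F) : set (C -> F) :=
  [set f | H2 F f /\ exists c : J -> C, eqT f (\sum_i c i *: w i)].

Lemma lspan_subsp (J : finType) (w : J -> C -> F) : @subsp R H (lspan w).
Proof.
split=> [x []//||c x y [hx [a ea]] [hy [b eb]]].
  split; first exact: H2_0.
  by exists (fun=> 0); apply: aeTW => t; rewrite fct_sumE big1 // => i _; rewrite scale0r.
split; first exact: H2_lin.
exists (fun i => c * a i + b i); apply: eqT_trans (eqT_lin c ea eb) _; apply: aeTW => t.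
rewrite !fctE !fct_sumE scaler_sumr -big_split; apply: eq_bigr => i _ /=.
by rewrite !fctE scalerDl scalerA.
Qed.

Lemma lspan_eqT (J : finType) (w : J -> C -> F) f g : lspan w f -> H2 F g -> eqT g f -> lspan w g.
Proof. by move=> [hf [a ea]] hg e; split=> //; exists a; exact: eqT_trans e ea. Qed.

Lemma mem_lspan (J : finType) (w : J -> C -> F) i : H2 F (w i) -> lspan w (w i).
Proof.
move=> hw; split=> //; exists (fun j => (i == j)%:R); apply: aeTW => t.
rewrite fct_sumE (bigD1 i) //= eqxx !fctE scale1r big1 ?addr0 // => j ij.
by rewrite !fctE eq_sym (negbTE ij) scale0r.
Qed.

Lemma has_dim_subsp W k : has_dim W k -> @subsp R H W.
Proof. by move=> [w [_ _ ->]]; exact: lspan_subsp. Qed.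

Lemma has_dim_le W k n (v : 'I_n -> C -> F) : has_dim W k -> (forall j, H2 F (v j)) ->
  (forall x, W x -> exists a : 'I_n -> C, eqT x (\sum_j a j *: v j)) -> (k <= n)%N.
Proof.
move=> hd hv sp; have [w [hw iw eW]] := hd; rewrite leqNgt; apply/negP => nk.
have Ww i : W (w i) by rewrite eW; exact: mem_lspan.
have /choice[A hA] i := sp _ (Ww i).
have [i||i|//|c c0 n0] := @lin_dep R H k n w v (\matrix_(i, j) A i j).
- exact: hw.
- exact: hv.
- apply/pheq_eqT; [exact: hw|exact: h2_lc|].
  apply: eqT_trans (hA i) _; apply: aeTW => t; rewrite !fct_sumE.
  by apply: eq_bigr => j _; rewrite !fctE mxE.
- have e : eqT (\sum_i c 0 i *: w i) 0.
    by apply/pheq_eqT; [exact: h2_lc|exact: H2_0|apply/pheq0].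
  have z := iw _ e; move/eqP: c0; apply.
  by apply/rowP => i; rewrite z mxE.
Qed.

Lemma has_dim_uniq W k n : has_dim W k -> has_dim W n -> k = n.
Proof.
move=> hk hn; apply/eqP; rewrite eqn_leq; have [w [hw _ ew]] := hk; have [v [hv _ ev]] := hn.
apply/andP; split; [apply: (has_dim_le hk hv)|apply: (has_dim_le hn hw)] => x.
  by rewrite {1}ev => -[].
by rewrite {1}ew => -[].
Qed.

Lemma dimH2E W k : has_dim W k -> dimH2 W = k.
Proof.
move=> h; rewrite /dimH2; case: xgetP => [n _ hn|/(_ k)//].
exact: has_dim_uniq hn h.
Qed.

Lemma has_dim_onb W k (w : 'I_k -> C -> F) : @subsp R H W ->
  (forall f g, W f -> H2 F g -> eqT g f -> W g) -> @onf R H k w -> (forall i, W (w i)) ->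
  (forall x, W x -> @pheq R H x (@onproj R H k w x)) -> has_dim W k.
Proof.
move=> sW eW ow Ww sp; exists w; have hw i : H2 F (w i) := ow.1 i; split=> //.
  move=> c e i; rewrite -(@onf_dot_lc R H k w c i ow).
  rewrite -[RHS](ip20l (hw i)); apply: ip2_eqTl => //; [exact: h2_lc|exact: H2_0].
apply/seteqP; split=> x.
  move=> Wx; have hx : H2 F x := subspm sW Wx; split=> //.
  exists (fun i => ip2 x (w i)).
  by apply/pheq_eqT => //; [exact: h2_lc|exact: sp].
move=> [hx [c e]]; apply: (eW _ _ _ hx e); exact: (subsp_lc sW).
Qed.

Lemma has_dim_span (J : finType) (v : J -> C -> F) W : (forall j, H2 F (v j)) ->
  @subsp R H W -> (forall f g, W f -> H2 F g -> eqT g f -> W g) ->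
  (forall x, W x -> exists a : J -> C, eqT x (\sum_j a j *: v j)) ->
  exists k (w : 'I_k -> C -> F), [/\ has_dim W k, @onf R H k w, forall i, W (w i) &
    forall x, W x -> @pheq R H x (@onproj R H k w x)].
Proof.
move=> hv sW eW sp; pose n := #|J|; pose v' (j : 'I_n) : ph_sort H := v (enum_val j).
have sp' x : W x -> exists a : 'I_n -> C, @pheq R H x (\sum_j a j *: v' j).
  move=> Wx; have [a e] := sp x Wx; exists (fun j => a (enum_val j)).
  have -> : \sum_j a (enum_val j) *: v' j = \sum_j a j *: (v j : ph_sort H).
    by rewrite [RHS](reindex _ (onW_bij _ (@enum_val_bij J))).
  by apply/pheq_eqT => //; [exact: (subspm sW)|exact: h2_lc].
have bound k (w : 'I_k -> ph_sort H) : @onf R H k w -> (forall i, W (w i)) -> (k <= n)%N.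
  move=> ow Ww; have /choice[A hA] i := sp' _ (Ww i).
  apply: (@onf_bound R H k n w v' (\matrix_(i, j) A i j)) => // [j|i]; first exact: hv.
  have -> : \sum_j (\matrix_(i, j) A i j) i j *: v' j = \sum_j A i j *: v' j.
    by apply: eq_bigr => j _; rewrite mxE.
  exact: hA.
have [k [w [ow Ww hw]]] := max_onb sW bound.
by exists k, w; split=> //; exact: has_dim_onb ow Ww hw.
Qed.

Lemma defect_uniq T M W k : has_dim W k -> defect_space T M W ->
  (forall W', defect_space T M W' -> (k <= dimH2 W')%N) -> defect T M = k.
Proof.
move=> hk hW hmin; rewrite /defect; case: xgetP => [n _ [[W' hW' eW'] nmin]|/(_ k)].
  apply/eqP; rewrite eqn_leq; apply/andP; split.
    by apply: leq_trans (nmin _ hW) _; rewrite (dimH2E hk).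
  by rewrite -eW'; exact: hmin.
by case; split=> //; exists W => //; exact: dimH2E.
Qed.

(* Any defect space maps onto (T M + M) / M, into which W embeds. *)
Lemma minimal_defect T M W k : closed_subspace M -> has_dim W k -> defect_space T M W ->
  (forall x, W x -> M x -> eqT x 0) ->
  (forall x, W x -> exists f m, [/\ M f, M m & eqT x (T f - m)]) ->
  minimal_defect_space T M W /\ defect T M = k.
Proof.
move=> cM hk hW triv sub; have [sM _] := closed_subspaceP cM.
have hM f : M f -> H2 F f := subspm sM (x := f).
suff e : defect T M = k by split=> //; split=> //; rewrite e; exact: dimH2E.
apply: (defect_uniq hk hW) => W' [[n hn] hW']; rewrite (dimH2E hn) leqNgt; apply/negP => nk.
have [w [hw iw eW]] := hk; have [v [hv _ ev]] := hn.
have Ww i : W (w i) by rewrite eW; exact: mem_lspan.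
(* Each basis vector of W is split along M and W'. If n < k, a nontrivial combination kills the
   parts in W', and the same combination of the basis of W lies in M, against [triv]. *)
have /choice[q hq] i : exists q : (C -> F) * (C -> F), [/\ M q.1, W' q.2 & eqT (w i) (q.1 + q.2)].
  have [f [m [Mf Mm e]]] := sub _ (Ww i); have [g [u [Mg Wu e']]] := hW' f Mf.
  exists (g - m, u); split=> //=; first exact: (subspB sM).
  apply: eqT_trans e _; apply: aeT_sub e' => t h; rewrite !fctE h.
  by rewrite addrAC.
have hu i : H2 F (q i).2 by have [_ Wu _] := hq i; exact: (subspm (has_dim_subsp hn)).
have /choice[A hA] i : exists a : 'I_n -> C, eqT (q i).2 (\sum_j a j *: v j).
  by have [_ Wu _] := hq i; move: Wu; rewrite ev => -[].
have [i||i|//|c c0 n0] := @lin_dep R H k n (fun i => (q i).2) v (\matrix_(i, j) A i j).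
- exact: hu.
- exact: hv.
- apply/pheq_eqT; [exact: hu|exact: h2_lc|].
  apply: eqT_trans (hA i) _; apply: aeTW => t; rewrite !fct_sumE.
  by apply: eq_bigr => j _; rewrite !fctE mxE.
- have e : eqT (\sum_i c 0 i *: (q i).2) 0.
    by apply/pheq_eqT; [exact: h2_lc|exact: H2_0|apply/pheq0].
  have Mq i : M (q i).1 by case: (hq i).
  have ew : eqT (\sum_i c 0 i *: w i) (\sum_i c 0 i *: (q i).1).
    apply: (@eqT_trans _ _ (\sum_i c 0 i *: ((q i).1 + (q i).2))).
      by apply: eqT_lc => i; case: (hq i).
    apply: aeT_sub e => t; rewrite !fct_sumE => h.
    under eq_bigr do rewrite fctE scalerDr.
    by rewrite big_split /= -[RHS]addr0 -[X in _ = _ + X]h.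
  have hws : H2 F (\sum_i c 0 i *: w i) by exact: h2_lc.
  have z : eqT (\sum_i c 0 i *: w i) 0.
    apply: triv; first exact: (subsp_lc (has_dim_subsp hk)).
    by apply: (closed_subspace_eqT cM _ hws ew); exact: (subsp_lc sM).
  have := iw _ z => zc; move/eqP: c0; apply.
  by apply/rowP => i; rewrite zc mxE.
Qed.
End DefectTheory.

Lemma bs_eqT (R : realType) (E : fdHilbert R) (f g : R[i] -> E) :
  H2 E f -> H2 E g -> eqT f g -> eqT (bs f) (bs g).
Proof.
move=> hf hg e; have e0 := at0_ae (H2L2 hf) (H2L2 hg) e.
by apply: aeT_sub e => t h; rewrite /bs h e0.
Qed.

(** * Ranges of inner functions *)

Section OrthDecomp.
Variables (R : realType) (E : fdHilbert R).
Notation C := R[i].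
Implicit Types (V : {vspace (fdH_vect E)}).

(** A bridge from subspaces given as sets, whose orthonormal bases come from [max_onb], to vector
    spaces with a [\dim]. *)
Lemma subsp_vspace (S : set E) : @subsp R (fdPH E) S ->
  exists k (w : 'I_k -> E) V, [/\ @onf R (fdPH E) k w, (forall i, S (w i)),
    (forall x, S x -> x = \sum_i ip x (w i) *: w i) & (forall x, x \in V <-> S x)].
Proof.
move=> sS.
have bound k (w : 'I_k -> ph_sort (fdPH E)) : @onf R (fdPH E) k w -> (forall i, S (w i)) -> (k <= edim E)%N.
  move=> ow _; apply: (@onf_bound R (fdPH E) k _ w (@eb R E) (\matrix_(i, j) ip (w i : E) (eb j))) => // i.
  rewrite [X in pheq X _](eb_exp (w i : E)).
  have -> : \sum_j (\matrix_(i, j) ip (w i : E) (eb j)) i j *: (eb j : ph_sort (fdPH E)) =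
    \sum_j ip (w i : E) (eb j) *: eb j by apply: eq_bigr => j _; rewrite mxE.
  exact: pheq_refl.
have [k [w [ow Sw sw]]] := max_onb sS bound.
have exp x : S x -> x = \sum_i ip x (w i : E) *: (w i : E).
  by move=> Sx; apply: fdpheq; exact: sw.
(* The span of w is the image of the map with columns w, obtained here from constant functions
   evaluated at 0. *)
exists k, w, (limg (colsym (fun i (_ : C) => w i : E) 0)); split=> // x; split.
  move=> /memv_imgP[u _ ->]; rewrite colsymE.
  exact: (@subsp_lc R (fdPH E) S sS).
move=> Sx; apply/memv_imgP; exists (\row_i ip x (w i : E)); first exact: memvf.
by rewrite colsymE {1}(exp x Sx); apply: eq_bigr => i _; rewrite mxE.
Qed.

Lemma vspace_subsp V : @subsp R (fdPH E) [set x | x \in V].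
Proof.
by split=> //= [|c x y hx hy]; [exact: mem0v|rewrite memvD // memvZ].
Qed.

Lemma orth_complement V : exists V', orth_decomp V' V /\
  forall u, (forall v, v \in V -> ip u v = 0) -> u \in V'.
Proof.
have sS : @subsp R (fdPH E) [set u : E | forall v, v \in V -> ip u v = 0].
  split=> //= [v _|c x y hx hy v hv]; first by rewrite ip0l.
  by rewrite ip_lin hx // hy // mulr0 addr0.
have [_ [_ [V' [_ _ _ hV']]]] := subsp_vspace sS.
exists V'; split; last by move=> u hu; apply/hV'.
split; last by move=> u v /hV' hu /hu.
have [k [w [_ [ow Vw sw _]]]] := subsp_vspace (vspace_subsp V).
apply/vspaceP => e; rewrite memvf; apply/memv_addP.
pose p : E := @onproj R (fdPH E) k w e.
exists (e - p); last first.
  exists p; last by rewrite subrK.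
  by apply: memv_suml => i _; rewrite memvZ //; exact: Vw.
apply/hV' => v hv; rewrite (sw v hv).
exact: (@onproj_orth_lc R (fdPH E) k w e (fun i => ip v (w i)) ow I).
Qed.

Lemma orth_decomp_dim (V W : {vspace (fdH_vect E)}) : orth_decomp V W ->
  (\dim V + \dim W)%N = \dim {:E} /\ forall u, u \in V -> u \in W -> u = 0.
Proof.
move=> [vw ow].
have z u : u \in V -> u \in W -> u = 0 by move=> hu hv; apply: ip_eq0; exact: ow.
split=> //; rewrite -vw dimv_disjoint_sum //.
apply/eqP; rewrite -subv0; apply/subvP => u; rewrite memv_cap => /andP[h1 h2].
by rewrite (z u h1 h2) mem0v.
Qed.
End OrthDecomp.

Section ConstantDirections.
Variables (R : realType) (E F : fdHilbert R) (Theta : R[i] -> 'Hom(fdH_vect E, fdH_vect F)).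
Notation C := R[i].
Hypothesis hT : inner_fun Theta.

Definition col e : C -> F := app Theta (cst1 e).
Lemma col_H2 e : H2 F (col e).
Proof. by apply: inner_app_H2 => //; exact: cst_H2. Qed.
Lemma col_lin c e f : col (c *: e + f) = c *: col e + col f.
Proof. by apply/funext => z; rewrite /col /app /cst1 !fctE linearP. Qed.

Lemma eqT_bs0 (f : C -> F) : eqT (bs f) 0 <-> eqT f (cst1 (at0 f)).
Proof.
split; apply: aeT_sub => t h; first by rewrite (bs_eq f t) h scaler0 addr0.
by rewrite /bs h /cst1 subrr scaler0.
Qed.

(* The domain E'' of the unitary part. *)
Definition constdir : set E := [set e | eqT (bs (col e)) 0].
Lemma constdir_subsp : @subsp R (fdPH E) constdir.
Proof.
split=> //= [|c x y hx hy].
  apply/eqT_bs0.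
  by rewrite /col app_cst0 at0_cst; exact: eqT_refl.
rewrite /constdir /= col_lin bs_lin; [|exact: col_H2..].
apply: aeT_sub (aeT_and hx hy) => t [a b].
by rewrite !fctE a b scaler0 addr0.
Qed.

Lemma col_nrm2 e : nrm2 (col e : ph_sort (H2PH F)) = hnorm e ^+ 2.
Proof.
rewrite inner_nrm2; [|by []|exact: cst_H2].
by rewrite -[LHS]/(cRe (ip2 _ _)) ip2_cst ?at0_cst ?hnorm2 //; exact: H2L2 (cst_H2 _).
Qed.

(** Theta is isometric, so |e|^2 splits into |Theta(0) e|^2 and the square norm of S^* Theta e. A
    strict contraction at 0 thus means that Theta e is not constant. *)
Lemma const_norm e : hnorm (at0 (col e)) ^+ 2 + nrm2 (bs (col e) : ph_sort (H2PH F)) = hnorm e ^+ 2.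
Proof. by rewrite -bs_nrm2 ?col_nrm2 //; exact: col_H2. Qed.

Lemma pure_unitary_exists : exists E' E'' F' F'' U, pure_unitary_decomp Theta E' E'' F' F'' U.
Proof.
have [k [w [E'' [_ _ _ hE]]]] := subsp_vspace constdir_subsp.
have [E' [dE cE]] := orth_complement E''.
pose f0 (e : fdH_vect E) : fdH_vect F := at0 (col e).
have lin0 : linear f0.
  by move=> c x y; rewrite /f0 col_lin at0_lin //; apply: H2L2; exact: col_H2.
pose U : 'Hom(fdH_vect E, fdH_vect F) := linfun (HB.pack_for {linear fdH_vect E -> fdH_vect F} f0
    (GRing.isLinear.Build _ _ _ _ f0 lin0)).
have UE e : U e = at0 (col e) by rewrite /U lfunE.
clearbody U.
(* Each v comes with its own null set; a basis of E'' reduces them to finitely many. *)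
have aeU : aeT (fun z => forall v, v \in E'' -> Theta z v = U v).
  have : aeT (fun z => forall i : 'I_(\dim E''), Theta z (vbasis E'')`_i = U (vbasis E'')`_i).
    apply: aeT_all => i.
    have : (vbasis E'')`_i \in E'' by apply: vbasis_mem; rewrite mem_nth // size_tuple.
    move=> /hE /eqT_bs0; apply: aeT_sub => t; rewrite UE => h.
    exact: h.
  apply: aeT_sub => t h v hv; rewrite (coord_vbasis hv) !linear_sum.
  by apply: eq_bigr => i _; rewrite !linearZ /= h.
have iU u v : u \in E'' -> v \in E'' -> ip (U u) (U v) = ip u v.
  move=> hu hv; have [t [h1 h2]] := aeT_ex (aeT_and aeU (inner_iso hT)).
  by rewrite -(h1 u hu) -(h1 v hv) h2.
have [F' [dF cF]] := orth_complement (U @: E'')%VS.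
exists E', E'', F', (U @: E'')%VS, U; split=> //; split.
  (* Theta z is isometric and equals U on E'', so it sends E' into the complement of U E''. *)
  apply: aeT_sub (aeT_and aeU (inner_iso hT)) => t [h1 h2].
  apply/subvP => _ /memv_imgP[e he ->]; apply: cF => _ /memv_imgP[v hv ->].
  by rewrite -(h1 v hv) h2; have [_ ->] := dE.
move=> e he e0; rewrite -(@ltr_pXn2r _ 2) ?nnegrE ?hnorm_ge0 //.
rewrite -const_norm -[ltLHS]/(hnorm (at0 (col e)) ^+ 2) ltrDl lt0r.
have hb := bs_H2 (col_H2 e).
rewrite (@nrm2_ge0 R (H2PH F)) // andbT; apply: contra e0 => /eqP n0; apply/eqP.
have [_ z] := orth_decomp_dim dE; apply: z => //; apply/hE.
by apply/(pheq_eqT hb (@H2_0 R F)); apply/pheq0.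
Qed.

Definition colshift : set (C -> F) :=
  [set x | H2 F x /\ exists e, eqT x (bs (col e))].

(** The map e |-> S^* Theta e vanishes on E'' and is injective on E' by purity and [const_norm], so
    its range has the dimension of E'. *)
Lemma decomp_dim E' E'' F' F'' U : pure_unitary_decomp Theta E' E'' F' F'' U ->
  has_dim colshift (\dim {:E} - \dim E'')%N.
Proof.
move=> [dE _ [_ pE] aeU _]; have [<- zE] := orth_decomp_dim dE; rewrite addnK.
have const e : e \in E'' -> eqT (bs (col e)) 0.
  move=> he; apply/eqT_bs0.
  have ce : eqT (col e) (cst1 (U e)) by apply: aeT_sub aeU => t; exact.
  rewrite (at0_ae (H2L2 (col_H2 e)) (H2L2 (cst_H2 (U e))) ce) at0_cst; exact: ce.
pose b (i : 'I_(\dim E')) := (vbasis E')`_i.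
have bE i : b i \in E' by apply: vbasis_mem; rewrite mem_nth // size_tuple.
have hb i : H2 F (bs (col (b i))) := bs_H2 (col_H2 (b i)).
have bs_sum (c : 'I_(\dim E') -> C) : bs (col (\sum_i c i *: b i)) = \sum_i c i *: bs (col (b i)).
  suff : forall r : seq 'I_(\dim E'), bs (col (\sum_(i <- r) c i *: b i)) = \sum_(i <- r) c i *: bs (col (b i)).
    exact.
  elim=> [|i r IH]; last by rewrite !big_cons col_lin bs_lin ?IH //; exact: col_H2.
  by rewrite !big_nil /col app_cst0 bs_cst.
exists (fun i => bs (col (b i))); split=> //.
  move=> c; rewrite -bs_sum; set e := \sum_i _ => h.
  have eE : e \in E' by apply: memv_suml => i _; rewrite memvZ.
  have e0 : e = 0.
    apply/eqP; apply/negPn/negP => e0; have := pE e eE e0.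
    rewrite -(@ltr_pXn2r _ 2) ?nnegrE ?hnorm_ge0 // -(const_norm e).
    have hbe := bs_H2 (col_H2 e).
    rewrite (_ : nrm2 _ = 0) ?addr0 ?ltxx //.
    by apply/pheq0; apply/(pheq_eqT hbe (@H2_0 R F)).
  have /freeP := basis_free (vbasisP E'); exact.
apply/seteqP; split=> x [hx].
  move=> [e ee]; split=> //.
  have : e \in (E' + E'')%VS by have [-> _] := dE; exact: memvf.
  move=> /memv_addP[u hu [v hv euv]].
  exists (fun i => coord (vbasis E') i u); rewrite -bs_sum -(coord_vbasis hu).
  apply: eqT_trans ee _; rewrite euv.
  have -> : u + v = 1 *: u + v by rewrite scale1r.
  rewrite col_lin bs_lin; [|exact: col_H2..].
  by apply: aeT_sub (const v hv) => t h; rewrite !fctE h scale1r addr0.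
by move=> [c ec]; split=> //; exists (\sum_i c i *: b i); rewrite bs_sum.
Qed.

(** Every decomposition computes the dimension of the same space, so the choice inside
    [unitary_rank] is harmless; [pure_unitary_exists] rules out its default value. *)
Lemma unitary_rankP : has_dim colshift (\dim {:E} - unitary_rank Theta)%N.
Proof.
rewrite /unitary_rank; case: xgetP => [r _ [E' [E'' [F' [F'' [U [h ->]]]]]]|h].
  exact: decomp_dim h.
have [E' [E'' [F' [F'' [U hd]]]]] := pure_unitary_exists.
by case: (h (\dim E'')); exists E', E'', F', F'', U.
Qed.

Lemma app_split h : H2 E h -> eqT (bs (app Theta h)) (bs (col (at0 h)) + app Theta (bs h)).
Proof.
move=> hh; have hb := bs_H2 hh; have ha := inner_app_H2 hT hb.
have e : eqT (app Theta h) (1 *: col (at0 h) + zX 1 (app Theta (bs h))).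
  apply: aeTW => t; rewrite /col /app !fctE /zX scale1r /cst1 -linearZ -linearD expr1.
  by rewrite {1}(bs_eq h t).
have hz := zX_H2 1 ha; have hc := col_H2 (at0 h).
apply: eqT_trans (bs_eqT _ _ e) _; [exact: inner_app_H2|exact: H2_lin|].
rewrite bs_lin //; apply: aeT_sub (bs_zX ha) => t h0.
by rewrite !fctE h0 scale1r.
Qed.

(** Moving S^* to the other side gives <Theta e, Theta z h> = <e, z h>, and constants are orthogonal
    to z H^2. The candidate defect space thus meets M trivially. *)
Lemma col_orth e h : H2 E h -> ip2 (bs (col e)) (app Theta h) = 0.
Proof.
move=> hh; have hc := cst_H2 e; have ha := inner_app_H2 hT hh; rewrite bs_adj //; last exact: col_H2.
rewrite -app_zX.
rewrite inner_ip2 //; last exact: zX_H2.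
rewrite -bs_adj //.
rewrite bs_cst.
by rewrite ip20l.
Qed.

Lemma inner_range_repE M : inner_range_rep M Theta -> M = inner_range Theta.
Proof.
move=> [_ ->]; apply/seteqP; split=> x [hx [h hh e]]; split=> //; exists h => //.
  by apply: eqT_trans e _; have [] := inner_toeplitz hT hh.
by apply: eqT_trans e _; apply: eqT_sym; have [] := inner_toeplitz hT hh.
Qed.

Lemma inner_range_defect M : closed_subspace M -> inner_range_rep M Theta ->
  almost_invariant (bshift F) M /\ defect (bshift F) M = (\dim {:E} - unitary_rank Theta)%N.
Proof.
move=> cM /inner_range_repE eM.
have hd := unitary_rankP.
have ds : defect_space (bshift F) M colshift.
  split; first by exists (\dim {:E} - unitary_rank Theta)%N.
  move=> f; rewrite eM => -[hf [h hh e]].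
  have hb := bs_H2 hh; have ha := inner_app_H2 hT hb.
  exists (app Theta (bs h)), (bs (col (at0 h))); split.
  - by split=> //; exists (bs h) => //; exact: eqT_refl.
  - by split; [exact: bs_H2 (col_H2 _)|exists (at0 h); exact: eqT_refl].
  - have [_ eb] := bshiftP hf; apply: eqT_trans eb _.
    apply: eqT_trans (bs_eqT hf (inner_app_H2 hT hh) e) _.
    by rewrite addrC; exact: app_split.
split; first by exists colshift.
have [x [hx [e ee]]|x [hx [e ee]]|_ ->//] := minimal_defect cM hd ds.
- rewrite eM => -[_ [h hh eh]]; apply: ip2_eq0 => //.
  have ha := inner_app_H2 hT hh; have hb := bs_H2 (col_H2 e).
  by rewrite (ip2_eqTl hx hb hx ee) (ip2_eqTr hx ha hb eh) col_orth.
- have hc := col_H2 e; exists (col e), 0; split.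
  + by rewrite eM; split=> //; exists (cst1 e); [exact: cst_H2|exact: eqT_refl].
  + by case: cM.
  + rewrite subr0; apply: eqT_trans ee _; apply: eqT_sym.
    by have [] := bshiftP hc.
Qed.
End ConstantDirections.

(** * Ranges of compressed multiplication operators *)

Lemma rint_le_ae (R : realType) (u v : R -> R) : measurable_fun (`[0, 1] : set R) u -> rint v ->
  aeD (fun t => 0 <= u t <= v t) -> rint u.
Proof.
move=> mu rv h; pose w t := Num.max 0 (Num.min (u t) (v t)).
have rw : rint w.
  apply: (@rint_le _ w (fun t => `|v t|)); last 2 first.
  - exact: rint_abs.
  - move=> t _; rewrite ger0_norm ?le_max ?lexx // ge_max normr_ge0 /=.
    by rewrite ge_min (ler_norm (v t)) orbT.
  apply: measurable_maxr; first exact: measurable_cst.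
  by apply: measurable_minr => //; exact: rint_meas.
apply: (rint_ae mu _ rw).
by apply: aeD_sub h => t _ /andP[h0 h1]; rewrite /w min_l // max_r.
Qed.

Section BoundedArgument.
Variables (R : realType) (E F : fdHilbert R).
Notation C := R[i].
Variable Phi : C -> 'Hom(fdH_vect E, fdH_vect F).
Hypothesis hPhi : opH2 Phi.

(** Boundedness of k is what makes Phi k square-integrable. It holds for constants and, through
    [adj_poly], for model projections of polynomials. *)
Lemma app_bounded k (B : R) : H2 E k -> aeT (fun z => hnorm (k z) <= B) -> H2 F (app Phi k).
Proof.
move=> hk hB; apply: app_H2 => //; apply/L2P => i.
apply: (@cL2_ext _ (fun z => \sum_j fc k j z * ip (Phi z (eb j)) (eb i))).
  by move=> t; rewrite -ip_app.
apply: cL2_sum => j; have /L2P/(_ j) [mk _] := H2L2 hk.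
have [mg rg] := symb_cL2 hPhi (eb j) (eb i).
have mp := measTM mk mg; split=> //.
pose b := B * hnorm (eb j : E).
apply: (@rint_le_ae _ _ (fun t => b ^+ 2 * cabs (ip (Phi (circ t) (eb j)) (eb i)) ^+ 2)).
- exact: (measurable_funX 2 (measT_cabs mp)).
- exact: rintZ.
move: hB; rewrite aeTE; apply: aeD_sub => t _ h; rewrite sqr_ge0 /=.
rewrite cabsM exprMn ler_wpM2r ?sqr_ge0 // lerXn2r ?nnegrE ?cabs_ge0 //.
  by rewrite mulr_ge0 ?hnorm_ge0 // (le_trans _ h) ?hnorm_ge0.
by apply: le_trans (cabs_ip_le _ _) _; rewrite ler_wpM2r ?hnorm_ge0.
Qed.

Lemma app_cst_H2 e : H2 F (app Phi (cst1 e)).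
Proof.
apply: (@app_bounded _ (hnorm e)); first exact: cst_H2.
by apply: aeTW => t; rewrite /cst1.
Qed.
End BoundedArgument.

(** * The model space, orthogonal to Theta H^2 *)

Section ModelSpace.
Variables (R : realType) (E E1 : fdHilbert R) (Theta : R[i] -> 'Hom(fdH_vect E, fdH_vect E1)).
Notation C := R[i].
Hypothesis hT : inner_fun Theta.

Definition model : set (C -> E1) :=
  [set k | H2 E1 k /\ forall h, H2 E h -> ip2 k (app Theta h) = 0].

Lemma model_subsp : @subsp R (H2PH E1) model.
Proof.
split=> [x []//||c x y [hx ox] [hy oy]].
  by split=> [|h hh]; [exact: H2_0|rewrite ip20l //; exact: inner_app_H2].
split=> [|h hh]; first exact: H2_lin.
have ha := inner_app_H2 hT hh.
by rewrite ip2_lin ?ox ?oy ?mulr0 ?addr0 //; exact: H2L2.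
Qed.
Lemma model_eqT f g : model f -> H2 E1 g -> eqT g f -> model g.
Proof.
move=> [hf of_] hg e; split=> // h hh; rewrite -(of_ h hh).
by apply: ip2_eqTl => //; exact: inner_app_H2.
Qed.
Lemma model_bs k : model k -> model (bs k).
Proof.
move=> [hk ok]; split=> [|h hh]; first exact: bs_H2.
have ha := inner_app_H2 hT hh; rewrite bs_adj //.
rewrite -app_zX.
by apply: ok; exact: zX_H2.
Qed.

Definition modelproj (h : C -> E1) := h - toeplitz Theta (adjH2 (toeplitz Theta) h).
Lemma modelprojP h : H2 E1 h -> model (modelproj h) /\
  exists g, [/\ H2 E g, eqT (adjH2 (toeplitz Theta) h) g & eqT (modelproj h) (h - app Theta g)].
Proof.
move=> hh; have [g hg og] := inner_proj hT hh.
have [h1 e1] := inner_adj hT hh hg og.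
have [h2 e2] := inner_toeplitz hT h1.
have ha := inner_app_H2 hT hg.
have e : eqT (modelproj h) (h - app Theta g).
  apply: aeT_sub (eqT_trans e2 (app_eqT Theta e1)) => t e.
  by rewrite /modelproj !fctE e.
split; last by exists g.
have m : model (h - app Theta g) by split=> //; exact: h2B.
by apply: model_eqT m _ e; exact: h2B.
Qed.

Lemma model_decomp h : H2 E1 h -> exists g, [/\ H2 E g, model (h - app Theta g) &
  eqT (modelproj h) (h - app Theta g)].
Proof.
move=> hh; have [hm [g [hg _ e]]] := modelprojP hh; exists g; split=> //.
by apply: model_eqT hm _ (eqT_sym e); apply: h2B => //; exact: inner_app_H2.
Qed.

Lemma modelproj_id k : model k -> eqT (modelproj k) k.
Proof.
move=> hk; have [hk2 ok] := hk; have [hm [g [hg _ e]]] := modelprojP hk2.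
have [hq oq] := hm; have ha := inner_app_H2 hT hg.
have hd : H2 E1 (modelproj k - k) := h2B hq hk2.
have : ip2 (modelproj k - k) (modelproj k - k) = 0.
  have md : model (modelproj k - k) := subspB model_subsp hm hk.
  rewrite -[RHS]oppr0 -(md.2 g hg) -[RHS]mulN1r.
  have -> : (-1 : C) = (-1)^* by rewrite rmorphN rmorph1.
  rewrite -ip2Zr //; apply: ip2_eqTr => //; first exact: h2Z.
  by apply: aeT_sub e => t h; rewrite !fctE h scaleN1r addrAC subrr add0r.
move=> /(ip2_eq0 hd); apply: aeT_sub => t; rewrite !fctE; exact: subr0_eq.
Qed.

Lemma modelproj_contr h h' : H2 E1 h -> H2 E1 h' ->
  @nrm R (H2PH E1) (modelproj h - modelproj h') <= @nrm R (H2PH E1) (h - h').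
Proof.
move=> hh hh'; have [hm [g [hg _ e]]] := modelprojP hh.
have [hm' [g' [hg' _ e']]] := modelprojP hh'.
set q := modelproj h - modelproj h'.
have mq : model q := subspB model_subsp hm hm'; have [hq oq] := mq.
have hgg := h2B hg hg'; have ha := inner_app_H2 hT hgg.
rewrite ler_sqrt; last exact: (@nrm2_ge0 R (H2PH E1) _ (h2B hh hh')).
have hs := h2D hq ha.
have -> : @nrm2 R (H2PH E1) (h - h') = @nrm2 R (H2PH E1) (q + app Theta (g - g')).
  apply: nrm2_eqT => //; first exact: h2B.
  have alg (x y u v : E1) : x - y = (x - u) - (y - v) + (u - v).
    by rewrite opprB -addrA [v - y + _]addrC addrA [x - u + _]addrA subrK addrA subrK.
  apply: aeT_sub (aeT_and e e') => t [a b]; rewrite /q appB !fctE a b !fctE.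
  exact: alg.
have d : @nrm2 R (H2PH E1) (q + app Theta (g - g')) = @nrm2 R (H2PH E1) q +
    @nrm2 R (H2PH E1) (app Theta (g - g')) + 2 * cRe (ip2 q (app Theta (g - g'))).
  exact: (@nrm2D R (H2PH E1)).
rewrite d oq // mulr0 addr0 lerDl.
exact: (@nrm2_ge0 R (H2PH E1)).
Qed.

(* T_Theta^* intertwines the backward shifts, which are nilpotent on polynomials.
   Hence the argument of Phi in [compressed_op] is bounded for polynomial h. *)
Lemma adj_poly n a g : H2 E g -> eqT (adjH2 (toeplitz Theta) (pl n a)) g ->
  exists b, eqT g (pl n b).
Proof.
move=> hg e; exists (fun i => at0 (iter i (@bs R E) g)).
have hp := pl_H2 n a; have [hm [g' [hg' e1 e2]]] := modelprojP hp.
have egg : eqT g g' by apply: eqT_trans (eqT_sym e) e1.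
have adj h : H2 E h -> ip2 g h = ip2 (pl n a) (app Theta h).
  move=> hh; have ha := inner_app_H2 hT hh; have ha' := inner_app_H2 hT hg'.
  rewrite (ip2_eqTl hg hg' hh egg) -(inner_ip2 hT hg' hh).
  have hd := h2B hp ha'.
  apply/esym/eqP; rewrite -subr_eq0 -ip2Bl // -(hm.2 h hh); apply/eqP.
  by apply: ip2_eqTl => //; [exact: hm.1|exact: eqT_sym].
have hb m (K : fdHilbert R) (f : C -> K) : H2 K f -> H2 K (iter m (@bs R K) f) by exact: bs_pheq_iter.
have adjn (K : fdHilbert R) m (f u : C -> K) : H2 K f -> H2 K u -> ip2 (iter m (@bs R K) f) u = ip2 f (zX m u).
  elim: m u => [|m IH] u hf hu; first by rewrite zX0.
  rewrite /= bs_adj //; last exact: hb.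
  rewrite IH //; last exact: zX_H2.
  by congr ip2; apply/funext => z; rewrite /zX expr1 scalerA -exprSr.
have z : eqT (iter n (@bs R E) g) 0.
  apply: ip2_eq0; first exact: hb.
  rewrite adjn //; last exact: hb.
  have hbg := hb n _ _ hg.
  rewrite adj; last exact: zX_H2.
  rewrite app_zX.
  have ha := inner_app_H2 hT hbg.
  rewrite -adjn // -[RHS](ip20l ha); apply: ip2_eqTl => //; [exact: hb|exact: H2_0|exact: bs_iter_pl].
by apply: aeT_sub z => t h; rewrite {1}(taylor n t hg) h scaler0 addr0.
Qed.
End ModelSpace.

(** * Range and defect of the bounded extension *)

Section CompressedRange.
Variables (R : realType) (E E1 F : fdHilbert R).
Notation C := R[i].
Variable Theta : C -> 'Hom(fdH_vect E, fdH_vect E1).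
Variable Phi : C -> 'Hom(fdH_vect E1, fdH_vect F).
Hypotheses (hT : inner_fun Theta) (hPhi : opH2 Phi).
Variable A : (C -> E1) -> (C -> F).
Hypothesis hA : bounded_extension A (compressed_op Theta Phi).

Lemma ext_H2 h : H2 E1 h -> H2 F (A h).
Proof. by have [[h0 _ _] _] := hA; exact: h0. Qed.

Lemma ext_poly n a : eqT (A (pl n a)) (app Phi (modelproj Theta (pl n a))).
Proof.
have [_ hp] := hA; have hpl := pl_H2 n a.
apply: eqT_trans (hp _ (pl_poly n a)) _.
have [[hq _] [g [hg e1 e2]]] := modelprojP hT hpl.
have [b eb] := adj_poly hT hg e1.
have H : H2 F (app Phi (modelproj Theta (pl n a))).
  (* On the circle a polynomial is bounded by the sum of the norms of its coefficients, and |Theta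
     g| = |g| with g a polynomial by [adj_poly]. *)
  pose B := \sum_(i < n) hnorm (a i) + \sum_(i < n) hnorm (b i).
  apply: (@app_bounded _ _ _ _ hPhi _ B hq).
  have pb (K : fdHilbert R) (c : nat -> K) t : hnorm (pl n c (circ t)) <= \sum_(i < n) hnorm (c i).
    rewrite plE; elim/big_rec2: _ => [|i x y _ h].
      by rewrite hnorm_nrm /nrm (@nrm20 R (fdPH K)) sqrtr0.
    rewrite hnorm_nrm; apply: le_trans (@nrmD R (fdPH K) _ _ I I) _.
    apply: lerD => //; rewrite /nrm (@nrm2Z R (fdPH K)) //.
    by rewrite cabs_exp cabs_circ expr1n expr1n mul1r.
  apply: aeT_sub (aeT_and e2 (aeT_and eb (inner_iso hT))) => t [-> [h1 h2]].
  rewrite !fctE hnorm_nrm; apply: le_trans (@nrmD R (fdPH E1) _ _ I I) _.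
  apply: lerD; first exact: pb.
  rewrite (@nrmN R (fdPH E1)) // -hnorm_nrm /hnorm /app h2 -/(hnorm _) h1.
  exact: pb.
by have [] := toeplitzP hq H.
Qed.

(** Both sides are limits along polynomials: A is bounded, the model projection is a contraction,
    and multiplication by Phi is closed by [app_limit]. *)
Lemma extE h : H2 E1 h -> eqT (A h) (app Phi (modelproj Theta h)).
Proof.
move=> hh; have [[_ lin [K bK]] _] := hA.
have e0 n : (0 : R) < n.+1%:R^-1 by rewrite invr_gt0 ltr0Sn.
have /choice[p hp] n : exists p : C -> E1, (exists m a, p = pl m a) /\
  @nrm R (H2PH E1) (h - p) < n.+1%:R^-1.
  by have [m [a ha]] := poly_dense hh (e0 n); exists (pl m a); split=> //; exists m, a.
have hpH n : H2 E1 (p n) by have [[m [a ->]] _] := hp n; exact: pl_H2.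
have small e : 0 < e -> exists N, forall n, (N <= n)%N -> @nrm R (H2PH E1) (p n - h) < e.
  move=> ep; exists (Num.truncn e^-1) => n hn; have [_ h1] := hp n.
  rewrite (@nrmBsym R (H2PH E1) _ _ (hpH n) hh); apply: lt_trans h1 _.
  rewrite invf_plt ?posrE ?ltr0Sn //; apply: lt_le_trans (truncnS_gt _) _.
  by rewrite ler_nat.
have mqH g : H2 E1 g -> H2 E1 (modelproj Theta g) by move=> /(modelprojP hT) [[]].
apply: (@app_limit _ _ _ _ hPhi _ _ (fun n => A (p n)) (fun n => modelproj Theta (p n))).
- exact: ext_H2.
- exact: mqH.
- by move=> n; exact: ext_H2.
- by move=> n; exact: mqH.
- by move=> n; have [[m [a ->]] _] := hp n; exact: ext_poly.
- move=> e ep; pose K' := `|K| + 1; have K0 : 0 < K' by rewrite ltr_wpDl.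
  have [N hN] := small (e / K') (divr_gt0 ep K0).
  exists N => n Nn; have := hN n Nn; rewrite ltr_pdivlMr // => h1.
  apply: le_lt_trans h1.
  have hd := h2B (hpH n) hh.
  apply: (@le_trans _ _ (@nrm R (H2PH F) (A (p n - h)))).
    have e1 : eqT (A (p n - h)) (A (p n) - A h).
      have -> : p n - h = (-1) *: h + p n by rewrite scaleN1r addrC.
      by apply: eqT_trans (lin _ _ _ hh (hpH n)) _; rewrite scaleN1r addrC; exact: eqT_refl.
    rewrite /nrm (@nrm2_eqT _ _ _ (A (p n) - A h) _ _ e1) //; first exact: ext_H2.
    by apply: h2B; exact: ext_H2.
  apply: le_trans (bK _ hd) _; rewrite norm2E mulrC ler_wpM2l ?nrm_ge0 //.
  by rewrite /K' (le_trans (ler_norm _)) // lerDl.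
- move=> e ep; have [N hN] := small e ep; exists N => n Nn.
  exact: le_lt_trans (modelproj_contr hT (hpH n) hh) (hN n Nn).
Qed.

Lemma ext_model k : model Theta k -> eqT (A k) (app Phi k).
Proof.
move=> hk; apply: eqT_trans (extE hk.1) _; apply: app_eqT; exact: modelproj_id.
Qed.

Lemma ext_range f : rangeH2 A f <-> H2 F f /\ exists2 k, model Theta k & eqT f (app Phi k).
Proof.
split=> [[hf [h hh e]]|[hf [k hk e]]]; split=> //.
  exists (modelproj Theta h); first by have [] := modelprojP hT hh.
  by apply: eqT_trans e _; exact: extE.
exists k; first exact: hk.1.
by apply: eqT_trans e _; apply: eqT_sym; exact: ext_model.
Qed.

Definition symshift : set (C -> F) :=
  [set x | H2 F x /\ exists e, eqT x (bs (app Phi (cst1 e)))].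

Lemma symshiftE :
  rangeH2 (fun h => bshift F (toeplitz Phi (projConst h))) = symshift.
Proof.
have key h : H2 E1 h -> eqT (bshift F (toeplitz Phi (projConst h))) (bs (app Phi (cst1 (at0 h)))).
  move=> hh; have [hp ep] := projConstP hh.
  have hc := app_cst_H2 hPhi (at0 h).
  have h1 : H2 F (app Phi (projConst h)).
    apply: (@app_bounded _ _ _ _ hPhi _ (hnorm (at0 h)) hp).
    by apply: aeT_sub ep => t ->.
  have [h2 e2] := toeplitzP hp h1.
  have [h3 e3] := bshiftP h2; apply: eqT_trans e3 _; apply: bs_eqT => //.
  by apply: eqT_trans e2 _; exact: app_eqT.
apply/seteqP; split=> x [hx].
  move=> [h hh e]; split=> //; exists (at0 h).
  by apply: eqT_trans e _; exact: key.
move=> [e ee]; split=> //; exists (cst1 e); first exact: cst_H2.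
apply: eqT_trans ee _; apply: eqT_sym; rewrite -{2}(at0_cst e); apply: key; exact: cst_H2.
Qed.

Lemma symshift_eqT f g : symshift f -> H2 F g -> eqT g f -> symshift g.
Proof. by move=> [_ [e ee]] hg eg; split=> //; exists e; exact: eqT_trans ee. Qed.

Lemma symcol_lin c u v : bs (app Phi (cst1 (c *: u + v))) =
  c *: bs (app Phi (cst1 u)) + bs (app Phi (cst1 v)).
Proof.
rewrite -bs_lin; [|exact: app_cst_H2..]; congr bs.
by apply/funext => z; rewrite /app /cst1 !fctE linearP.
Qed.

Lemma symshift_subsp : @subsp R (H2PH F) symshift.
Proof.
split=> [x []//||c x y [hx [u eu]] [hy [v ev]]].
  split; first exact: H2_0.
  by exists 0; rewrite app_cst0 bs_cst; exact: eqT_refl.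
split; first exact: H2_lin.
by exists (c *: u + v); rewrite symcol_lin; exact: eqT_lin.
Qed.

Lemma symshift_span x : symshift x ->
  exists a : 'I_(edim E1) -> C, eqT x (\sum_i a i *: bs (app Phi (cst1 (eb i)))).
Proof.
move=> [hx [e ee]]; exists (fun i => ip e (eb i)).
have sum (r : seq 'I_(edim E1)) (a : 'I_(edim E1) -> C) :
  bs (app Phi (cst1 (\sum_(i <- r) a i *: eb i))) = \sum_(i <- r) a i *: bs (app Phi (cst1 (eb i))).
  elim: r => [|i r IH]; last by rewrite !big_cons symcol_lin IH.
  by rewrite !big_nil app_cst0 bs_cst.
by rewrite -sum -eb_exp.
Qed.

(** Phi times an H^2 function may fail to be in L^2. For S^* k it is, because S^* k is again in the
    model space, where Phi acts as A. *)
Lemma ext_split k : model Theta k -> H2 F (app Phi (bs k)) /\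
  eqT (bs (A k)) (bs (app Phi (cst1 (at0 k))) + app Phi (bs k)).
Proof.
move=> hk; have hb := model_bs hT hk.
have eA := ext_model hb; have hAb := ext_H2 hb.1.
have hL : H2 F (app Phi (bs k)).
  apply: app_H2 => //; first exact: hb.1.
  apply: (L2_ae _ eA (H2L2 hAb)) => v; apply: app_meas => //; exact: H2L2 hb.1.
split=> //.
have hc := app_cst_H2 hPhi (at0 k); have hz := zX_H2 1 hL.
have e : eqT (A k) (1 *: app Phi (cst1 (at0 k)) + zX 1 (app Phi (bs k))).
  apply: aeT_sub (ext_model hk) => t ->.
  rewrite /app !fctE /zX scale1r /cst1 -linearZ -linearD expr1.
  by rewrite {1}(bs_eq k t).
apply: eqT_trans (bs_eqT (ext_H2 hk.1) (H2_lin _ hc hz) e) _.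
rewrite bs_lin //; apply: aeT_sub (bs_zX hL) => t h0.
by rewrite !fctE h0 scale1r.
Qed.

(** If v = Theta h, then 0 = S^* v is the sum of the orthogonal terms S^* Theta h(0) and Theta S^*
    h, so both vanish. Hence v = Theta h(0) is constant and |Theta(0) h(0)| = |h(0)|, which purity
    allows only for h(0) = 0. *)
Lemma pure_col v : pure_fun Theta -> inner_range Theta (cst1 v) -> v = 0.
Proof.
move=> pT [_ [h hh e]]; have hb := bs_H2 hh.
have z : eqT (bs (col Theta (at0 h)) + app Theta (bs h)) 0.
  apply: eqT_trans (eqT_sym (app_split hT hh)) _.
  apply: eqT_trans (bs_eqT (inner_app_H2 hT hh) (cst_H2 v) (eqT_sym e)) _.
  by rewrite bs_cst; exact: eqT_refl.
have hc := col_H2 hT (at0 h); have hbc := bs_H2 hc; have ha := inner_app_H2 hT hb.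
have b0 : eqT (bs (col Theta (at0 h))) 0.
  apply: ip2_eq0 => //.
  transitivity (ip2 (bs (col Theta (at0 h)) + app Theta (bs h)) (bs (col Theta (at0 h)))).
    by rewrite ip2Dl // (ip2C' hbc ha) col_orth // rmorph0 addr0.
  rewrite -[RHS](ip20l hbc).
  by apply: ip2_eqTl => //; [exact: h2D|exact: H2_0].
have a0 : eqT (app Theta (bs h)) 0.
  by apply: aeT_sub (aeT_and z b0) => t [h1 h2]; move: h1; rewrite !fctE h2 add0r.
have h0 : eqT (bs h) 0.
  apply/(pheq_eqT hb (@H2_0 R E))/pheq0; rewrite -(inner_nrm2 hT hb).
  by apply/pheq0/(pheq_eqT ha (@H2_0 R E1)).
have ec : eqT (cst1 v) (col Theta (at0 h)).
  apply: eqT_trans e _; apply: app_eqT; exact/eqT_bs0.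
have hv := cst_H2 v.
have ev : v = at0 (col Theta (at0 h)) by rewrite -(at0_ae (H2L2 hv) (H2L2 hc) ec) at0_cst.
case: (eqVneq (at0 h) 0) => [e0|n0].
  by rewrite ev e0 /col app_cst0 at0_cst.
have := pT _ (memvf _) n0; rewrite -[X in hnorm X]/(at0 (col Theta (at0 h))) => lt.
have := const_norm hT (at0 h); have /pheq0 -> : @pheq R (H2PH E1) (bs (col Theta (at0 h))) 0.
  by apply/pheq_eqT => //; exact: H2_0.
rewrite addr0 => /eqP; rewrite eqrXn2 ?hnorm_ge0 // => /eqP h1.
by rewrite h1 ltxx in lt.
Qed.

(** A vector v orthogonal to all values at 0 is, as a constant function, orthogonal to the model
    space. It then lies in Theta H^2 and is 0 by [pure_col]. *)
Lemma model_at0 e : pure_fun Theta -> exists2 k, model Theta k & at0 k = e.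
Proof.
move=> pT.
have sS : @subsp R (fdPH E1) [set e : E1 | exists2 k, model Theta k & at0 k = e].
  split=> //= [|c x y [k hk <-] [l hl <-]].
    exists 0; first exact: subsp0 (model_subsp hT).
    by rewrite -[0 : C -> E1]/(cst1 (0 : E1)) at0_cst.
  exists (c *: k + l); first exact: (subspL (model_subsp hT)).
  by rewrite at0_lin //; apply: H2L2; [case: hk|case: hl].
have [_ [_ [V [_ _ _ hV]]]] := subsp_vspace sS.
have [V' [dV _]] := orth_complement V.
suff V0 v : v \in V' -> v = 0.
  have : e \in (V' + V)%VS by have [-> _] := dV; exact: memvf.
  by move=> /memv_addP[u /V0 -> [w /hV hw ->]]; rewrite add0r.
move=> hv; apply: pure_col => //.
have hc := cst_H2 v; have [g [hg mg _]] := model_decomp hT hc.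
split=> //; exists g => //; have [hm om] := mg; have ha := inner_app_H2 hT hg.
have : ip2 (cst1 v - app Theta g) (cst1 v - app Theta g) = 0.
  rewrite ip2Br // om // subr0 ip2_cst; last exact: H2L2.
  have [_ o] := dV; rewrite ipC o ?rmorph0 //.
  by apply/hV; exists (cst1 v - app Theta g).
by move=> /(ip2_eq0 hm); apply: aeT_sub => t; rewrite !fctE; exact: subr0_eq.
Qed.

Lemma compressed_defect M : pure_fun Theta -> closed_subspace M -> M = rangeH2 A ->
  let W := ominus symshift (symshift `&` M) in
  [/\ almost_invariant (bshift F) M, minimal_defect_space (bshift F) M W &
      defect (bshift F) M = dimH2 W].
Proof.
move=> pT cM eM W; have [sM _] := closed_subspaceP cM.
have hv i : H2 F (bs (app Phi (cst1 (eb i)))) by apply: bs_H2; exact: app_cst_H2.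
pose Y := symshift `&` M.
have sY : @subsp R (H2PH F) Y.
  split=> [x [[]]//||c x y [x1 x2] [y1 y2]].
    by split; [exact: subsp0 symshift_subsp|exact: subsp0 sM].
  by split; [exact: (subspL symshift_subsp)|exact: (subspL sM)].
have YeqT f g : Y f -> H2 F g -> eqT g f -> Y g.
  by move=> [f1 f2] hg e; split; [exact: symshift_eqT e|exact: closed_subspace_eqT e].
have Yspan x : Y x -> exists a : 'I_(edim E1) -> C, eqT x (\sum_i a i *: bs (app Phi (cst1 (eb i)))).
  by move=> [+ _]; exact: symshift_span.
have sW : @subsp R (H2PH F) W.
  split=> [x [[]]//||c x y [x1 x2] [y1 y2]].
    split; first exact: subsp0 symshift_subsp.
    by move=> g [[hg _] _]; rewrite ip20l.
  split; first exact: (subspL symshift_subsp).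
  move=> g Yg; have [[hg _] _] := Yg; have [hx _] := x1; have [hy _] := y1.
  by rewrite ip2_lin ?x2 ?y2 ?mulr0 ?addr0 //; exact: H2L2.
have WeqT f g : W f -> H2 F g -> eqT g f -> W g.
  move=> [f1 f2] hg e; split; first exact: symshift_eqT e.
  by move=> h Yh; rewrite -(f2 h Yh); apply: ip2_eqTl => //; [case: f1|case: Yh => -[]].
have Wspan x : W x -> exists a : 'I_(edim E1) -> C, eqT x (\sum_i a i *: bs (app Phi (cst1 (eb i)))).
  by move=> [+ _]; exact: symshift_span.
have [d [w [hdY ow Yw spY]]] := has_dim_span hv sY YeqT Yspan.
have [k [_ [hdW _ _ _]]] := has_dim_span hv sW WeqT Wspan.
have ds : defect_space (bshift F) M W.
  split; first by exists k.
  move=> f Mf; move: (Mf); rewrite {1}eM => /ext_range[hf [q hq e]].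
  have [hL es] := ext_split hq.
  set x := bs (app Phi (cst1 (at0 q))) in es.
  have hx : H2 F x by apply: bs_H2; exact: app_cst_H2.
  have Xx : symshift x by split=> //; exists (at0 q); exact: eqT_refl.
  (* The component of S^* Phi q(0) in the intersection with M is absorbed into M; what remains is
     orthogonal to that intersection and lies in W. *)
  pose p : C -> F := @onproj R (H2PH F) d w x.
  have Yp : Y p by exact: (subsp_lc sY).
  have hp : H2 F p by case: Yp => -[].
  exists (app Phi (bs q) + p), (x - p); split.
  - apply: (subspD sM); last by case: Yp.
    rewrite eM; apply/ext_range; split=> //; exists (bs q); last exact: eqT_refl.
    exact: model_bs.
  - split; first by apply: (subspB symshift_subsp) => //; case: Yp.
    move=> g Yg; have hg : H2 F g by case: Yg => -[].
    have hd := h2B hx hp.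
    have hs : H2 F (@onproj R (H2PH F) d w g) by exact: (@onprojm R (H2PH F)).
    rewrite (@ip2_eqTr _ _ g (@onproj R (H2PH F) d w g)) //.
      exact: (@onproj_orth_lc R (H2PH F)).
    by apply/pheq_eqT => //; exact: spY.
  - have [_ eb] := bshiftP hf; apply: eqT_trans eb _.
    have hAq := ext_H2 hq.1.
    apply: eqT_trans (bs_eqT hf hAq _) _.
      by apply: eqT_trans e _; apply: eqT_sym; exact: ext_model.
    apply: eqT_trans es _; apply: aeTW => t; rewrite !fctE.
    by rewrite [RHS]addrC [_ + p _]addrC addrA subrK.
have [x [Xx ox] Mx|x [[hx [e ee]] ox]|md ed] := minimal_defect cM hdW ds.
- have hx : H2 F x by case: Xx.
  by apply: ip2_eq0 => //; exact: ox.
(* Minimality: the constant e is reached as q(0) for some q in the model space, and S^* A q - Phi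
   S^* q = S^* Phi e. *)
- have [q hq eq0] := model_at0 e pT; have [hL es] := ext_split hq.
  have hAq := ext_H2 hq.1.
  exists (A q), (app Phi (bs q)); split.
  + rewrite eM; split=> //; exists q; [exact: hq.1|exact: eqT_refl].
  + rewrite eM; apply/ext_range; split=> //; exists (bs q); last exact: eqT_refl.
    exact: model_bs.
  + apply: eqT_trans ee _; have [_ eb] := bshiftP hAq.
    apply: aeT_sub (aeT_and eb es) => t [h1 h2]; rewrite !fctE h1 h2 !fctE eq0.
    by rewrite addrK.
by split=> //; [exists W|rewrite ed (dimH2E hdW)].
Qed.
End CompressedRange.

(** * The model of an almost invariant subspace *)

Section PowerSeries.
Variables (R : realType) (E : fdHilbert R).
Notation C := R[i].
Notation H := (H2PH E).
Implicit Types (c : nat -> E).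

Lemma at0_pl n c : at0 (pl n.+1 c) = c 0%N.
Proof.
apply: eb_ext => i; have hp := pl_H2 n.+1 c.
rewrite -ip2_cst; last exact: H2L2.
have hm (j : nat) : H2 E (zX j (cst1 (c j))) := mono_H2 j (c j).
have hc := cst_H2 (eb i : E).
rewrite /pl [LHS](@dot_suml R H) //; last by move=> j; exact: hm.
rewrite (bigD1 ord0) //= big1 ?addr0 => [|[[//|j] hj] _].
  by rewrite zX0 -[LHS]/(ip2 _ _) ip2_cst ?at0_cst //; exact: H2L2 (cst_H2 _).
rewrite -[LHS]/(ip2 _ _) ip2_cst; last by apply: H2L2; exact: hm.
by rewrite at0_mono ip0l.
Qed.

Lemma pl_coef N n c : (n < N)%N -> at0 (iter n (@bs R E) (pl N c)) = c n.
Proof.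
elim: n N c => [|n IH] [//|N] c hn; first exact: at0_pl.
rewrite iterSr -[RHS](IH N (fun i => c i.+1)) //.
have hb := bs_H2 (pl_H2 N.+1 c); have hp := pl_H2 N (fun i => c i.+1).
apply: at0_ae; [exact: H2L2 (bs_pheq_iter n hb)|exact: H2L2 (bs_pheq_iter n hp)|].
exact: bs_iter_eqT (bs_pl N c).
Qed.

Lemma pl_nrm2 N c : @nrm2 R H (pl N c) = \sum_(i < N) hnorm (c i) ^+ 2.
Proof.
elim: N c => [|N IH] c; first by rewrite /pl !big_ord0 (@nrm20 R H).
have hp := pl_H2 N.+1 c; rewrite bs_nrm2 // at0_pl big_ord_recl; congr (_ + _).
rewrite -(IH (fun i => c i.+1)); apply: nrm2_eqT; [exact: bs_H2|exact: pl_H2|exact: bs_pl].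
Qed.

Lemma coef_ext f g : H2 E f -> H2 E g ->
  (forall n, at0 (iter n (@bs R E) f) = at0 (iter n (@bs R E) g)) -> eqT f g.
Proof. by move=> hf hg h; apply: H2_ext => // n v; rewrite !ip2_mono // h. Qed.

Lemma pl_cvg f : H2 E f -> @cvg_to R H (fun N => pl N (fun n => at0 (iter n (@bs R E) f))) f.
Proof.
move=> hf e e0; have [N hN] := bs_stable hf e0; exists N => n Nn.
have hb : H2 E (iter n (@bs R E) f) := bs_pheq_iter n hf; have hz := zX_H2 n hb.
set p := pl n _; have hp : H2 E p := pl_H2 _ _.
rewrite (@nrmBsym R H _ _ hp hf).
rewrite /nrm (@nrm2_eqT _ _ (f - p) (zX n (iter n (@bs R E) f))) //.
- have -> : @nrm2 R H (zX n (iter n (@bs R E) f)) = @nrm2 R H (iter n (@bs R E) f).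
    by rewrite -[LHS]/(cRe (ip2 _ _)) zX_iso //; exact: H2L2.
  exact: hN.
- exact: h2B.
- by apply: aeTW => t; rewrite !fctE {1}(taylor n t hf) addrC addKr.
Qed.

Lemma pl_diff_nrm2 m n c : (n <= m)%N -> @nrm2 R H (pl m c - pl n c) =
  \sum_(i < m) hnorm (c i) ^+ 2 - \sum_(i < n) hnorm (c i) ^+ 2.
Proof.
move=> nm; have -> : pl m c - pl n c = pl m (fun i => if (i < n)%N then 0 else c i).
  rewrite (pl_widen c nm); apply/funext => z; rewrite !fctE !plE -sumrB.
  by apply: eq_bigr => i _; case: ifP => _; rewrite ?scaler0 ?subrr ?subr0.
rewrite pl_nrm2 -!(big_mkord xpredT (fun i => hnorm (c i) ^+ 2)).
rewrite -(big_mkord xpredT (fun i => hnorm (if (i < n)%N then 0 else c i) ^+ 2)).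
rewrite (big_cat_nat (n := n)) //= [in RHS](big_cat_nat (n := n)) //= addrAC subrr add0r.
rewrite big_nat big1 ?add0r; last first.
  by move=> i /andP[_ ->]; rewrite hnorm_nrm /nrm (@nrm20 R (fdPH E)) sqrtr0 expr0n.
rewrite [LHS]big_nat [RHS]big_nat; apply: eq_bigr => i /andP[ni _].
by rewrite ltnNge ni.
Qed.

(** The partial sums are Cauchy in a complete space. Each Taylor coefficient is a scalar product
    with a monomial, hence continuous, and is constant along the partial sums from some rank on. *)
Lemma power_series c : (forall e : R, 0 < e -> exists N, forall n, (N <= n)%N ->
    \sum_(i < n) hnorm (c i) ^+ 2 - \sum_(i < N) hnorm (c i) ^+ 2 < e) ->
  exists2 q, H2 E q & forall n, at0 (iter n (@bs R E) q) = c n.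
Proof.
move=> hc.
have hpl N : H2 E (pl N c) := pl_H2 N c.
have ca : @cauchyseq R H (fun N => pl N c).
  move=> e e0; have e2 : 0 < (e / 2) ^+ 2 by rewrite exprn_gt0 // divr_gt0.
  have [N hN] := hc _ e2; exists N => m n Nm Nn.
  have sm k : (N <= k)%N -> @nrm R H (pl k c - pl N c) < e / 2.
    move=> Nk; rewrite -(@ltr_pXn2r _ 2) ?nnegrE ?nrm_ge0 ?divr_ge0 ?(ltW e0) //.
    rewrite nrmK; last exact: (h2B (hpl k) (hpl N)).
    by rewrite pl_diff_nrm2 //; exact: hN.
  apply: le_lt_trans (@nrmB_tri R H (pl N c) _ _ (hpl m) (hpl N) (hpl n)) _.
  have := sm m Nm; have := sm n Nn; rewrite (@nrmBsym R H _ _ (hpl n) (hpl N)).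
  lra.
have [q hq cq] := @H2_complete R E _ hpl ca.
exists q => // n; apply: eb_ext => i.
rewrite -ip2_mono //; apply/subr0_eq/cabs0_eq0.
have hm := mono_H2 n (eb i : E).
apply/eqP; rewrite eq_le cabs_ge0 andbT leNgt; apply/negP => p0.
set m := zX n _ in hm p0; set a := cabs _ in p0.
have b0 : 0 < @nrm R H m + 1 by rewrite ltr_wpDl // nrm_ge0.
have [N hN] := cq _ (divr_gt0 p0 b0).
pose k := maxn N n.+1.
have hd := h2B (hpl k) hq.
have := @CS R H _ _ hd hm.
have -> : @ph_dot R H (pl k c - q) m = ip (c n) (eb i) - ip2 q m.
  rewrite -[LHS]/(ip2 _ _) ip2Bl // ip2_mono // pl_coef //; exact: leq_maxr.
rewrite -cabsN opprB -/a => h1.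
have h2 : @nrm R H (pl k c - q) < a / (@nrm R H m + 1) by apply: hN; exact: leq_maxl.
have : a < a.
  apply: le_lt_trans h1 _; apply: le_lt_trans (_ : _ <= a / (@nrm R H m + 1) * @nrm R H m) _.
    by rewrite ler_wpM2r ?nrm_ge0 // ltW.
  by rewrite mulrAC ltr_pdivrMr // ltr_pM2l // ltrDl.
by rewrite ltxx.
Qed.
End PowerSeries.
(** Subtracting from the spanning vectors of W their projections on M moves the defect into a space
    G orthogonal to M. Then S^* f = y + x with y in M and x in G, and removing the projection on an
    orthonormal basis of G leaves y. *)
Lemma defect_deflation (R : realType) (F : fdHilbert R) (M W : set (R[i] -> F)) :
  closed_subspace M -> defect_space (bshift F) M W ->
  exists k (g : 'I_k -> R[i] -> F), [/\ @onf R (H2PH F) k g,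
    forall i f, M f -> ip2 f (g i) = 0 &
    forall f, M f -> M (@defl R (H2PH F) (@bs R F) k g f)].
Proof.
move=> cM [[n hn] dW]; have [sM cl] := closed_subspaceP cM.
have [v [hv iv eW]] := hn.
have /choice[m hm] j : exists m, M m /\ forall y, M y -> ip2 (v j - m) y = 0.
  by have [m Mm om] := proj_exists (@H2_complete R F) sM cl (hv j); exists m.
have hmH j : H2 F (m j) by apply: (subspm sM); case: (hm j).
pose u j := v j - m j.
have hu j : H2 F (u j) := h2B (hv j) (hmH j).
pose G := lspan u.
have Gspan x : G x -> exists a : 'I_n -> R[i], eqT x (\sum_j a j *: u j) by case.
have [k [g [_ og Gg sg]]] := has_dim_span hu (lspan_subsp u) (@lspan_eqT _ _ _ u) Gspan.
have orth f x : M f -> G x -> ip2 f x = 0.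
  move=> Mf [hx [a ea]]; have hf : H2 F f := subspm sM Mf.
  have hs : H2 F (\sum_j a j *: u j) by exact: h2_lc.
  rewrite (ip2_eqTr hx hs hf ea) [LHS](@dot_lcr R (H2PH F)) //.
  apply: big1 => j _; rewrite -[ph_dot _ _]/(ip2 f (u j)) (ip2C' (hu j) hf).
  by have [_ ->] := hm j; rewrite // rmorph0 mulr0.
have hg i : H2 F (g i) := og.1 i.
exists k, g; split=> // [i f Mf|f Mf]; first exact: (orth f _ Mf (Gg i)).
have hf : H2 F f := subspm sM Mf; have hb := bs_H2 hf.
have [m' [w [Mm' Ww e]]] := dW f Mf.
move: Ww; rewrite eW => -[hw [a ea]].
have hm' : H2 F m' := subspm sM Mm'.
have [hbf ebf] := bshiftP hf.
pose y := m' + \sum_j a j *: m j; pose x := \sum_j a j *: u j.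
have My : M y by apply: (subspD sM) => //; apply: (subsp_lc sM) => j; case: (hm j).
have hx : H2 F x by exact: h2_lc.
have Gx : G x by split=> //; exists a; exact: eqT_refl.
have hy : H2 F y := subspm sM My.
have eb : eqT (bs f) (y + x).
  apply: eqT_trans (eqT_sym ebf) _; apply: eqT_trans e _.
  apply: aeT_sub ea => t h; rewrite /y /x !fctE h -addrA; congr (_ + _).
  rewrite !fct_sumE -big_split; apply: eq_bigr => j _ /=.
  by rewrite /u !fctE scalerBr addrC subrK.
have hp : H2 F (@onproj R (H2PH F) k g (bs f)) by exact: (@onprojm R (H2PH F)).
apply: (closed_subspace_eqT cM My); first exact: (h2B hb hp).
have ep : @onproj R (H2PH F) k g (bs f) = @onproj R (H2PH F) k g x.
  apply: eq_bigr => i _; congr (_ *: _).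
  rewrite -[LHS]/(ip2 _ _) -[RHS]/(ip2 _ _).
  have hyx : H2 F (y + x) := h2D hy hx.
  by rewrite (ip2_eqTl hb hyx (hg i) eb) ip2Dl // (orth y _ My (Gg i)) add0r.
have ex : eqT x (@onproj R (H2PH F) k g x).
  have hox : H2 F (@onproj R (H2PH F) k g x) by exact: (@onprojm R (H2PH F)).
  by apply/(pheq_eqT hx hox); exact: sg.
apply: aeT_sub (aeT_and eb ex) => t [h1 h2].
by rewrite /defl ep !fctE h1 -h2 !fctE addrK.
Qed.

(** * The deflated backward shift on M and its residuals *)

Section DeflatedShift.
Variables (R : realType) (F : fdHilbert R) (M : set (R[i] -> F)) (k : nat) (g : 'I_k -> R[i] -> F).
Notation C := R[i].
Notation H := (H2PH F).
Hypothesis cM : closed_subspace M.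
Hypothesis og : @onf R H k g.
Hypothesis Mg : forall i f, M f -> ip2 f (g i) = 0.
Definition deflT : (C -> F) -> (C -> F) := @defl R H (@bs R F) k g.
Notation T := deflT.
Hypothesis TM : forall f, M f -> M (T f).

Lemma inv_subsp : @subsp R H M. Proof. by have [] := closed_subspaceP cM. Qed.
Lemma inv_H2 f : M f -> H2 F f. Proof. exact: (subspm inv_subsp). Qed.
Lemma bs_stab x : H2 F x -> H2 F (bs x). Proof. exact: bs_H2. Qed.
Lemma bs_linear c x y : H2 F x -> H2 F y -> bs (c *: x + y) = c *: bs x + bs y.
Proof. exact: bs_lin. Qed.
Lemma deflT_H2 f : H2 F f -> H2 F (T f).
Proof. exact: (@deflm R H (@bs R F) k g bs_stab og). Qed.
Lemma deflT_lin c x y : H2 F x -> H2 F y -> T (c *: x + y) = c *: T x + T y.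
Proof. exact: (@defl_lin R H (@bs R F) k g bs_stab bs_linear og). Qed.
Lemma deflT_stable f : H2 F f -> forall e : R, 0 < e ->
  exists N, forall n, (N <= n)%N -> @nrm2 R H (iter n T f) < e.
Proof.
move=> hf e e0; apply: (@deflation_stable R H (@bs R F) (zX 1) k g) => //.
- exact: bs_stab.
- exact: bs_linear.
- by move=> x; exact: bs_contr.
- by move=> x; exact: bs_stable.
- by move=> x; exact: zX_H2.
- by move=> x y; exact: bs_adj.
- by move=> x y hx hy; apply: zX_iso; exact: H2L2.
Qed.

Definition residual f := f - zX 1 (T f).
Lemma residual_H2 f : H2 F f -> H2 F (residual f).
Proof. by move=> hf; apply: h2B => //; apply: zX_H2; exact: deflT_H2. Qed.
Lemma residual_lin c x y : H2 F x -> H2 F y -> residual (c *: x + y) = c *: residual x + residual y.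
Proof.
move=> hx hy; rewrite /residual; have -> := deflT_lin c hx hy; rewrite zX_lin.
by apply/funext => z; exact: (@lincombB _ (fdH_vect F)).
Qed.
(** f - z T f is f(0) plus z times the projection of S^* f on the g_i, so residuals stay in the span
    of the constants and the finitely many z g_i. *)
Lemma residual_span f : H2 F f -> eqT (residual f)
  (\sum_(j : 'I_(edim F) + 'I_k) (match j with inl i => ip (at0 f) (eb i) | inr i => ip2 (bs f) (g i) end)
     *: (match j with inl i => cst1 (eb i : F) | inr i => zX 1 (g i) end)).
Proof.
move=> hf; apply: aeTW => t; rewrite fct_sumE big_sumType /=.
have e : T f (circ t) = bs f (circ t) - \sum_i ip2 (bs f) (g i) *: g i (circ t).
  rewrite -[LHS]/(bs f (circ t) - (\sum_i ip2 (bs f) (g i) *: g i) (circ t)).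
  by rewrite fct_sumE.
rewrite -[LHS]/(f (circ t) - circ t ^+ 1 *: T f (circ t)) e {1}(bs_eq f t) expr1.
set S := \sum_i ip2 (bs f) (g i) *: g i (circ t).
have -> : \sum_(i < edim F) (ip (at0 f) (eb i) *: cst1 (eb i)) (circ t) = at0 f.
  by rewrite [RHS]eb_exp.
have -> : \sum_(i < k) (ip2 (bs f) (g i) *: zX 1 (g i)) (circ t) = circ t *: S.
  rewrite scaler_sumr; apply: eq_bigr => i _.
  rewrite -[LHS]/(ip2 (bs f) (g i) *: (circ t ^+ 1 *: g i (circ t))).
  by rewrite expr1 !scalerA mulrC.
by rewrite scalerBr opprB -addrA [X in _ + X]addrC subrK.
Qed.

(* S^* f - T f is orthogonal to M, which contains T f. *)
Lemma residual_nrm2 f : M f -> @nrm2 R H (residual f) = @nrm2 R H f - @nrm2 R H (T f).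
Proof.
move=> Mf; have hf := inv_H2 Mf; have MT := TM Mf; have hT := inv_H2 MT.
have hz := zX_H2 1 hT; have hb := bs_H2 hf.
have d : @nrm2 R H (f - zX 1 (T f)) = @nrm2 R H f + @nrm2 R H (zX 1 (T f)) - 2 * cRe (ip2 f (zX 1 (T f))).
  exact: (@nrm2B R H).
have hp : H2 F (@onproj R H k g (bs f)) by exact: (@onprojm R H).
have e1 : ip2 (bs f) (T f) = ip2 (T f) (T f).
  have o : ip2 (@onproj R H k g (bs f)) (T f) = 0.
    rewrite (ip2C' hT hp) [X in X^*](@dot_lcr R H) //; last exact: og.1.
    rewrite big1 ?rmorph0 // => i _.
    by rewrite (Mg i MT : @ph_dot R H (T f) (g i) = 0) mulr0.
  by rewrite -[T f in RHS]/(bs f - @onproj R H k g (bs f)) ip2Bl // o subr0.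
have e2 : @nrm2 R H (zX 1 (T f)) = @nrm2 R H (T f).
  by rewrite -[LHS]/(cRe (ip2 _ _)) zX_iso //; exact: H2L2.
rewrite d -bs_adj // e1 e2 -[cRe (ip2 _ _)]/(@nrm2 R H (T f)); ring.
Qed.

Definition residuals : set (C -> F) := [set x | H2 F x /\ exists2 f, M f & eqT x (residual f)].

Lemma residuals_onb : exists d (phi : 'I_d -> C -> F), [/\ @onf R H d phi,
  forall a, exists2 f, M f & eqT (phi a) (residual f) &
  forall f, M f -> eqT (residual f) (\sum_a ip2 (residual f) (phi a) *: phi a)].
Proof.
have sJ : @subsp R H residuals.
  split=> [x []//||c x y [hx [f Mf ef]] [hy [h Mh eh]]].
    have M0 : M 0 by case: cM.
    split; first exact: H2_0.
    exists 0 => //; have hJ := residual_H2 (@H2_0 R F).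
    apply: eqT_sym; apply/(pheq_eqT hJ (@H2_0 R F))/pheq0; rewrite residual_nrm2 // (@nrm20 R H).
    have := @nrm2_ge0 R H _ (deflT_H2 (@H2_0 R F)).
    have := @nrm2_ge0 R H _ hJ; rewrite residual_nrm2 // (@nrm20 R H); lra.
  split; first exact: H2_lin.
  exists (c *: f + h); first exact: (subspL inv_subsp).
  have hf := inv_H2 Mf; have hh := inv_H2 Mh.
  have el := eqT_lin c ef eh.
  have ej := residual_lin c hf hh.
  by apply: (eqT_trans el); rewrite ej; exact: eqT_refl.
have eJ f h : residuals f -> H2 F h -> eqT h f -> residuals h.
  by move=> [hf [x Mx ex]] hh e; split=> //; exists x => //; exact: eqT_trans ex.
pose v (j : 'I_(edim F) + 'I_k) : C -> F :=
  match j with inl i => cst1 (eb i : F) | inr i => zX 1 (g i) end.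
have hv j : H2 F (v j).
  by case: j => i; [exact: cst_H2|apply: zX_H2; exact: og.1].
have sp x : residuals x -> exists a : 'I_(edim F) + 'I_k -> C, eqT x (\sum_j a j *: v j).
  move=> [hx [f Mf e]].
  eexists; apply: eqT_trans e _; exact: residual_span (inv_H2 Mf).
have [d [phi [_ op Jp sJp]]] := has_dim_span hv sJ eJ sp.
exists d, phi; split=> // [a|f Mf]; first by case: (Jp a).
have hJ := residual_H2 (inv_H2 Mf).
have hs : H2 F (\sum_a ip2 (residual f) (phi a) *: phi a) by apply: h2_lc; exact: op.1.
apply/(pheq_eqT hJ hs); apply: sJp; split=> //.
by exists f => //; exact: eqT_refl.
Qed.
End DeflatedShift.

(** * The isometry V given by its Taylor coefficients *)

Section ModelMap.
Variables (R : realType) (F : fdHilbert R) (M : set (R[i] -> F)).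
Notation C := R[i].
Notation H := (H2PH F).
Variables (T : (C -> F) -> (C -> F)) (d : nat) (phi : 'I_d -> C -> F).
Notation E1 := (Cn R d).
Notation H1 := (H2PH E1).
Notation J f := (f - zX 1 (T f)).
Hypothesis cM : closed_subspace M.
Hypothesis TM : forall f, M f -> M (T f).
Hypothesis Tl : forall c x y, M x -> M y -> T (c *: x + y) = c *: T x + T y.
Hypothesis stable : forall f, M f -> forall e : R, 0 < e ->
  exists N, forall n, (N <= n)%N -> @nrm2 R H (iter n T f) < e.
Hypothesis Jn : forall f, M f -> @nrm2 R H (J f) = @nrm2 R H f - @nrm2 R H (T f).
Hypothesis ophi : @onf R H d phi.
Hypothesis Jphi : forall a, exists2 f, M f & eqT (phi a) (J f).
Hypothesis Jspan : forall f, M f -> eqT (J f) (\sum_a ip2 (J f) (phi a) *: phi a).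

Let sM : @subsp R H M. Proof. by have [] := closed_subspaceP cM. Qed.
Let MH f : M f -> H2 F f. Proof. exact: (subspm sM). Qed.
Let iM n f : M f -> M (iter n T f). Proof. by move=> Mf; elim: n => //= n IH; exact: TM. Qed.
Let JH f : M f -> H2 F (J f).
Proof. by move=> Mf; apply: h2B; [exact: MH|apply: zX_H2; exact: MH (TM Mf)]. Qed.

(** Coordinates of J f in the basis phi. Applied to T^n f, they are the Taylor coefficient of order
    n of V f. *)
Definition mcoef (f : C -> F) : E1 := \row_a ip2 (J f) (phi a).

Lemma mcoef_lin c x y : M x -> M y -> mcoef (c *: x + y) = c *: mcoef x + mcoef y.
Proof.
move=> Mx My; apply/rowP => a; rewrite !mxE (Tl c Mx My) zX_lin.
have -> : c *: x + y - (c *: zX 1 (T x) + zX 1 (T y)) = c *: (J x) + J y.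
  by apply/funext => z; exact: (@lincombB _ (fdH_vect F)).
have h1 := H2L2 (JH Mx); have h2 := H2L2 (JH My); have h3 := H2L2 (ophi.1 a).
exact: (ip2_lin c h1 h2 h3).
Qed.

Lemma mcoef_nrm f : M f -> hnorm (mcoef f) ^+ 2 = @nrm2 R H f - @nrm2 R H (T f).
Proof.
move=> Mf; rewrite -Jn //; have hJ := JH Mf.
have hs : H2 F (\sum_a ip2 (J f) (phi a) *: phi a) by apply: h2_lc; exact: ophi.1.
have e1 := nrm2_eqT hJ hs (Jspan Mf).
have e2 := @onf_nrm2 R H d phi (fun a => ip2 (J f) (phi a)) ophi.
rewrite e1 e2 hnorm2 /ip /= /dotv cRe_sum; apply: eq_bigr => a _.
by rewrite mul_conjcC /= mxE.
Qed.

Let iterl n c x y : M x -> M y -> iter n T (c *: x + y) = c *: iter n T x + iter n T y.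
Proof.
move=> Mx My; elim: n => //= n IH; rewrite IH; apply: Tl; exact: iM.
Qed.

(** The norm identity for J telescopes along the orbit of f; by stability the squared coefficients
    then sum to |f|^2. *)
Lemma mcoef_sum N f : M f -> \sum_(i < N) hnorm (mcoef (iter i T f)) ^+ 2 =
  @nrm2 R H f - @nrm2 R H (iter N T f).
Proof.
move=> Mf; elim: N => [|N IH]; first by rewrite big_ord0 subrr.
by rewrite big_ord_recr /= IH mcoef_nrm; [ring|exact: iM].
Qed.

Lemma model_map_exists f : M f ->
  exists2 q, H2 E1 q & forall n, at0 (iter n (@bs R E1) q) = mcoef (iter n T f).
Proof.
move=> Mf; apply: power_series => e e0; have [N hN] := stable Mf e0.
exists N => n _; rewrite !mcoef_sum //.
have h1 := hN N (leqnn N); have h2 := @nrm2_ge0 R H _ (MH (iM n Mf)); lra.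
Qed.

Definition model_map f : C -> E1 := xget 0 [set q | H2 E1 q /\
  forall n, at0 (iter n (@bs R E1) q) = mcoef (iter n T f)].

Lemma model_mapP f : M f -> H2 E1 (model_map f) /\ forall n, at0 (iter n (@bs R E1) (model_map f)) = mcoef (iter n T f).
Proof.
move=> Mf; rewrite /model_map; case: xgetP => [q _ //|h].
by have [q hq eq0] := model_map_exists Mf; case: (h q).
Qed.
Lemma model_map_H2 f : M f -> H2 E1 (model_map f). Proof. by case/model_mapP. Qed.
Lemma model_map_coef f n : M f -> at0 (iter n (@bs R E1) (model_map f)) = mcoef (iter n T f).
Proof. by case/model_mapP. Qed.

Lemma model_map_lin c x y : M x -> M y -> eqT (model_map (c *: x + y)) (c *: model_map x + model_map y).
Proof.
move=> Mx My; have Mc : M (c *: x + y) := subspL sM c Mx My.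
have hx := model_map_H2 Mx; have hy := model_map_H2 My.
apply: coef_ext => [||n]; [exact: model_map_H2|exact: H2_lin|].
rewrite model_map_coef // bs_iter_lin // at0_lin; [|exact: H2L2 (bs_pheq_iter _ _)..].
rewrite !model_map_coef // iterl // mcoef_lin //; exact: iM.
Qed.

Lemma model_map_bs f : M f -> eqT (bs (model_map f)) (model_map (T f)).
Proof.
move=> Mf; have hf := model_map_H2 Mf; apply: coef_ext => [||n].
- exact: bs_H2.
- exact: model_map_H2 (TM Mf).
by rewrite -iterSr !model_map_coef ?iterSr //; exact: TM.
Qed.

(** After N steps of S^* on V f and of T on f, the same squared coefficients have been split off.
    The two square norms differ only by remainders that tend to 0. *)
Lemma model_map_nrm2 f : M f -> @nrm2 R H1 (model_map f) = @nrm2 R H f.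
Proof.
move=> Mf; have hq := model_map_H2 Mf; set q := model_map f in hq.
have key N : @nrm2 R H1 q = @nrm2 R H f - @nrm2 R H (iter N T f) + @nrm2 R H1 (iter N (@bs R E1) q).
  rewrite -mcoef_sum //; elim: N => [|N IH]; first by rewrite big_ord0 add0r.
  rewrite IH bs_nrm2; last exact: bs_pheq_iter.
  by rewrite model_map_coef // big_ord_recr /= addrA.
apply/eqP; rewrite -subr_eq0 -normr_le0 leNgt; apply/negP => p0.
set r := `|_| in p0; have r2 : 0 < r / 2 by rewrite divr_gt0.
have [N1 h1] := stable Mf r2.
have r3 : 0 < Num.sqrt (r / 2) by rewrite sqrtr_gt0.
have [N2 h2] := bs_stable hq r3.
pose N := maxn N1 N2; have := h1 N (leq_maxl _ _); have := h2 N (leq_maxr _ _).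
have hb : H2 E1 (iter N (@bs R E1) q) := bs_pheq_iter N hq.
have n1 := @nrm2_ge0 R H _ (MH (iM N Mf)); have n2 := @nrm2_ge0 R H1 _ hb.
rewrite /nrm ltr_sqrt //.
have : r <= Num.max (@nrm2 R H (iter N T f)) (@nrm2 R H1 (iter N (@bs R E1) q)).
  rewrite /r (key N) ler_norml le_max; apply/andP; split.
  - have : @nrm2 R H (iter N T f) <= Num.max (@nrm2 R H (iter N T f)) (@nrm2 R H1 (iter N (@bs R E1) q)).
      by rewrite le_max lexx.
    lra.
  - by apply/orP; right; lra.
by rewrite le_max => /orP[] a b c'; lra.
Qed.

Notation Phi := (colsym phi).
Lemma model_map_opH2 : opH2 Phi. Proof. by apply: colsym_opH2; exact: ophi.1. Qed.

(** Since J T^n f = T^n f - z T^(n+1) f, the sum of the z^n J T^n f telescopes, and Phi maps the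
    coordinates [mcoef] back to J T^n f. *)
Lemma model_map_sum N f : M f -> eqT (f - zX N (iter N T f))
  (app Phi (pl N (fun n => mcoef (iter n T f)))).
Proof.
move=> Mf; elim: N => [|N IH].
  apply: aeTW => t; rewrite zX0 /= subrr /app /pl big_ord0 linear0 //.
have e := Jspan (iM N Mf).
apply: aeT_sub (aeT_and IH e) => t [h1 h2].
have -> : app Phi (pl N.+1 (fun n => mcoef (iter n T f))) (circ t) =
  app Phi (pl N (fun n => mcoef (iter n T f))) (circ t) + circ t ^+ N *: Phi (circ t) (mcoef (iter N T f)).
  by rewrite /app !plE big_ord_recr linearD linearZ.
have -> : Phi (circ t) (mcoef (iter N T f)) = iter N T f (circ t) - circ t *: iter N.+1 T f (circ t).
  rewrite -[RHS]/(iter N T f (circ t) - circ t ^+ 1 *: T (iter N T f) (circ t)).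
  rewrite -[RHS]/((iter N T f - zX 1 (T (iter N T f))) (circ t)) h2 fct_sumE colsymE.
  by apply: eq_bigr => a _; rewrite mxE.
rewrite -h1 -[LHS]/(f (circ t) - circ t ^+ N.+1 *: iter N.+1 T f (circ t)).
rewrite -[(f - _) _]/(f (circ t) - circ t ^+ N *: iter N T f (circ t)).
by rewrite scalerBr scalerA -exprSr addrA subrK.
Qed.

(** Let N grow in [model_map_sum]: stability sends the left side to f, the polynomials tend to V f,
    and [app_limit] handles the possibly unbounded symbol. *)
Lemma model_map_app f : M f -> eqT f (app Phi (model_map f)).
Proof.
move=> Mf; have hf := MH Mf; have hq := model_map_H2 Mf.
have hz N : H2 F (zX N (iter N T f)) by apply: zX_H2; exact: MH (iM N Mf).
apply: (@app_limit _ _ _ _ model_map_opH2 f (model_map f) (fun N => f - zX N (iter N T f))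
  (fun N => pl N (fun n => mcoef (iter n T f)))) => //.
- by move=> N; exact: h2B.
- by move=> N; exact: pl_H2.
- by move=> N; exact: model_map_sum.
- move=> e e0; have e2 : 0 < e ^+ 2 by rewrite exprn_gt0.
  have [N hN] := stable Mf e2; exists N => n Nn.
  have hd := h2B (h2B hf (hz n)) hf.
  rewrite -(@ltr_pXn2r _ 2) ?nnegrE ?nrm_ge0 ?(ltW e0) // nrmK //.
  have -> : @nrm2 R H (f - zX n (iter n T f) - f) = @nrm2 R H (iter n T f).
    have -> : f - zX n (iter n T f) - f = - zX n (iter n T f) by rewrite addrAC subrr add0r.
    rewrite (@nrm2N R H _ (hz n)) -[LHS]/(cRe (ip2 _ _)) zX_iso //; exact: H2L2 (MH (iM n Mf)).
  exact: hN.
- have -> : (fun N => pl N (fun n => mcoef (iter n T f))) =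
    (fun N => pl N (fun n => at0 (iter n (@bs R E1) (model_map f)))).
    apply/funext => N; congr (pl N _); apply/funext => n; by rewrite model_map_coef.
  exact: pl_cvg.
Qed.
End ModelMap.

(** * From the isometry V to a pair Theta, Phi *)

Section Representation.
Variables (R : realType) (F E1 : fdHilbert R) (M : set (R[i] -> F)).
Notation C := R[i].
Notation H := (H2PH F).
Notation H1 := (H2PH E1).
Variables (V : (C -> F) -> (C -> E1)) (Phi : C -> 'Hom(fdH_vect E1, fdH_vect F)).
Hypothesis cM : closed_subspace M.
Hypothesis hPhi : opH2 Phi.
Hypothesis VH : forall f, M f -> H2 E1 (V f).
Hypothesis Vl : forall c x y, M x -> M y -> eqT (V (c *: x + y)) (c *: V x + V y).
Hypothesis Vn : forall f, M f -> @nrm2 R H1 (V f) = @nrm2 R H f.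
Hypothesis Vbs : forall f, M f -> exists2 f', M f' & eqT (bs (V f)) (V f').
Hypothesis Vapp : forall f, M f -> eqT f (app Phi (V f)).
Hypothesis Vfull : forall e, (forall f, M f -> ip (at0 (V f)) e = 0) -> e = 0.

Let sM : @subsp R H M. Proof. by have [] := closed_subspaceP cM. Qed.
Let clM : @closedW R H M. Proof. by have [] := closed_subspaceP cM. Qed.
Let MH f : M f -> H2 F f. Proof. exact: (subspm sM). Qed.
Let Vlp c x y : M x -> M y -> @pheq R H1 (V (c *: x + y)) (c *: V x + V y).
Proof.
move=> Mx My; apply/pheq_eqT; last exact: Vl.
  by apply: VH; exact: (subspL sM).
by apply: H2_lin; exact: VH.
Qed.
Definition vrange : set (C -> E1) := @iso_range R H H1 V M.
Lemma vrangeP k : vrange k <-> H2 E1 k /\ exists2 f, M f & eqT k (V f).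
Proof.
split=> -[hk [f Mf e]]; split=> //; exists f => //.
  by apply/(pheq_eqT hk (VH Mf)).
by apply/(pheq_eqT hk (VH Mf)).
Qed.
Lemma vrange_subsp : @subsp R H1 vrange.
Proof. exact: (@iso_range_subsp R H H1 V M sM VH Vlp Vn). Qed.
Lemma vrange_closed : @closedW R H1 vrange.
Proof. exact: (@iso_range_closed R H H1 V M (@H2_complete R F) sM clM VH Vlp Vn). Qed.
Lemma vrange_V f : M f -> vrange (V f).
Proof. by move=> Mf; apply/vrangeP; split; [exact: VH|exists f => //; exact: eqT_refl]. Qed.

Definition vperp : set (C -> E1) := [set x | H2 E1 x /\ forall k, vrange k -> ip2 x k = 0].
Lemma vperp_subsp : @subsp R H1 vperp.
Proof.
split=> [x []//||c x y [hx ox] [hy oy]].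
  by split=> [|k /vrangeP[hk _]]; [exact: H2_0|rewrite ip20l].
split=> [|k Kk]; first exact: H2_lin.
have /vrangeP[hk _] := Kk.
by rewrite ip2_lin ?ox ?oy ?mulr0 ?addr0 //; exact: H2L2.
Qed.
Lemma vperp_closed : @closedW R H1 vperp.
Proof.
move=> x hx cl; split=> // k Kk; have /vrangeP[hk _] := Kk.
apply: cabs0_eq0; apply/eqP; rewrite eq_le cabs_ge0 andbT leNgt; apply/negP => p0.
have b0 : 0 < @nrm R H1 k + 1 by rewrite ltr_wpDl // nrm_ge0.
have [y [hy oy] h] := cl _ (divr_gt0 p0 b0).
have hd := h2B hx hy; have := @CS R H1 _ _ hd hk.
have -> : @ph_dot R H1 (x - y) k = ip2 x k.
  by rewrite -[LHS]/(ip2 _ _) ip2Bl // oy // subr0.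
set a := cabs _ in p0 h * => h1.
have : a < a.
  apply: le_lt_trans h1 _; apply: le_lt_trans (_ : _ <= a / (@nrm R H1 k + 1) * @nrm R H1 k) _.
    by rewrite ler_wpM2r ?nrm_ge0 // ltW.
  by rewrite mulrAC ltr_pdivrMr // ltr_pM2l // ltrDl.
by rewrite ltxx.
Qed.
(** By [Vbs] the range of V is invariant under the backward shift, so its complement is invariant
    under the shift, as the Beurling-Lax theorem requires. *)
Lemma vperp_zX x : vperp x -> vperp (zX 1 x).
Proof.
move=> [hx ox]; have hz := zX_H2 1 hx; split=> // k /vrangeP[hk [f Mf e]].
rewrite (ip2C' hk hz) -bs_adj //.
have [f' Mf' e'] := Vbs Mf; have hV' := VH Mf'.
have Kb : vrange (bs k).
  apply/vrangeP; split; first exact: bs_H2.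
  by exists f' => //; apply: eqT_trans (bs_eqT hk (VH Mf) e) e'.
by rewrite (ip2C' hx (bs_H2 hk)) ox // !rmorph0.
Qed.

Lemma vrange_proj h : H2 E1 h -> exists2 f, M f & forall g, M g -> ip2 (h - V f) (V g) = 0.
Proof.
move=> hh.
have [p /vrangeP[hp [f Mf e]] op] := proj_exists (@H2_complete R E1) vrange_subsp vrange_closed hh.
exists f => // g Mg; have hV := VH Mf; have hVg := VH Mg.
rewrite -(op (V g) (vrange_V Mg)); apply: ip2_eqTl => //; [exact: h2B|exact: h2B|].
by apply: aeT_sub e => t e; rewrite !fctE e.
Qed.

(* The adjoint of V. *)
Definition vadj (h : C -> E1) : C -> F :=
  xget 0 [set f | M f /\ forall g, M g -> ip2 (h - V f) (V g) = 0].
Lemma vadjP h : H2 E1 h -> M (vadj h) /\ forall g, M g -> ip2 (h - V (vadj h)) (V g) = 0.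
Proof.
move=> hh; rewrite /vadj; case: xgetP => [f _ //|hn].
by have [f Mf o] := vrange_proj hh; case: (hn f).
Qed.
Lemma V_diff x y : M x -> M y -> @nrm2 R H1 (V x - V y) = @nrm2 R H (x - y).
Proof.
move=> Mx My.
exact: (@iso_diff R H H1 V M sM VH Vlp Vn).
Qed.
Lemma vadj_uniq h f : H2 E1 h -> M f -> (forall g, M g -> ip2 (h - V f) (V g) = 0) ->
  eqT (vadj h) f.
Proof.
move=> hh Mf of_; have [Ma oa] := vadjP hh; set a := vadj h in Ma oa *.
have Mfa : M (a - f) := subspB sM Ma Mf.
have ha := VH Ma; have hf := VH Mf; have hd := h2B ha hf.
have o (b : C -> F) : M b -> ip2 (V a - V f) (V b) = 0.
  move=> Mb; have hb := VH Mb.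
  have -> : V a - V f = (h - V f) - (h - V a) by rewrite opprB [RHS]addrC addrA subrK.
  by rewrite ip2Bl ?of_ ?oa ?subr0 //; exact: h2B.
apply/(pheq_eqT (MH Ma) (MH Mf)); rewrite /pheq -V_diff //.
by rewrite -[LHS]/(cRe (ip2 _ _)) ip2Br // !o // subrr.
Qed.

Lemma vadj_pyth h : H2 E1 h ->
  @nrm2 R H1 h = @nrm2 R H (vadj h) + @nrm2 R H1 (h - V (vadj h)).
Proof.
move=> hh; have [Ma oa] := vadjP hh; have hV := VH Ma; have hd := h2B hh hV.
rewrite -Vn //; set a := V _ in hV hd oa *.
have -> : @nrm2 R H1 h = @nrm2 R H1 ((h - a) + a) by rewrite subrK.
have d : @nrm2 R H1 ((h - a) + a) = @nrm2 R H1 (h - a) + @nrm2 R H1 a + 2 * cRe (ip2 (h - a) a).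
  exact: (@nrm2D R H1).
by rewrite d oa // mulr0 addr0 addrC.
Qed.

Lemma vadj_bounded : bounded_op vadj.
Proof.
split=> [h hh|c h g hh hg|]; first by have [/MH] := vadjP hh.
- have [Mh oh] := vadjP hh; have [Mg og] := vadjP hg.
  have Mc : M (c *: vadj h + vadj g) := subspL sM c Mh Mg.
  apply: vadj_uniq => //; first exact: H2_lin.
  move=> b Mb; have hb := VH Mb; have h1 := VH Mh; have h2 := VH Mg.
  have d1 := h2B hh h1; have d2 := h2B hg h2.
  have hl2 : H2 E1 (c *: (h - V (vadj h)) + (g - V (vadj g))) := H2_lin c d1 d2.
  have hl1 : H2 E1 (c *: h + g - V (c *: vadj h + vadj g)) := h2B (H2_lin c hh hg) (VH Mc).
  have el : eqT (c *: h + g - V (c *: vadj h + vadj g)) (c *: (h - V (vadj h)) + (g - V (vadj g))).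
    apply: aeT_sub (Vl c Mh Mg) => t e.
    rewrite -[LHS]/(c *: h (circ t) + g (circ t) - V (c *: vadj h + vadj g) (circ t)) e.
    exact: (@lincombB _ (fdH_vect E1)).
  rewrite (ip2_eqTl hl1 hl2 hb el) (ip2_lin c (H2L2 d1) (H2L2 d2) (H2L2 hb)).
  by rewrite oh // og // mulr0 addr0.
exists 1 => h hh; rewrite mul1r !norm2E ler_sqrt; last exact: (@nrm2_ge0 R H1).
have [Ma _] := vadjP hh; have hd := h2B hh (VH Ma).
by rewrite (vadj_pyth hh) lerDl; exact: (@nrm2_ge0 R H1).
Qed.

Lemma vadj_V f : M f -> eqT (vadj (V f)) f.
Proof.
move=> Mf; apply: vadj_uniq => //; first exact: VH.
by move=> g Mg; rewrite subrr ip20l //; exact: VH.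
Qed.

(** r = h - V (vadj h) is in the kernel of [vadj]. If h is orthogonal to that kernel, then r is
    orthogonal to h and to V M, hence null, and the norms agree by [vadj_pyth]. *)
Lemma vadj_isometry : partial_isometry vadj.
Proof.
move=> h hh oh; have [Ma oa] := vadjP hh; have hV := VH Ma; have hd := h2B hh hV.
have M0 : M 0 := subsp0 sM.
have z : eqT (vadj (h - V (vadj h))) 0.
  apply: vadj_uniq => // g Mg; have hg := VH Mg; rewrite -(oa g Mg).
  have V0 : eqT (V 0) 0.
    apply/(pheq_eqT (VH M0) (@H2_0 R E1))/pheq0; by rewrite Vn // (@nrm20 R H).
  apply: ip2_eqTl => //; first by apply: h2B => //; exact: VH.
  by apply: aeT_sub V0 => t e; rewrite !fctE e subr0.
have := oh _ hd z; set r := h - V (vadj h) in hd oa *.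
have -> : h = r + V (vadj h) by rewrite /r subrK.
rewrite ip2Dl // (ip2C' hd hV) oa // rmorph0 addr0 => r0.
have n0 : @nrm2 R H1 r = 0 by rewrite -[LHS]/(cRe (ip2 r r)) r0.
by rewrite /r subrK !norm2E /nrm (vadj_pyth hh) -/r n0 addr0.
Qed.

Lemma vadj_range : M = rangeH2 vadj.
Proof.
apply/seteqP; split=> f.
  move=> Mf; split; first exact: MH.
  by exists (V f); [exact: VH|apply: eqT_sym; exact: vadj_V].
move=> [hf [h hh e]]; have [Ma _] := vadjP hh.
exact: closed_subspace_eqT e.
Qed.

Theorem model_representation : exists (E : fdHilbert R) (Theta : C -> 'Hom(fdH_vect E, fdH_vect E1)),
  partial_isometry_rep M Theta Phi.
Proof.
have [k [Th [hT eN]]] := beurling_lax vperp_subsp vperp_closed vperp_zX.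
exists (Cn R k), Th; split=> //.
  (* Purity: otherwise S^* Theta v = 0, so Theta v is a constant e orthogonal to V M, that is, to
     all values (V f)(0). [Vfull] gives e = 0, and then v = 0. *)
  move=> v _ v0; rewrite -(@ltr_pXn2r _ 2) ?nnegrE ?hnorm_ge0 // -(const_norm hT v).
  rewrite -[X in hnorm X]/(at0 (col Th v)) ltrDl lt0r.
  have hb := bs_H2 (col_H2 hT v).
  rewrite (@nrm2_ge0 R H1) // andbT; apply: contra v0 => /eqP n0; apply/eqP.
  have b0 : eqT (bs (col Th v)) 0 by apply/(pheq_eqT hb (@H2_0 R E1))/pheq0.
  have ec := proj1 (eqT_bs0 _) b0; set e := at0 (col Th v) in ec.
  have hc := col_H2 hT v.
  have Nc : vperp (col Th v).
    by rewrite eN; split=> //; exists (cst1 v); [exact: cst_H2|exact: eqT_refl].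
  have e0 : e = 0.
    apply: Vfull => f Mf; have hV := VH Mf; have he := cst_H2 e.
    rewrite -ip2_cst; last exact: H2L2.
    rewrite -(ip2_eqTr hc he hV ec) (ip2C' hc hV).
    by have [_ ->] := Nc; rewrite ?rmorph0 //; exact: vrange_V.
  apply: hnorm_eq0; apply/eqP; rewrite -sqrf_eq0; apply/eqP.
  rewrite -(const_norm hT v) n0 addr0 -/e e0 hnorm_nrm /nrm (@nrm20 R (fdPH E1)) sqrtr0.
  by rewrite expr0n.
exists vadj; split; [|exact: vadj_isometry|exact: vadj_range].
split=> [|p [n [a ep]]]; first exact: vadj_bounded.
have hp : H2 E1 p.
  have /poly_pl[m [b ->]] : poly_fun p by exists n, a.
  exact: pl_H2.
have [Ma oa] := vadjP hp; have hV := VH Ma.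
have [hm [g [hg _ eg]]] := modelprojP hT hp; have [hq oq] := hm.
have hag := inner_app_H2 hT hg.
have Nag : vperp (app Th g) by rewrite eN; split=> //; exists g => //; exact: eqT_refl.
have hd1 := h2B hp hV.
(* Two descriptions of the projection on V M. Their difference at p is orthogonal to V M, hence in
   Theta H^2, to which both values are orthogonal. *)
have eV : eqT (modelproj Th p) (V (vadj p)).
  set q := modelproj Th p in hq oq eg hm *.
  have hd := h2B hq hV.
  have oV (b : C -> F) : M b -> ip2 (q - V (vadj p)) (V b) = 0.
    move=> Mb; have hb := VH Mb.
    transitivity (ip2 ((p - V (vadj p)) - app Th g) (V b)).
      apply: ip2_eqTl => //; first exact: h2B.
      by apply: aeT_sub eg => t h; rewrite !fctE h !fctE addrAC.
    rewrite ip2Bl // oa // sub0r.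
    by have [_ ->] := Nag; rewrite ?oppr0 //; exact: vrange_V.
  have Nd : vperp (q - V (vadj p)).
    split=> // k0 /vrangeP[hk0 [f Mf ef]].
    by rewrite (ip2_eqTr hk0 (VH Mf) hd ef) oV.
  move: (Nd); rewrite eN => -[_ [g' hg' eg']]; have ha' := inner_app_H2 hT hg'.
  have z : ip2 (q - V (vadj p)) (q - V (vadj p)) = 0.
    rewrite ip2Br // oV // subr0 (ip2C' hq hd).
    by rewrite (ip2_eqTr hd ha' hq eg') oq // rmorph0.
  by move: (ip2_eq0 hd z); apply: aeT_sub => t; rewrite !fctE; exact: subr0_eq.
have ea : eqT (vadj p) (app Phi (modelproj Th p)).
  by apply: eqT_trans (Vapp Ma) _; apply: app_eqT; exact: eqT_sym.
have hA := MH Ma.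
have hL : H2 F (app Phi (modelproj Th p)).
  apply: app_H2 => //; apply: (L2_ae _ ea (H2L2 hA)) => v; apply: app_meas => //; exact: H2L2.
have [_ et] := toeplitzP hq hL.
by apply: eqT_trans ea _; exact: eqT_sym.
Qed.
End Representation.

Lemma almost_invariant_rep (R : realType) (F : fdHilbert R) (M : set (R[i] -> F)) :
  closed_subspace M -> almost_invariant (bshift F) M ->
  exists (E E1 : fdHilbert R) (Th : R[i] -> 'Hom(E, E1)) (Phi : R[i] -> 'Hom(E1, F)),
    partial_isometry_rep M Th Phi.
Proof.
move=> cM [W dW].
have [k [g [og Mg TM]]] := defect_deflation cM dW.
pose T := deflT g.
have MH f : M f -> H2 F f by exact: inv_H2 cM f.
have [d [phi [op Jp Js]]] := residuals_onb cM og Mg TM.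
have Tl c x y : M x -> M y -> T (c *: x + y) = c *: T x + T y.
  by move=> /MH hx /MH hy; exact: (deflT_lin og).
have st f : M f -> forall e : R, 0 < e ->
  exists N, forall n, (N <= n)%N -> @nrm2 R (H2PH F) (iter n T f) < e.
  by move=> /MH hf e e0; exact: (deflT_stable og).
have Jn f : M f -> @nrm2 R (H2PH F) (f - zX 1 (T f)) = @nrm2 R (H2PH F) f - @nrm2 R (H2PH F) (T f).
  by move=> Mf; exact: (residual_nrm2 cM og Mg TM).
have hphi : opH2 (colsym phi) by exact: model_map_opH2.
have [] := @model_representation R F (Cn R d) M (model_map T phi) (colsym phi) cM hphi.
- exact: (model_map_H2 cM TM st Jn op Js).
- exact: (model_map_lin cM TM Tl st Jn op Js).
- exact: (model_map_nrm2 cM TM st Jn op Js).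
- by move=> f Mf; exists (T f); [exact: TM|exact: (model_map_bs cM TM st Jn op Js)].
- exact: (model_map_app cM TM st Jn op Js).
(* Each phi_a is J f for some f in M, so (V f)(0) is the a-th unit vector: the values at 0 span the
   whole coefficient space. *)
- move=> e oe; apply/rowP => a; rewrite mxE.
  have [f Mf ef] := Jp a; have := oe f Mf.
  rewrite -[model_map T phi f]/(iter 0 (@bs R (Cn R d)) (model_map T phi f)).
  rewrite (model_map_coef cM TM st Jn op Js) //= /ip /= /dotv (bigD1 a) //=.
  have hJ : H2 F (f - zX 1 (T f)) by apply: h2B; [exact: MH|apply: zX_H2; exact: MH (TM f Mf)].
  have ec b : mcoef T phi f 0 b = (a == b)%:R.
    rewrite mxE -(op.2 a b).
    exact: (ip2_eqTl hJ (op.1 a) (op.1 b) (eqT_sym ef)).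
  rewrite ec eqxx mul1r big1 ?addr0 => [|b ba].
    by move=> /(congr1 Num.conj); rewrite conjCK rmorph0.
  by rewrite ec eq_sym (negbTE ba) mul0r.
by move=> E [Th h]; exists E, (Cn R d), Th, (colsym phi).
Qed.

Theorem theorem3p8 (R : realType) (F : fdHilbert R) (M : set (R[i] -> F)) :
  closed_subspace M ->
  [/\ almost_invariant (bshift F) M <->
        (exists (E : fdHilbert R) (Theta : R[i] -> 'Hom(E, F)),
           inner_range_rep M Theta) \/
        (exists (E E1 : fdHilbert R) (Theta : R[i] -> 'Hom(E, E1))
                (Phi : R[i] -> 'Hom(E1, F)),
           partial_isometry_rep M Theta Phi),
      forall (E : fdHilbert R) (Theta : R[i] -> 'Hom(E, F)),
        inner_range_rep M Theta ->
        defect (bshift F) M = (\dim {:E} - unitary_rank Theta)%N &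
      forall (E E1 : fdHilbert R) (Theta : R[i] -> 'Hom(E, E1))
             (Phi : R[i] -> 'Hom(E1, F)),
        partial_isometry_rep M Theta Phi ->
        let X := rangeH2 (fun h => bshift F (toeplitz Phi (projConst h))) in
        let W := ominus X (X `&` M) in
        minimal_defect_space (bshift F) M W /\
        defect (bshift F) M = dimH2 W].
Proof.
move=> cM; split.
- split=> [aM|[[E [Th h]]|[E [E1 [Th [Phi [hT pT hPhi [A [hA _ eM]]]]]]]]].
  (* The construction through V leads every almost invariant subspace to the form (2). *)
  + by right; exact: almost_invariant_rep.
  + by have [] := inner_range_defect h.1 cM h.
  + by have [] := compressed_defect hT hPhi hA pT cM eM.
- by move=> E Th h; have [] := inner_range_defect h.1 cM h.
- move=> E E1 Th Phi [hT pT hPhi [A [hA _ eM]]] X W.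
  rewrite /W /X (symshiftE hPhi).
  by have [] := compressed_defect hT hPhi hA pT cM eM.
Qed.
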